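(* Let $(M,c,\sigma)$ be an almost Riemannian structure whose scale tractor $I$ has $I^2$ nowhere vanishing, and let $\Sigma$ be the zero locus of $\sigma$. Let $f_0\in\Gamma\mathcal T^\Phi M[w_0]$ be an arbitrary extension to $M$ of given boundary data $f|_\Sigma$, set $h_0:=d+2w_0$, and assume $h_0\notin\mathbb Z_{\ge 2}$. Then for every $\ell\in\mathbb Z_{\ge1}$, $$f^{(\ell)}=\Big[\prod_{j=1}^{\ell}\frac{c_j}{j(h_0-j-1)}\Big]f_0$$ is of the form $f^{(\ell)}=f_0+\sigma f_1+\sigma^2f_2+\cdots+\sigma^\ell f_\ell+O(\sigma^{\ell+1})$ with $f_i\in\Gamma\mathcal T^\Phi M[w_0-i]$, and solves $$y\,f^{(\ell)}=O(\sigma^\ell).$$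
   Context: $M$ is a smooth manifold of dimension $d\ge3$ with conformal class $c$. $\mathcal EM[w]$ is the line bundle of conformal densities of weight $w$ (families of functions $\mu_g$, $g\in c$, with $\mu_{\Omega^2g}=\Omega^w\mu_g$); each $g\in c$ trivialises these. $\boldsymbol g$ is the conformal metric. For $g\in c$ the standard tractor bundle splits as $\mathcal TM\cong\mathcal EM[1]\oplus T^*M[1]\oplus\mathcal EM[-1]$, the triples $(\alpha,\mu_a,\beta)$ transforming under $\hat g=e^{2\omega}g$, $\Upsilon=d\omega$, by $(\alpha,\ \mu_b+\alpha\Upsilon_b,\ \beta-\Upsilon^c\mu_c-\tfrac12\alpha\Upsilon^c\Upsilon_c)$. It carries the tractor connection $\nabla_a(\alpha,\mu_b,\beta)=(\nabla_a\alpha-\mu_a,\ \nabla_a\mu_b+\boldsymbol g_{ab}\beta+P_{ab}\alpha,\ \nabla_a\beta-P_{ac}\mu^c)$ and the parallel tractor metric with quadratic form $\boldsymbol g^{-1}(\mu,\mu)+2\alpha\beta$. Here $P_{ab}$ is the Schouten tensor, $\mathrm{Ric}=(d-2)P+Jg$, $J=P^a{}_a$. $\mathcal T^\Phi M$ is any tensor bundle built from $\mathcal TM$, and $\mathcal T^\Phi M[w]=\mathcal T^\Phi M\otimes\mathcal EM[w]$. An almost Riemannian structure $(M,c,\sigma)$ is a conformal manifold with a section $\sigma\in\Gamma\mathcal EM[1]$ (defining scale) nowhere zero on an open dense set; here $\sigma$ is a defining density for $\Sigma$. Its scale tractor is, in a scale $g$, $I=(\sigma,\nu,\rho)$ with $\nu=\nabla\sigma$,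 $\rho=-\frac1d(\nabla^a\nabla_a\sigma+J\sigma)$, and $I^2=|\nu|^2+2\sigma\rho$. With $\nabla$ the coupled Levi-Civita/tractor connection, on $V\in\Gamma\mathcal T^\Phi M[w]$ the contraction of $I$ with the Thomas D-operator $D^AV=\big((d+2w-2)wV,\ (d+2w-2)\nabla_aV,\ -(\nabla^a\nabla_a+Jw)V\big)$ is $$I\cdot D\,V=(d+2w-2)(\nabla_\nu V+w\rho V)-\sigma(\nabla^a\nabla_a+Jw)V .$$ Operators: $xV=\sigma V$; $hV=(d+2w)V$; $yV=-\frac1{I^2}I\cdot D\,V$ (which lowers weight by one). For $j\in\mathbb Z$, $c_j:=xy+j(h-j-1)$. $O(\sigma^\ell)$ means $\sigma^\ell$ times a smooth section. *)

(* Defs.v *)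
From HB Require Import structures.
From mathcomp Require Import all_boot all_order all_algebra perm.
From mathcomp Require Import all_classical all_reals all_analysis.

Set Implicit Arguments.
Unset Strict Implicit.
Unset Printing Implicit Defensive.

Import Order.TTheory GRing.Theory Num.Theory.
Import numFieldNormedType.Exports.

Local Open Scope classical_set_scope.
Local Open Scope ring_scope.

(** * Smooth functions and smooth manifolds *)

Definition partial (R : realType) (d : nat) (k : 'I_d) (f : 'rV[R]_d -> R) :
  'rV[R]_d -> R := fun x => 'D_(delta_mx 0 k) f x.

(** C^oo on an open set: the iterated partial derivatives of all orders exist
    and are continuous. *)
Definition smooth_on (R : realType) (d : nat) (U : set 'rV[R]_d)
    (f : 'rV[R]_d -> R) : Prop :=
  forall (s : seq 'I_d) (x : 'rV[R]_d), U x ->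
    let h := foldr (@partial R d) f s in
    {for x, continuous h} /\ forall k : 'I_d, derivable h x (delta_mx 0 k).

(** [chart_coord i] and [chart_param i] are total functions, meaningful only on
    [chart_dom i] and on [chart_coord i @` chart_dom i], where they are mutually
    inverse homeomorphisms. *)
Record smooth_manifold (R : realType) (d : nat) := SmoothManifold {
  carrier :> topologicalType;
  chart : Type;
  chart_dom : chart -> set carrier;
  chart_coord : chart -> carrier -> 'rV[R]_d;
  chart_param : chart -> 'rV[R]_d -> carrier;
  carrier_hausdorff : hausdorff_space carrier;
  carrier_countable : @second_countable carrier;
  dom_open : forall i, open (chart_dom i);
  image_open : forall i, open (chart_coord i @` chart_dom i);
  chart_coordK : forall i p, chart_dom i p ->
    chart_param i (chart_coord i p) = p;
  coord_continuous : forall i p, chart_dom i p ->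
    {for p, continuous (chart_coord i)};
  param_continuous : forall i x, (chart_coord i @` chart_dom i) x ->
    {for x, continuous (chart_param i)};
  dom_cover : forall p, exists i, chart_dom i p;
  transition_smooth : forall i j (k : 'I_d),
    smooth_on (chart_coord i @` (chart_dom i `&` chart_dom j))
      (fun x => chart_coord j (chart_param i x) 0 k)
}.

Section ManifoldCalculus.
Variables (R : realType) (d : nat) (M : smooth_manifold R d).
Implicit Types (i j : chart M) (p : M) (f : M -> R).

Definition smooth_in i f : Prop :=
  smooth_on (chart_coord i @` chart_dom i) (f \o chart_param i).

Definition smooth_fun f : Prop := forall i, smooth_in i f.

(** [pd i k f p] is df/dx^k at [p], [x] being the coordinates of chart [i]. *)
Definition pd i (k : 'I_d) f p : R :=
  partial k (f \o chart_param i) (chart_coord i p).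

(** [jac i j p a b] is dy^b/dx^a, for [x], [y] the coordinates of [i], [j]. *)
Definition jac i j p (a b : 'I_d) : R :=
  pd i a (fun q => chart_coord j q 0 b) p.

(** A metric is given by its Gram matrix in every chart.  Values outside
    [chart_dom i] are irrelevant throughout. *)
Definition metric := chart M -> M -> 'M[R]_d.

(** Any signature is allowed. *)
Definition is_metric (g : metric) : Prop :=
  [/\ forall i p, chart_dom i p -> g i p \in unitmx,
      forall i p, chart_dom i p -> (g i p)^T = g i p,
      forall i a b, smooth_in i (fun p => g i p a b) &
      forall i j p a b, chart_dom i p -> chart_dom j p ->
        g i p a b = \sum_k \sum_l jac i j p a k * jac i j p b l * g j p k l].

(** [rescales w g g'] says g' = e^(2w) g. *)
Definition rescales (w : M -> R) (g g' : metric) : Prop :=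
  forall i p, chart_dom i p -> g' i p = expR (2 * w p) *: g i p.

Definition is_conformal_class (c : set metric) : Prop :=
  [/\ c !=set0, c `<=` is_metric &
      forall g g', c g ->
        (c g' <-> exists2 w, smooth_fun w & rescales w g g')].

(** * Levi-Civita connection and Schouten tensor of a scale *)

Section Scale.
Variable g : metric.

(** Inverse metric g^{ab}. *)
Definition ginv i p (a b : 'I_d) : R := invmx (g i p) a b.

(** [christoffel i p k a b] is Gamma^k_{ab}. *)
Definition christoffel i p (k a b : 'I_d) : R :=
  2^-1 * \sum_l ginv i p k l *
    (pd i a (fun q => g i q l b) p + pd i b (fun q => g i q l a) p
     - pd i l (fun q => g i q a b) p).

(** Sign convention: positive on round spheres. *)
Definition ricci i p (a b : 'I_d) : R :=
  \sum_k (pd i k (fun q => christoffel i q k a b) p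
          - pd i a (fun q => christoffel i q k k b) p
          + \sum_l (christoffel i p k k l * christoffel i p l a b
                    - christoffel i p k a l * christoffel i p l k b)).

Definition scalar_curv i p : R :=
  \sum_a \sum_b ginv i p a b * ricci i p a b.

(** [Jtrace] and [schouten] solve Ric = (d - 2) P + J g, J = g^{ab} P_{ab};
    tracing the first equation gives Sc = 2 (d - 1) J. *)
Definition Jtrace i p : R := scalar_curv i p / (2 * (d%:R - 1)).

Definition schouten i p (a b : 'I_d) : R :=
  (ricci i p a b - Jtrace i p * g i p a b) / (d%:R - 2).

Definition laplacian i (f : M -> R) p : R :=
  \sum_a \sum_b ginv i p a b *
    (pd i a (pd i b f) p - \sum_k christoffel i p k a b * pd i k f p).

End Scale.

(** * Conformal densities *)

Definition density := metric -> M -> R.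

Definition is_density (c : set metric) (w : R) (mu : density) : Prop :=
  (forall g, c g -> smooth_fun (mu g)) /\
  (forall g g' om, c g -> c g' -> smooth_fun om -> rescales om g g' ->
     forall p, mu g' p = expR (w * om p) * mu g p).

(** * Tractors *)

(** Indices of the slots of a tractor (alpha, mu_a, beta). *)
Definition tix := option (option 'I_d).
Definition top : tix := None.
Definition bot : tix := Some None.
Definition mid (a : 'I_d) : tix := Some (Some a).

(** Change of coordinates: components in chart [i] from those in chart [j]. *)
Definition chart_mx i j p (A B : tix) : R :=
  match A, B with
  | None, None => 1
  | Some (Some a), Some (Some b) => jac i j p a b
  | Some None, Some None => 1
  | _, _ => 0
  end.

(** Change of scale, in chart [i], from [g] to e^(2om) g, with Upsilon = d om.
    The slots alpha, mu, beta of the standard tractor bundle are densities of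
    weights 1, 1, -1; hence the exponential factors. *)
Definition scale_mx (g : metric) (om : M -> R) i p (A B : tix) : R :=
  let U a := pd i a om p in
  match A, B with
  | None, None => expR (om p)
  | Some (Some a), None => expR (om p) * U a
  | Some (Some a), Some (Some b) => expR (om p) * (a == b)%:R
  | Some None, None =>
      - expR (- om p) * (2^-1 * \sum_a \sum_b ginv g i p a b * U a * U b)
  | Some None, Some (Some b) => - expR (- om p) * \sum_a ginv g i p a b * U a
  | Some None, Some None => expR (- om p)
  | _, _ => 0
  end.

(** Tractor metric: the polarization of g^{-1}(mu, mu) + 2 alpha beta. *)
Definition tmetric (g : metric) i p (A B : tix) : R :=
  match A, B with
  | None, Some None | Some None, None => 1
  | Some (Some a), Some (Some b) => ginv g i p a b
  | _, _ => 0
  end.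

Definition tmetric_inv (g : metric) i p (A B : tix) : R :=
  match A, B with
  | None, Some None | Some None, None => 1
  | Some (Some a), Some (Some b) => g i p a b
  | _, _ => 0
  end.

(** Connection form of the tractor connection: the [A] slot of nabla_a t is
    d_a t_A + \sum_B tconn a A B * t_B. *)
Definition tconn (g : metric) i p (a : 'I_d) (A B : tix) : R :=
  match A, B with
  | None, Some (Some b) => - (a == b)%:R
  | Some (Some b), None => schouten g i p a b
  | Some (Some b), Some (Some k) => - christoffel g i p k a b
  | Some (Some b), Some None => g i p a b
  | Some None, Some (Some k) => - \sum_b schouten g i p a b * ginv g i p b k
  | _, _ => 0
  end.

Section TractorTensors.
Variable n : nat.

Definition tindex := {ffun 'I_n -> tix}.
Definition tensor := tindex -> R.

(** Weighted tractor tensors: a family of components, one for each scale and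
    chart. *)
Definition tfield := metric -> chart M -> M -> tensor.

Definition upd (A : tindex) (m : 'I_n) (B : tix) : tindex :=
  [ffun k => if k == m then B else A k].

(** Natural endomorphisms of the n-th tensor power of the standard tractor
    bundle: they are generated by the permutations of the indices and the
    operators [Trace r s], which contract the indices [r] and [s] by the tractor
    metric and put the inverse metric in their place. *)
Inductive natural_endo :=
  | Perm of 'S_n
  | Trace (r s : 'I_n) of r != s
  | Scale of R & natural_endo
  | Add of natural_endo & natural_endo
  | Comp of natural_endo & natural_endo.

Fixpoint endo_act (g : metric) i p (e : natural_endo) (V : tensor) : tensor :=
  match e with
  | Perm s => fun A => V [ffun k => A (s k)]
  | @Trace r s _ => fun A => tmetric_inv g i p (A r) (A s) *
      \sum_B \sum_C tmetric g i p B C * V (upd (upd A r B) s C)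
  | Scale a e1 => fun A => a * endo_act g i p e1 V A
  | Add e1 e2 => fun A => endo_act g i p e1 V A + endo_act g i p e2 V A
  | Comp e1 e2 => endo_act g i p e1 (endo_act g i p e2 V)
  end.

(** [is_section c Phi w V]: [V] is a smooth section, of weight [w], of the
    bundle of tractor tensors of rank [n] and symmetry type [Phi], i.e. of those
    annihilated by all the endomorphisms in [Phi] (e.g. 1 + (r s) for skewness,
    [Trace r s] for trace-freeness).  The tractor metric identifies the standard
    tractor bundle with its dual, so that dual factors are not needed. *)
Definition is_section (c : set metric) (Phi : set natural_endo) (w : R)
    (V : tfield) : Prop :=
  [/\ forall g i A, c g -> smooth_in i (fun p => V g i p A),
      forall g i j p A, c g -> chart_dom i p -> chart_dom j p ->
        V g i p A =
          \sum_(B : tindex) (\prod_m chart_mx i j p (A m) (B m)) * V g j p B,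
      forall g g' om, c g -> c g' -> smooth_fun om -> rescales om g g' ->
        forall i p A, chart_dom i p ->
          V g' i p A = expR (w * om p) *
            \sum_(B : tindex) (\prod_m scale_mx g om i p (A m) (B m))
                              * V g i p B &
      forall g i p e A, c g -> chart_dom i p -> Phi e ->
        endo_act g i p e (V g i p) A = 0].

Definition agree (c : set metric) (V W : tfield) : Prop :=
  forall g i p A, c g -> chart_dom i p -> V g i p A = W g i p A.

(** Coupled Levi-Civita/tractor connection; in the scale [g] the density factor
    does not contribute. *)
Definition nabla (g : metric) i (a : 'I_d) (V : M -> tensor) p : tensor :=
  fun A => pd i a (fun q => V q A) p
    + \sum_(m < n) \sum_B tconn g i p a (A m) B * V p (upd A m B).

Definition tlaplacian (g : metric) i (V : M -> tensor) p : tensor := fun A =>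
  \sum_a \sum_b ginv g i p a b *
    (nabla g i a (nabla g i b V) p A
     - \sum_k christoffel g i p k a b * nabla g i k V p A).

(** The slots of D^A V, for [V] of weight [w]. *)
Definition thomasD (w : R) (V : tfield) (g : metric) i p (B : tix) : tensor :=
  fun A => match B with
  | None => (d%:R + 2 * w - 2) * w * V g i p A
  | Some (Some a) => (d%:R + 2 * w - 2) * nabla g i a (V g i) p A
  | Some None =>
      - (tlaplacian g i (V g i) p A + Jtrace g i p * w * V g i p A)
  end.

End TractorTensors.

(** * Almost Riemannian structures *)

Section AlmostRiemannian.
Variables (c : set metric) (sigma : density).

Definition almost_riemannian : Prop :=
  [/\ is_conformal_class c, is_density c 1 sigma &
      exists U : set M, [/\ open U, dense U &
        forall g p, c g -> U p -> sigma g p != 0]].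

Definition zero_locus : set M := [set p | forall g, c g -> sigma g p = 0].

(** (sigma, nu, rho) *)
Definition scale_tractor (g : metric) i p (A : tix) : R :=
  match A with
  | None => sigma g p
  | Some (Some a) => pd i a (sigma g) p
  | Some None =>
      - d%:R^-1 * (laplacian g i (sigma g) p + Jtrace g i p * sigma g p)
  end.

Definition Isq (g : metric) i p : R :=
  \sum_A \sum_B tmetric g i p A B *
    scale_tractor g i p A * scale_tractor g i p B.

Variable n : nat.
Implicit Type V : tfield n.

Definition IdotD (w : R) V : tfield n := fun g i p A =>
  \sum_B \sum_C tmetric g i p B C *
    scale_tractor g i p B * thomasD w V g i p C A.

(** The operators depend on the weight [w] of their argument: [x_op] raises it
    by one and [y_op w] lowers it by one. *)
Definition x_op V : tfield n := fun g i p A => sigma g p * V g i p A.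

Definition h_op (w : R) V : tfield n := fun g i p A =>
  (d%:R + 2 * w) * V g i p A.

Definition y_op (w : R) V : tfield n := fun g i p A =>
  - (Isq g i p)^-1 * IdotD w V g i p A.

Definition c_op (j : int) (w : R) V : tfield n := fun g i p A =>
  x_op (y_op w V) g i p A
  + j%:~R * (h_op w V g i p A - j%:~R * V g i p A - V g i p A).

(** The product over 1 <= j <= l of c_j / (j (h0 - j - 1)), applied to [f0] of
    weight [w0], where h0 = d + 2 w0; the c_j preserve the weight. *)
Definition f_iter (w0 : R) (f0 : tfield n) (l : nat) : tfield n :=
  foldr (fun (j : nat) V => fun g i p A =>
           (j%:R * (d%:R + 2 * w0 - j%:R - 1))^-1 * c_op j%:Z w0 V g i p A)
        f0 (iota 1 l).

(** [V], of weight [w], is O(sigma^k). *)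
Definition O_sigma (Phi : set (natural_endo n)) (w : R) (k : nat) V : Prop :=
  exists2 G, is_section c Phi (w - k%:R) G &
    agree c V (fun g i p A => sigma g p ^+ k * G g i p A).

End AlmostRiemannian.
End ManifoldCalculus.

(* Main.v *)
(** Write [h] for d + 2w.  Since [x, y] = h, one has y c_j = c_(j-1) y, whence
    y c_1 ... c_l f0 = sigma^l y^(l+1) f0, while c_j / (j (h0 - j - 1)) is the
    identity plus a constant times sigma y.  Both claims follow once y is known to
    map sections to sections, i.e. once I.D is invariant under changes of chart and
    of scale and commutes with the natural endomorphisms.

    These invariances are identities in a commutative ring with derivations, that
    of the smooth functions on an open set of R^d.  A change of scale multiplies
    the metric by E^2, a change of chart replaces the derivations D' by D = J D';
    in both cases, and for a natural endomorphism, a linear map S intertwines the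
    tractor connections.  On the overlap of two charts everything is written in the
    ring of the first one, the derivations of the second being combinations of
    those of the first with coefficients in the inverse Jacobian matrix: thus only
    the first-order chain rule is used. *)

Require Import Defs.
From HB Require Import structures.
From mathcomp Require Import all_boot all_order all_algebra perm.
From mathcomp Require Import all_classical all_reals all_analysis.
From mathcomp Require Import ring.

Set Implicit Arguments.
Unset Strict Implicit.
Unset Printing Implicit Defensive.

Import Order.TTheory GRing.Theory Num.Theory.
Import numFieldNormedType.Exports.

Local Open Scope classical_set_scope.
Local Open Scope ring_scope.

(** * Smooth functions of several variables *)

(** Inverses (of 2, of [d], of the conformal factor) are atoms for [ring], because [A] is only a
    commutative ring; this is why their defining equations are inserted by hand in the computations.
    [IdD] takes the tractor connection [nb] as a parameter, separate from the metric that enters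
    through the Christoffel symbols, J and rho. This cuts a change of scale in two: [IdD_conf]
    changes the metric and keeps [nb], then [IdD_parallel] passes to the connection that [nb] is
    intertwined with. The coefficient d + 2w - 2 serves the first half, the conformal law of the
    Schouten tensor the second. The constant j (h - j - 1) in c_j is forced. If c_j = xy + k_j(h) is
    to satisfy y c_(j+1) = c_j y, then [x, y] = h gives k_(j+1)(h) - (h - 2) = k_j(h - 2), as y
    lowers h by 2, and k_0 = 0 determines the rest. Each power of sigma in y f^(l) comes from a
    factor that powers of y have lowered to c_0 = xy. *)

Section SmoothOn.
Variables (R : realType) (d : nat).
Implicit Types (U : set 'rV[R]_d) (f g : 'rV[R]_d -> R) (k : 'I_d).

Lemma near_partial U f g k x : open U -> (forall y, U y -> f y = g y) -> U x ->
  partial k f x = partial k g x.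
Proof.
move=> Uo fg Ux; apply: near_eq_derive; near=> y; apply: fg; near: y.
exact: open_nbhs_nbhs.
Unshelve. all: by end_near. Qed.

Lemma smooth_on_partial U f k : smooth_on U f -> smooth_on U (partial k f).
Proof. by move=> sf s x Ux; have := sf (rcons s k) x Ux; rewrite /= foldr_rcons. Qed.

Lemma smooth_on_sub U V f : V `<=` U -> smooth_on U f -> smooth_on V f.
Proof. by move=> VU sf s x /VU; exact: sf. Qed.

(** Coinduction: by stability every iterated derivative of [f] agrees on [U] with a member of [P].
    As [U] is open, agreement on [U] transfers continuity and derivability at its points. *)
Lemma smooth_on_coind U (P : ('rV[R]_d -> R) -> Prop) f : open U ->
  (forall h, P h -> forall x, U x ->
    {for x, continuous h} /\ forall k, derivable h x (delta_mx 0 k)) ->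
  (forall h k, P h -> exists2 h', P h' & forall x, U x -> partial k h x = h' x) ->
  P f -> smooth_on U f.
Proof.
move=> Uo Preg Pder Pf s.
have [h Ph fh] : exists2 h, P h & forall x, U x -> foldr (@partial R d) f s x = h x.
  elim: s => [|k s [h Ph fh]] /=; first by exists f.
  have [h' Ph' hh'] := Pder h k Ph; exists h' => // x Ux.
  by rewrite -hh'//; apply: near_partial Ux.
move=> x Ux /=; have [ch dh] := Preg h Ph x Ux.
have hf : \near x, h x = foldr (@partial R d) f s x.
  by near=> y; rewrite fh //; near: y; exact: open_nbhs_nbhs.
split=> [|k].
  apply: cvg_trans; first exact: (near_eq_cvg hf).
  by rewrite fh.
by apply: near_eq_derivable (dh k).
Unshelve. all: by end_near. Qed.

(* This class is stable under partial derivatives up to equality on [U], whence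
   all the closure properties of smooth functions at once. *)
Inductive smooth_gen U : ('rV[R]_d -> R) -> Prop :=
| Gen_smooth f of smooth_on U f : smooth_gen U f
| Gen_cst r : smooth_gen U (cst r)
| Gen_add f g of smooth_gen U f & smooth_gen U g : smooth_gen U (f + g)
| Gen_mul f g of smooth_gen U f & smooth_gen U g : smooth_gen U (f * g)
| Gen_exp f of smooth_gen U f : smooth_gen U (expR \o f)
| Gen_inv f of smooth_gen U f & (forall x, U x -> f x != 0) :
    smooth_gen U (fun x => (f x)^-1).

(** A directional derivative is the derivative of the restriction to a line, which gives access to
    the chain rule and the mean value theorem in one variable. *)
Lemma is_derive_slice f (y v : 'rV[R]_d) (t : R) : derivable f (t *: v + y) v ->
  is_derive t 1 (fun s => f (s *: v + y)) ('D_v f (t *: v + y)).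
Proof.
have E : (fun h : R => h^-1 *: (((fun s => f (s *: v + y)) \o shift t) (h *: 1) - f (t *: v + y)))
   = (fun h => h^-1 *: ((f \o shift (t *: v + y)) (h *: v) - f (t *: v + y))).
  by apply/funext => h /=; rewrite [_%:A]mulr1 scalerDl addrA.
by move=> df; split; [rewrite /derivable E|rewrite /derive E].
Qed.

Lemma is_derive_expR_comp f (x v : 'rV[R]_d) : derivable f x v ->
  is_derive x v (fun y => expR (f y)) (expR (f x) * 'D_v f x).
Proof.
move=> df; have x0 : x = 0 *: v + x by rewrite scale0r add0r.
have [dg Dg] : is_derive (0 : R) 1 (fun s => f (s *: v + x)) ('D_v f x).
  by rewrite [in 'D_v f x]x0; apply: is_derive_slice; rewrite -x0.
have de : derivable expR (f (0 *: v + x)) 1 by exact: derivable_expR.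
have dh : derivable (fun y => expR (f y)) x v.
  apply/derivable1P/derivable1_diffP.
  by apply: (@differentiable_comp _ _ _ _ (fun s : R => f (s *: v + x)) expR);
    exact/derivable1_diffP.
split=> //.
have [|_] := @is_derive_slice (fun y => expR (f y)) x v 0; first by rewrite -x0.
rewrite -x0 => <-.
by have := derive1_comp dg de; rewrite !derive1E Dg derive_val -x0.
Qed.

Lemma smooth_gen_reg U h : smooth_gen U h -> forall x, U x ->
  {for x, continuous h} /\ forall k, derivable h x (delta_mx 0 k).
Proof.
elim=> {h} [f sf|r|f g _ IHf _ IHg|f g _ IHf _ IHg|f _ IHf|f _ IHf f0] x Ux.
- exact: (sf [::]).
- by split=> [|k]; [exact: cst_continuous|exact: derivable_cst].
- have [[cf df] [cg dg]] := (IHf x Ux, IHg x Ux).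
  by split=> [|k]; [exact: continuousD|exact: derivableD].
- have [[cf df] [cg dg]] := (IHf x Ux, IHg x Ux).
  by split=> [|k]; [exact: continuousM|exact: derivableM].
- have [cf df] := IHf x Ux; split=> [|k].
    by apply: continuous_comp => //; exact: continuous_expR.
  by have [] := is_derive_expR_comp (df k).
- have [cf df] := IHf x Ux; split=> [|k].
    by apply: continuousV => //; exact: f0.
  by apply: derivableV => //; exact: f0.
Qed.

Lemma smooth_gen_on U f : open U -> smooth_gen U f -> smooth_on U f.
Proof.
move=> Uo; apply: smooth_on_coind => // {f}.
  by move=> h /smooth_gen_reg.
move=> f k; elim=> {f}
    [f sf|r|f g Gf [f' Gf' ff'] Gg [g' Gg' gg']|f g Gf [f' Gf' ff'] Gg [g' Gg' gg']
    |f Gf [f' Gf' ff']|f Gf [f' Gf' ff'] f0].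
- by exists (partial k f) => //; apply: Gen_smooth; exact: smooth_on_partial.
- exists (cst 0); first exact: Gen_cst.
  by move=> x _; rewrite /partial derive_cst.
- exists (f' + g'); first exact: Gen_add.
  move=> x Ux; rewrite /partial deriveD.
  + by rewrite -[LHS]/(partial k f x + partial k g x) ff' ?gg'.
  + by have [_] := smooth_gen_reg Gf Ux.
  + by have [_] := smooth_gen_reg Gg Ux.
- exists (f * g' + g * f'); first by do ?[exact: Gen_mul|apply: Gen_add].
  move=> x Ux; rewrite /partial deriveM.
  + by rewrite -[LHS]/(f x * partial k g x + g x * partial k f x) ff' ?gg'.
  + by have [_] := smooth_gen_reg Gf Ux.
  + by have [_] := smooth_gen_reg Gg Ux.
- exists ((expR \o f) * f'); first by apply: Gen_mul => //; exact: Gen_exp.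
  move=> x Ux; have [_ df] := smooth_gen_reg Gf Ux.
  by rewrite /partial; have [_ ->] := is_derive_expR_comp (df k); rewrite -/(partial k f x) ff'.
- pose fi x := (f x)^-1.
  have Gfi : smooth_gen U fi by exact: Gen_inv.
  exists (cst (-1) * (fi * fi) * f'); first by do ?[exact: Gen_cst|apply: Gen_mul].
  move=> x Ux; have [_ df] := smooth_gen_reg Gf Ux.
  rewrite /partial deriveV ?f0// -/(partial k f x) ff'//.
  by rewrite -[RHS]/(-1 * ((f x)^-1 * (f x)^-1) * f' x) mulN1r -expr2 exprVn.
Qed.

Lemma smooth_on_congr U f g : open U -> (forall x, U x -> f x = g x) ->
  smooth_on U f -> smooth_on U g.
Proof.
move=> Uo fg sf s.
have E x : U x -> foldr (@partial R d) g s x = foldr (@partial R d) f s x.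
  elim: s x => [|k s IHs] x Ux /=; first by rewrite fg.
  by apply: near_partial Ux.
move=> x Ux /=; have [ch dh] := sf s x Ux.
have hf : \near x, foldr (@partial R d) f s x = foldr (@partial R d) g s x.
  by near=> y; rewrite E //; near: y; exact: open_nbhs_nbhs.
split=> [|k].
  apply: cvg_trans; first exact: (near_eq_cvg hf).
  by rewrite E.
by apply: near_eq_derivable (dh k).
Unshelve. all: by end_near. Qed.

Lemma smooth_on_derivable U f k x : smooth_on U f -> U x -> derivable f x (delta_mx 0 k).
Proof. by move=> sf Ux; have [_] := sf [::] x Ux. Qed.

Lemma smooth_on_cst U r : open U -> smooth_on U (cst r).
Proof. by move=> Uo; apply: smooth_gen_on => //; exact: Gen_cst. Qed.

Lemma smooth_onD U f g : open U -> smooth_on U f -> smooth_on U g -> smooth_on U (f + g).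
Proof. by move=> Uo sf sg; apply: smooth_gen_on => //; apply: Gen_add; exact: Gen_smooth. Qed.

Lemma smooth_onM U f g : open U -> smooth_on U f -> smooth_on U g -> smooth_on U (f * g).
Proof. by move=> Uo sf sg; apply: smooth_gen_on => //; apply: Gen_mul; exact: Gen_smooth. Qed.

Lemma smooth_on_exp U f : open U -> smooth_on U f -> smooth_on U (expR \o f).
Proof. by move=> Uo sf; apply: smooth_gen_on => //; apply: Gen_exp; exact: Gen_smooth. Qed.

Lemma smooth_on_inv U f : open U -> smooth_on U f -> (forall x, U x -> f x != 0) ->
  smooth_on U (fun x => (f x)^-1).
Proof. by move=> Uo sf f0; apply: smooth_gen_on => //; apply: Gen_inv => //; exact: Gen_smooth. Qed.

(** * Mean value theorem, symmetry of second derivatives, chain rule *)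

Lemma MVT_slice f (x v : 'rV[R]_d) (t : R) : 0 <= t ->
  (forall s, 0 <= s <= t -> derivable f (s *: v + x) v) ->
  exists2 s, 0 <= s <= t & f (t *: v + x) - f x = t * 'D_v f (s *: v + x).
Proof.
move=> t0 df.
have [||s] := @MVT_segment R (fun s => f (s *: v + x)) (fun s => 'D_v f (s *: v + x)) 0 t t0.
- move=> s; rewrite in_itv /= => /andP[s0 st].
  by apply: is_derive_slice; apply: df; rewrite !ltW.
- apply: derivable_within_continuous => s; rewrite in_itv /= => st.
  by have [] := is_derive_slice (df _ st).
- by rewrite in_itv /= scale0r add0r subr0 mulrC => st E; exists s.
Qed.

Lemma is_derive_translate f (w y v : 'rV[R]_d) : derivable f (w + y) v ->
  is_derive y v (fun z => f (w + z)) ('D_v f (w + y)).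
Proof.
have E : (fun h : R => h^-1 *: (((fun z => f (w + z)) \o shift y) (h *: v) - f (w + y)))
   = (fun h => h^-1 *: ((f \o shift (w + y)) (h *: v) - f (w + y))).
  by apply/funext => h /=; rewrite addrCA.
by move=> df; split; [rewrite /derivable E|rewrite /derive E].
Qed.

(** The mean value theorem is applied in direction [u] to f(t v + y) - f(y), then in direction [v]
    to the derivative of [f] along [u]. The left-hand side is symmetric in [u] and [v], which is
    what [partialC] exploits. *)
Lemma second_difference f (x u v : 'rV[R]_d) (t : R) : 0 <= t ->
  (forall s s', 0 <= s <= t -> 0 <= s' <= t ->
     derivable f (s *: u + (s' *: v + x)) u /\
     derivable (fun y => 'D_u f y) (s *: u + (s' *: v + x)) v) ->
  exists s s', [/\ 0 <= s <= t, 0 <= s' <= t &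
    f (t *: u + (t *: v + x)) - f (t *: u + x) - (f (t *: v + x) - f x) =
    t * t * 'D_v (fun y => 'D_u f y) (s *: u + (s' *: v + x))].
Proof.
move=> t0 df.
have t1 : 0 <= t <= t by rewrite t0 lexx.
have t2 : 0 <= (0 : R) <= t by rewrite lexx t0.
have d1 s : 0 <= s <= t -> is_derive (s *: u + x) u (fun y => f (t *: v + y) - f y)
    ('D_u f (t *: v + (s *: u + x)) - 'D_u f (s *: u + x)).
  move=> st; apply: is_deriveB.
    by apply: is_derive_translate; rewrite addrCA; have [] := df _ _ st t1.
  apply: derivableP.
  by have [] := df _ _ st t2; rewrite scale0r add0r.
have [s st E1] : exists2 s, 0 <= s <= t &
    (f (t *: v + (t *: u + x)) - f (t *: u + x)) - (f (t *: v + x) - f x) =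
    t * ('D_u f (t *: v + (s *: u + x)) - 'D_u f (s *: u + x)).
  have [s st|s st ->] := @MVT_slice (fun y => f (t *: v + y) - f y) x u t t0.
    by have [] := d1 s st.
  by exists s => //; have [_ ->] := d1 s st.
have [s' st'|s' st' E2] := @MVT_slice (fun y => 'D_u f y) (s *: u + x) v t t0.
  by rewrite addrCA; have [] := df _ _ st st'.
exists s, s'; split; [exact: st|exact: st'|].
by rewrite addrCA E1 E2 [_ *: u + (_ + _)]addrCA mulrA.
Qed.

(** Both mixed derivatives, each at some point of a small box at [x], equal the same second
    difference divided by t^2; their continuity at [x] does the rest. *)
Lemma partialC U f a b x : open U -> smooth_on U f -> U x ->
  partial a (partial b f) x = partial b (partial a f) x.
Proof.
move=> Uo sf Ux.
set u : 'rV[R]_d := delta_mx 0 a; set v : 'rV[R]_d := delta_mx 0 b.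
have [c1 _] := sf [:: a; b] x Ux; have [c2 _] := sf [:: b; a] x Ux.
apply/eqP; rewrite -subr_eq0 -normr_le0; apply/ler_addgt0Pr => e e0; rewrite add0r.
have near1 : \forall y \near x, [/\ U y,
     `|partial a (partial b f) x - partial a (partial b f) y| <= e / 2 &
     `|partial b (partial a f) x - partial b (partial a f) y| <= e / 2].
  have e2 : 0 < e / 2 by rewrite divr_gt0.
  have n1 : \forall y \near x, U y by exact: open_nbhs_nbhs.
  have n2 : \forall y \near x, `|partial a (partial b f) x - partial a (partial b f) y| <= e / 2.
    by move/cvgrPdist_le : c1 => /(_ _ e2).
  have n3 : \forall y \near x, `|partial b (partial a f) x - partial b (partial a f) y| <= e / 2.
    by move/cvgrPdist_le : c2 => /(_ _ e2).
  by apply: (@filterS3 _ (nbhs x) (nbhs_filter x) _ _ _ _ _ n1 n2 n3) => y Uy h2 h3.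
have /nbhs_ballP[r /= r0 rP] := near1.
(* The box of side [t] spanned by [u] and [v] at [x] then lies in the ball of radius [r]; the + 1
   keeps the denominator positive. *)
pose t := r / 2 / (`|u| + `|v| + 1).
have n0 : 0 < `|u| + `|v| + 1 by rewrite ltr_wpDl ?addr_ge0.
have t0 : 0 < t by rewrite !divr_gt0.
have box s s' : 0 <= s <= t -> 0 <= s' <= t -> ball x r (s *: u + (s' *: v + x)).
  move=> /andP[s0 st] /andP[s0' st'].
  rewrite -ball_normE /= opprD opprD addrCA [- (s' *: v) - x]addrC addNKr.
  rewrite -opprD normrN (le_lt_trans (ler_normD _ _))// !normrZ !ger0_norm//.
  have : s * `|u| + s' * `|v| <= t * (`|u| + `|v| + 1).
    rewrite mulrDr mulr1 mulrDr -[leLHS]addr0 lerD ?(ltW t0)//.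
    by rewrite lerD// ler_wpM2r.
  move=> /le_lt_trans; apply; rewrite /t divfK ?gt_eqF//.
  by rewrite ltr_pdivrMr// ltr_pMr// ltr1n.
have B c c' y : U y -> derivable (partial c f) y (delta_mx 0 c').
  by move=> Uy; apply: (@smooth_on_derivable U) => //; exact: smooth_on_partial.
have [|s [s' [hs hs' E1]]] := @second_difference f x v u t (ltW t0).
  move=> s s' hs hs'; have [Uy _ _] := rP _ (box _ _ hs' hs).
  by rewrite addrCA; split; [exact: smooth_on_derivable sf Uy|exact: (B b a)].
have [|s1 [s1' [hs1 hs1' E2]]] := @second_difference f x u v t (ltW t0).
  move=> s1 s1' hs1 hs1'; have [Uy _ _] := rP _ (box _ _ hs1 hs1').
  by split; [exact: smooth_on_derivable sf Uy|exact: (B a b)].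
have tt0 : t * t != 0 by rewrite mulf_neq0 ?gt_eqF.
have E : partial a (partial b f) (s *: v + (s' *: u + x)) =
         partial b (partial a f) (s1 *: u + (s1' *: v + x)).
  apply: (mulfI tt0); rewrite -[LHS]E1 -[RHS]E2 [t *: u + (_ + _)]addrCA.
  by ring.
have [_ Q1 _] := rP _ (box _ _ hs' hs); have [_ _ Q2] := rP _ (box _ _ hs1 hs1').
rewrite addrCA E in Q1.
rewrite (splitr e); apply: le_trans (lerD Q1 Q2).
rewrite [X in _ <= _ + X]distrC; apply: le_trans (ler_normD _ _).
by rewrite subrKA.
Qed.

(** For negative [t] the segment is run backwards, starting from its other end. *)
Lemma MVT_slice_norm f (x v : 'rV[R]_d) (t : R) :
  (forall s, `|s| <= `|t| -> derivable f (s *: v + x) v) ->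
  exists2 s, `|s| <= `|t| & f (t *: v + x) - f x = t * 'D_v f (s *: v + x).
Proof.
move=> df; have [t0|t0] := leP 0 t.
  have [s /andP[s0 st]|s /andP[s0 st] E] := @MVT_slice f x v t t0.
    by apply: df; rewrite !ger0_norm.
  by exists s => //; rewrite !ger0_norm.
have nt : `|t| = - t by rewrite ltr0_norm.
have mt0 : 0 <= - t by rewrite oppr_ge0 ltW.
have B s : 0 <= s <= - t -> `|s + t| <= `|t|.
  by move=> /andP[s0 st]; rewrite nt ler0_norm -?lerBrDr ?sub0r// opprD gerDr oppr_le0.
have [s hs|s hs] := @MVT_slice f (t *: v + x) v (- t) mt0.
  by rewrite addrA -scalerDl; apply: df; exact: B.
rewrite !addrA -!scalerDl addNr scale0r add0r => E.
exists (s + t); first exact: B.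
by rewrite -[LHS]opprB E mulNr opprK.
Qed.

(** The increment of [f] telescopes over the coordinates; each piece is a coordinate of [h] times a
    partial derivative at a nearby point, and these are continuous at [x]. *)
Lemma smooth_on_differentiable U f x : open U -> smooth_on U f -> U x ->
  is_diff x f (fun h : 'rV[R]_d => \sum_a h 0 a * partial a f x).
Proof.
move=> Uo sf Ux.
pose df (h : 'rV[R]_d) : R := \sum_a h 0 a * partial a f x.
have lin_df : linear df.
  move=> r h h'; rewrite /df scaler_sumr -big_split/=; apply: eq_bigr => a _.
  by rewrite !mxE mulrDl -mulrA.
pose L : {linear 'rV[R]_d -> R} := HB.pack df (GRing.isLinear.Build _ _ _ _ df lin_df).
have cL : continuous L.
  move=> h; apply: differentiable_continuous; rewrite /L/= /df.
  rewrite (_ : (fun _ => _) = \sum_a (fun h : 'rV[R]_d => h 0 a * partial a f x)); last first.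
    by apply/funext => y; rewrite fct_sumE.
  apply: differentiable_sum => a; apply: differentiableM => //.
  exact: differentiable_coord.
suff E : f \o shift x = cst (f x) + L +o_ (0 : 'rV[R]_d) id.
  have EL := diff_unique cL E.
  by split; [apply/diff_locallyP; rewrite EL|rewrite EL].
apply/eqaddoP => _/posnumP[e].
(* Each of the [d] coordinate steps costs at most [e'] times the norm of the increment; dividing by
   d + 1 rather than by d also covers d = 0. *)
pose e' := e%:num / d.+1%:R.
have e'0 : 0 < e' by rewrite divr_gt0.
have near1 : \forall y \near x, U y /\ forall a, `|partial a f x - partial a f y| <= e'.
  have n1 : \forall y \near x, U y by exact: open_nbhs_nbhs.
  have n2 : \forall y \near x, forall a, `|partial a f x - partial a f y| <= e'.
    have n3 a : \forall y \near x, `|partial a f x - partial a f y| <= e'.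
      have [c1 _] := sf [:: a] x Ux.
      by move/cvgrPdist_le : c1 => /(_ _ e'0).
    exact: (@filter_forall _ _ _ _ (nbhs_filter x) n3).
  by apply: (@filterS2 _ (nbhs x) (nbhs_filter x) _ _ _ _ n1 n2).
have /nbhs_ballP[r /= r0 rP] := near1.
apply/nbhs_ballP; exists r => //= h; rewrite -ball_normE /= sub0r normrN => hr.
(* Truncation of [h] to its first [k] coordinates: consecutive truncations differ in a single
   coordinate. *)
pose hk (k : nat) : 'rV[R]_d := \row_j (if (j < k)%N then h 0 j else 0).
have hle j : `|h 0 j| <= `|h|.
  rewrite [leRHS]/Num.Def.normr/= mx_normrE; exact: (le_bigmax _ _ (0, j)).
have ball_hk (a : 'I_d) s : `|s| <= `|h 0 a| -> ball x r (s *: delta_mx 0 a + (hk a + x)).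
  move=> sa; rewrite -ball_normE /= distrC addrA addrK.
  apply: le_lt_trans hr.
  rewrite [leLHS]/Num.Def.normr/= mx_normrE (bigmax_le _ (normr_ge0 _))//= => -[i j] _.
  rewrite !mxE/= (ord1 i) eqxx/=; have [->|ja] := eqVneq j a.
    by rewrite ltnn mulr1 addr0 (le_trans sa).
  by rewrite mulr0 add0r; case: ifP => _; rewrite ?normr0.
have step (a : 'I_d) : exists2 y, ball x r y &
    f (hk a.+1 + x) - f (hk a + x) = h 0 a * partial a f y.
  have [s hs|s hs E] := @MVT_slice_norm f (hk a + x) (delta_mx 0 a) (h 0 a).
    have [Uy _] := rP _ (ball_hk a s hs); exact: smooth_on_derivable sf Uy.
  exists (s *: delta_mx 0 a + (hk a + x)); first exact: ball_hk.
  rewrite -E; congr (f _ - _); rewrite addrA; congr (_ + x).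
  apply/rowP => j; rewrite !mxE/= ltnS leq_eqVlt.
  have [->|ja] := eqVneq j a; first by rewrite eqxx ltnn mulr1 addr0.
  by rewrite mulr0 add0r -[_ == _ :> nat]/(j == a) (negPf ja).
have hkd : hk d = h by apply/rowP => j; rewrite mxE ltn_ord.
have hk0 : hk 0%N = 0 by apply/rowP => j; rewrite !mxE.
have -> : (f \o shift x - (cst (f x) + L)) h =
    \sum_(a < d) ((f (hk a.+1 + x) - f (hk a + x)) - h 0 a * partial a f x).
  rewrite sumrB -(big_mkord xpredT (fun k : nat => f (hk k.+1 + x) - f (hk k + x))).
  rewrite telescope_sumr// hkd hk0 add0r.
  by rewrite -[LHS]/(f (h + x) - (f x + df h)) opprD addrA.
apply: (le_trans (ler_norm_sum _ _ _)).
apply: (@le_trans _ _ (\sum_(a < d) `|h| * e')).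
  apply: ler_sum => a _; have [y by_ ->] := step a; have [_ Py] := rP _ by_.
  by rewrite -mulrBr normrM ler_pM// distrC.
rewrite sumr_const card_ord -[leLHS]mulr_natr -mulrA mulrC ler_wpM2r ?normr_ge0//.
rewrite /e' mulrAC ler_pdivrMr// ler_wpM2l// ler_nat; exact: leqnSn.
Qed.

(** Along the line through [x] in direction [v], [phi] becomes a curve, so that derivability of its
    components in this one direction is enough; differentiability in the full sense is used for
    [f]. *)
Lemma chain_rule U f (phi : 'rV[R]_d -> 'rV[R]_d) (x v : 'rV[R]_d) : open U -> smooth_on U f ->
  U (phi x) -> (forall a, derivable (fun y => phi y 0 a) x v) ->
  'D_v (f \o phi) x = \sum_a 'D_v (fun y => phi y 0 a) x * partial a f (phi x).
Proof.
move=> Uo sf Ux dphi.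
have dphi' : derivable phi x v by apply/derivable_mxP => i j; rewrite ord1.
pose g (t : R) := phi (t *: v + x).
have x0 : 0 *: v + x = x by rewrite scale0r add0r.
have Dslice (W : normedModType R) (h : 'rV[R]_d -> W) :
    'D_v h x = 'D_1 (fun t : R => h (t *: v + x)) 0.
  rewrite /derive.
  suff -> : (fun s : R => s^-1 *: ((h \o shift x) (s *: v) - h x)) =
    (fun s : R => s^-1 *: (((fun t : R => h (t *: v + x)) \o shift 0) (s *: 1) - h (0 *: v + x))) by [].
  by apply/funext => s /=; rewrite x0 addr0 [_%:A]mulr1.
have dg : differentiable g 0.
  by apply/derivable1_diffP; exact: ((derivable1P phi x v).1 dphi').
have Ug : U (g 0) by rewrite /g x0.
have df : is_diff (g 0) f (fun h : 'rV[R]_d => \sum_a h 0 a * partial a f (g 0)).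
  exact: (smooth_on_differentiable Uo sf Ug).
have [dfd vfd] := df.
have dfg : differentiable (f \o g) 0 by exact: differentiable_comp.
rewrite Dslice -[fun t : R => _]/(f \o g) deriveE// diff_comp//=.
rewrite vfd -deriveE// /g x0; apply: eq_bigr => a _; congr (_ * _).
rewrite -(Dslice _ phi) derive_mx ?mxE//.
Qed.


End SmoothOn.

(** * Conformal geometry in a ring with derivations *)

Section FiniteSums.
Variables (A : comPzRingType) (I : finType).
Implicit Types (F : I -> A).

Lemma sum_delta F a : \sum_k (k == a)%:R * F k = F a.
Proof.
rewrite (bigD1 a) //= eqxx mul1r big1 ?addr0 // => k /negPf ->.
by rewrite mul0r.
Qed.

Lemma sum_delta' F a : \sum_k (a == k)%:R * F k = F a.
Proof. by under eq_bigr do rewrite eq_sym; exact: sum_delta. Qed.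

(** Associativity of the matrix product, in the form in which contractions of indices are regrouped
    throughout. *)
Lemma sum_contract (J : finType) (x : I -> J -> A) (y : I -> A) (z : J -> A) :
  \sum_k y k * (\sum_l x k l * z l) = \sum_l (\sum_k y k * x k l) * z l.
Proof.
under eq_bigr do rewrite mulr_sumr; rewrite exchange_big /=.
by apply: eq_bigr => l _; rewrite mulr_suml; apply: eq_bigr => k _; rewrite mulrA.
Qed.

End FiniteSums.

Section Derivations.
Variables (R : numFieldType) (A : comPzRingType) (io : {rmorphism R -> A}) (d : nat).

(** Commutation is kept out of this predicate and supplied where it enters, as [Uclosed], [Jsym] or
    [Dcomm]: the derivations of a second chart are linear combinations of those of the first, for
    which the Leibniz rule is immediate but commutation is not. *)
Definition derivations (D : 'I_d -> A -> A) : Prop :=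
  [/\ forall a u v, D a (u + v) = D a u + D a v,
      forall a u v, D a (u * v) = D a u * v + u * D a v &
      forall a r, D a (io r) = 0].

Definition metric_pair (g gi : 'I_d -> 'I_d -> A) : Prop :=
  [/\ forall a b, g a b = g b a, forall a b, gi a b = gi b a &
      forall a c, \sum_b g a b * gi b c = (a == c)%:R].

Section Definitions.
Variables (D : 'I_d -> A -> A) (g gi : 'I_d -> 'I_d -> A).

Definition Chr (k a b : 'I_d) : A :=
  io 2^-1 * \sum_l gi k l * (D a (g l b) + D b (g l a) - D l (g a b)).

Definition Ric (a b : 'I_d) : A :=
  \sum_k (D k (Chr k a b) - D a (Chr k k b)
    + \sum_l (Chr k k l * Chr l a b - Chr k a l * Chr l k b)).

Definition Scal : A := \sum_a \sum_b gi a b * Ric a b.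

Definition Jtr : A := Scal * io (2 * (d%:R - 1))^-1.

Definition Sch (a b : 'I_d) : A := (Ric a b - Jtr * g a b) * io (d%:R - 2)^-1.

(** [nb] acts on the indices in [X]; the Christoffel term accounts for the form index of [nb b V].
    With [X] = [unit] and [nb] = [D] this is the scalar Laplacian [Lap0]. *)
Definition Lap X (nb : 'I_d -> (X -> A) -> X -> A) (V : X -> A) : X -> A := fun x =>
  \sum_a \sum_b gi a b * (nb a (nb b V) x - \sum_k Chr k a b * nb k V x).

Definition Lap0 (u : A) : A :=
  \sum_a \sum_b gi a b * (D a (D b u) - \sum_k Chr k a b * D k u).

Definition rho (s : A) : A := - io d%:R^-1 * (Lap0 s + Jtr * s).

Definition ip (u v : 'I_d -> A) : A := \sum_a \sum_b gi a b * (u a * v b).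

Definition Iq (s : A) : A := ip (D^~ s) (D^~ s) + s * rho s *+ 2.

Definition IdD X (nb : 'I_d -> (X -> A) -> X -> A) (s w : A) (V : X -> A) : X -> A := fun x =>
  (d%:R + 2 * w - 2) * (ip (D^~ s) (fun a => nb a V x) + w * rho s * V x)
  - s * (Lap nb V x + Jtr * w * V x).

End Definitions.

Definition connection (D : 'I_d -> A -> A) X (nb : 'I_d -> (X -> A) -> X -> A) : Prop :=
  (forall a V W, nb a (fun x => V x + W x) = fun x => nb a V x + nb a W x) /\
  (forall a f V, nb a (fun x => f * V x) = fun x => D a f * V x + f * nb a V x).

Definition linear_op X Y (S : (X -> A) -> Y -> A) : Prop :=
  (forall V W, S (fun x => V x + W x) = fun y => S V y + S W y) /\
  (forall f V, S (fun x => f * V x) = fun y => f * S V y).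

Lemma linear_op_sum X Y (S : (X -> A) -> Y -> A) (I : Type) (r : seq I) (F : I -> X -> A) y :
  linear_op S -> S (fun x => \sum_(i <- r) F i x) y = \sum_(i <- r) S (F i) y.
Proof.
move=> [SD SM]; have S0 : S (fun=> 0) = fun=> 0.
  apply/funext => z; have := SM 0 (fun=> 0).
  by under [in S _]eq_fun do rewrite mul0r; move=> ->; rewrite mul0r.
elim: r => [|i r IHr].
  under [in S _]eq_fun do rewrite big_nil.
  by rewrite big_nil S0.
under [in S _]eq_fun do rewrite big_cons.
by rewrite big_cons (SD (F i)) IHr.
Qed.

(* Tractor indices, as in [tix]: [None], [Some (Some a)] and [Some None] are the
   top, middle and bottom slots. *)
Definition tcon (D : 'I_d -> A -> A) (g gi : 'I_d -> 'I_d -> A) (a : 'I_d)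
    (x y : option (option 'I_d)) : A :=
  match x, y with
  | None, Some (Some b) => - (a == b)%:R
  | Some (Some b), None => Sch D g gi a b
  | Some (Some b), Some (Some k) => - Chr D g gi k a b
  | Some (Some b), Some None => g a b
  | Some None, Some (Some k) => - \sum_b Sch D g gi a b * gi b k
  | _, _ => 0
  end.

Lemma big_tix (V : nmodType) (F : option (option 'I_d) -> V) :
  \sum_x F x = F None + (F (Some None) + \sum_a F (Some (Some a))).
Proof.
have E (T : finType) (G : option T -> V) : \sum_x G x = G None + \sum_t G (Some t).
  rewrite (bigD1 None) //=; congr (_ + _).
  rewrite (reindex_omap Some id) /=; last by case.
  by apply: eq_bigl => t; rewrite eqxx.
by rewrite !E.
Qed.

(** * The Levi-Civita connection and the operator I.D in a fixed scale *)

Section LeviCivita.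
Variables (D : 'I_d -> A -> A) (g gi : 'I_d -> 'I_d -> A).
Hypotheses (hD : derivations D) (hg : metric_pair g gi).
Let DD := let: And3 p _ _ := hD in p.
Let DM := let: And3 _ p _ := hD in p.
Let Dio := let: And3 _ _ p := hD in p.
Let gC := let: And3 p _ _ := hg in p.
Let giC := let: And3 _ p _ := hg in p.
Let ggi := let: And3 _ _ p := hg in p.
Local Notation Chr_ := Chr.
Local Notation Chr := (Chr D g gi).

Lemma half2 : io 2^-1 + io 2^-1 = 1.
Proof. by rewrite -rmorphD -[2^-1]mul1r -splitr rmorph1. Qed.

Lemma derivation0 a : D a 0 = 0.
Proof. by have := Dio a 0; rewrite rmorph0. Qed.

Lemma derivation1 a : D a 1 = 0.
Proof. by rewrite -(rmorph1 io) Dio. Qed.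

Lemma derivation_nat a n : D a n%:R = 0.
Proof. by rewrite -(rmorph_nat io) Dio. Qed.

Lemma derivationN a u : D a (- u) = - D a u.
Proof. by apply/eqP; rewrite -addr_eq0 -DD addNr derivation0. Qed.

Lemma derivation_sum a (I : Type) (r : seq I) (F : I -> A) :
  D a (\sum_(i <- r) F i) = \sum_(i <- r) D a (F i).
Proof.
elim: r => [|i r IHr]; first by rewrite !big_nil derivation0.
by rewrite !big_cons DD IHr.
Qed.

Lemma gig a c : \sum_b gi a b * g b c = (a == c)%:R.
Proof. by rewrite eq_sym -ggi; apply: eq_bigr => b _; rewrite giC gC mulrC. Qed.

Lemma lowerK (F : 'I_d -> A) m : \sum_k g m k * (\sum_l gi k l * F l) = F m.
Proof. by rewrite sum_contract; under eq_bigr do rewrite ggi; exact: sum_delta'. Qed.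

Lemma raiseK (F : 'I_d -> A) m : \sum_k gi m k * (\sum_l g k l * F l) = F m.
Proof. by rewrite sum_contract; under eq_bigr do rewrite gig; exact: sum_delta'. Qed.

Lemma Chr_sym k a b : Chr k a b = Chr k b a.
Proof.
congr (_ * _); apply: eq_bigr => l _.
by rewrite [D a _ + _]addrC (gC a b).
Qed.

Lemma Chr_lower m a b :
  \sum_k g m k * Chr k a b = io 2^-1 * (D a (g m b) + D b (g m a) - D m (g a b)).
Proof. by under eq_bigr do rewrite mulrCA; rewrite -mulr_sumr lowerK. Qed.

(** With its upper index lowered, each Christoffel symbol is a Koszul expression; in the sum of the
    two everything but the derivative of g_ab cancels. *)
Lemma metricity c a b :
  D c (g a b) = \sum_k g a k * Chr k c b + \sum_k g b k * Chr k c a.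
Proof.
rewrite !Chr_lower -[LHS]mul1r -half2 (gC b a) (gC c b) (gC c a) .
rewrite (gC b c) (gC a c).
ring.
Qed.

(** Obtained by differentiating g gi = 1, inserting [metricity] and raising the free index. *)
Lemma metricity_inv c a b :
  D c (gi a b) = - (\sum_k Chr a c k * gi k b + \sum_k Chr b c k * gi a k).
Proof.
have E m : \sum_k g m k * D c (gi k b) = - \sum_k D c (g m k) * gi k b.
  apply/eqP; rewrite -addr_eq0 addrC -big_split /=.
  under eq_bigr do rewrite -DM.
  by rewrite -derivation_sum ggi derivation_nat.
rewrite -(raiseK (fun k => D c (gi k b)) a); under eq_bigr do rewrite E mulrN.
rewrite sumrN; congr (- _).
under eq_bigr => k _.
  under eq_bigr => l _ do rewrite metricity mulrDl !mulr_suml.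
  rewrite big_split mulrDr /=.
  over.
rewrite big_split /=; congr (_ + _).
- under eq_bigr => k _.
    rewrite exchange_big /=.
    under eq_bigr => l _ do (under eq_bigr do rewrite -mulrA; rewrite -mulr_sumr).
    over.
  by rewrite raiseK.
- apply: eq_bigr => k _; rewrite mulrC; congr (_ * _).
  rewrite -[RHS](raiseK (fun j => Chr j c k)); apply: eq_bigr => l _.
  by rewrite giC mulrC mulr_suml.
Qed.

Lemma ipC u v : ip gi u v = ip gi v u.
Proof.
rewrite /ip exchange_big; apply: eq_bigr => a _; apply: eq_bigr => b _.
by rewrite giC [u _ * _]mulrC.
Qed.

Lemma eq_ip u v u' v' : u =1 u' -> v =1 v' -> ip gi u v = ip gi u' v'.
Proof. by move=> uu vv; apply: eq_bigr => a _; apply: eq_bigr => b _; rewrite uu vv. Qed.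

Lemma ipDl u u' v : ip gi (fun a => u a + u' a) v = ip gi u v + ip gi u' v.
Proof.
rewrite -big_split; apply: eq_bigr => a _; rewrite -big_split; apply: eq_bigr => b _ /=.
ring.
Qed.

Lemma ipDr u v v' : ip gi u (fun a => v a + v' a) = ip gi u v + ip gi u v'.
Proof. by rewrite ipC ipDl; congr (_ + _); rewrite ipC. Qed.

Lemma ipZl c u v : ip gi (fun a => c * u a) v = c * ip gi u v.
Proof.
rewrite mulr_sumr; apply: eq_bigr => a _; rewrite mulr_sumr; apply: eq_bigr => b _ /=.
ring.
Qed.

Lemma ipZr c u v : ip gi u (fun a => c * v a) = c * ip gi u v.
Proof. by rewrite ipC ipZl; congr (_ * _); rewrite ipC. Qed.

Lemma Lap_mul X (nb : 'I_d -> (X -> A) -> X -> A) s V x : connection D nb ->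
  Lap D g gi nb (fun x => s * V x) x =
    s * Lap D g gi nb V x + ip gi (D^~ s) (fun a => nb a V x) *+ 2 + Lap0 D g gi s * V x.
Proof.
move=> [nbD nbM]; rewrite mulr2n {2}ipC /Lap /Lap0 /ip.
rewrite mulr_sumr mulr_suml -!big_split; apply: eq_bigr => a _.
rewrite mulr_sumr mulr_suml -!big_split; apply: eq_bigr => b _ /=.
rewrite nbM nbD !nbM.
have -> : \sum_k Chr k a b * nb k (fun x0 => s * V x0) x =
    (\sum_k Chr k a b * D k s) * V x + s * \sum_k Chr k a b * nb k V x.
  rewrite mulr_suml mulr_sumr -big_split; apply: eq_bigr => k _ /=.
  by rewrite nbM; ring.
ring.
Qed.

(** This is [x, y] = h before division by -I^2. The Leibniz rule for the Laplacian produces -2 s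
    times the pairing of [D s] with [nb V], which compensates for the shift of the coefficient from
    d + 2w - 2 to d + 2w; the Laplacian of [s] is -d rho - J s by the definition of rho. *)
Lemma IdD_mul X (nb : 'I_d -> (X -> A) -> X -> A) s w V x :
  connection D nb -> (d > 0)%N ->
  IdD D g gi nb s (w + 1) (fun x => s * V x) x =
    s * IdD D g gi nb s w V x + Iq D g gi s * (d%:R + 2 * w) * V x.
Proof.
move=> hnb d0; rewrite /IdD Lap_mul// /Iq.
rewrite (_ : ip gi (D^~ s) (fun a => nb a (fun x0 => s * V x0) x) =
  ip gi (D^~ s) (D^~ s) * V x + s * ip gi (D^~ s) (fun a => nb a V x)); last first.
  have [_ nbM] := hnb.
  rewrite (@eq_ip _ _ (D^~ s) (fun a => V x * D a s + s * nb a V x)) //; last first.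
    by move=> a; rewrite nbM mulrC.
  by rewrite ipDr !ipZr mulrC.
have E : Lap0 D g gi s = - d%:R * rho D g gi s - Jtr D g gi * s.
  have d1 : d%:R * io d%:R^-1 = 1.
    by rewrite -(rmorph_nat io d) -rmorphM mulfV ?rmorph1 // pnatr_eq0 -lt0n.
  by rewrite /rho !mulNr mulrN opprK mulrA d1 mul1r addrK.
rewrite E; ring.
Qed.

(** I.D is composed of the connection, of sums and of multiplications by ring elements, and [S]
    passes through each of these. It serves for changes of scale, for natural endomorphisms and for
    multiplication by constants. *)
Lemma IdD_parallel X Y (nbX : 'I_d -> (X -> A) -> X -> A) (nbY : 'I_d -> (Y -> A) -> Y -> A)
    (S : (X -> A) -> Y -> A) s w V y :
  linear_op S -> (forall a V, nbY a (S V) = S (nbX a V)) ->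
  IdD D g gi nbY s w (S V) y = S (IdD D g gi nbX s w V) y.
Proof.
move=> hS SV; have [SD SM] := hS.
have SN V' : S (fun x => - V' x) = fun y => - S V' y.
  by under eq_fun do rewrite -mulN1r; rewrite SM; apply/funext => z; rewrite mulN1r.
rewrite /IdD.
rewrite (SD (fun x => (d%:R + 2 * w - 2) *
  (ip gi (D^~ s) (fun a => nbX a V x) + w * rho D g gi s * V x))).
rewrite SN !SM !SD SM; congr (_ * (_ + _) - _ * (_ + _)).
- rewrite /ip linear_op_sum//; apply: eq_bigr => a _.
  rewrite linear_op_sum//; apply: eq_bigr => b _.
  under [in RHS]eq_fun do rewrite mulrA.
  by rewrite SM SV mulrA.
- rewrite /Lap linear_op_sum//; apply: eq_bigr => a _.
  rewrite linear_op_sum//; apply: eq_bigr => b _.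
  rewrite SM SD SN linear_op_sum// !SV; congr (_ * (_ - _)).
  by apply: eq_bigr => k _; rewrite SM SV.
- by rewrite SM.
Qed.

(** * Change of scale *)

Section Conformal.
Variables (E Ei : A) (U : 'I_d -> A).
Hypotheses (EEi : E * Ei = 1) (DE : forall a, D a E = E * U a).
Hypothesis Uclosed : forall a b, D a (U b) = D b (U a).
(** Here [E] is e^om and [U] is Upsilon = d om. [W] is the difference of the two Levi-Civita
    connections, [H] the covariant derivative of Upsilon, [UU] its squared norm and [divU] its
    divergence. *)
Let gh a b := E * E * g a b.
Let gih a b := Ei * Ei * gi a b.
Let Uu k := \sum_l gi k l * U l.
Let W k a b := (k == a)%:R * U b + (k == b)%:R * U a - g a b * Uu k.
Let H a b := D a (U b) - \sum_k Chr k a b * U k.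
Let UU := ip gi U U.
Let divU := \sum_a \sum_b gi a b * H a b.

Lemma sum_gi_g c : \sum_a \sum_b gi a b * (g a b * c) = d%:R * c.
Proof.
under eq_bigr => a _.
  under eq_bigr do rewrite mulrA [g a _]gC; rewrite -mulr_suml gig eqxx mul1r.
  over.
by rewrite sumr_const card_ord mulr_natl.
Qed.

Lemma derivation_inv a : D a Ei = - Ei * U a.
Proof.
have := derivation1 a; rewrite -EEi DM DE => /(congr1 ( *%R Ei)).
rewrite mulr0 mulrDr => /eqP; rewrite addr_eq0 => /eqP K.
rewrite -[LHS]mul1r -EEi [E * Ei]mulrC -mulrA -[RHS]opprK -[RHS]mulN1r.
rewrite -[LHS]opprK -K.
transitivity (- (E * Ei) * Ei * U a); first by ring.
by rewrite EEi; ring.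
Qed.

Lemma Chr_conf k a b : Chr_ D gh gih k a b = Chr k a b + W k a b.
Proof.
have X c u v : D c (gh u v) = E * E * (D c (g u v) + U c * g u v *+ 2).
  by rewrite /gh !DM !DE mulr2n; ring.
rewrite /Chr_.
under [in LHS] eq_bigr => l _.
  rewrite !X (_ : _ * _ = gi k l * (D a (g l b) + D b (g l a) - D l (g a b))
     + (U a * (gi k l * g l b) + U b * (gi k l * g l a) - g a b * (gi k l * U l)) *+ 2).
    over.
  transitivity ((E * Ei) * (E * Ei) * gi k l * ((D a (g l b) + U a * g l b *+ 2)
    + (D b (g l a) + U b * g l a *+ 2) - (D l (g a b) + U l * g a b *+ 2))).
    by rewrite /gih; ring.
  by rewrite EEi; ring.
rewrite big_split /= mulrDr; congr (_ + _).
rewrite sumrMnl sumrB big_split /= -!mulr_sumr !gig mulr2n.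
transitivity ((io 2^-1 + io 2^-1) * W k a b); last by rewrite half2 mul1r.
by rewrite /W -/(Uu k); ring.
Qed.

Lemma raise_lower_g a : \sum_l g a l * Uu l = U a.
Proof. exact: lowerK. Qed.

Lemma sum_U_Uu : \sum_l U l * Uu l = UU.
Proof. by apply: eq_bigr => a _; rewrite mulr_sumr; apply: eq_bigr => b _; ring. Qed.

Lemma W_sym k a b : W k a b = W k b a.
Proof. by rewrite /W gC; ring. Qed.

Lemma W_trace b : \sum_k W k k b = d%:R * U b.
Proof.
rewrite sumrB big_split /= sum_delta.
under [X in _ - X]eq_bigr do rewrite gC; rewrite raise_lower_g addrK.
under eq_bigr do rewrite eqxx mul1r.
by rewrite sumr_const card_ord mulr_natl.
Qed.

Lemma W_contract a (X : 'I_d -> 'I_d -> A) :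
  \sum_k \sum_l W k a l * X k l =
  \sum_l U l * X a l + U a * \sum_k X k k - \sum_k \sum_l g a l * Uu k * X k l.
Proof.
transitivity (\sum_k ((k == a)%:R * (\sum_l U l * X k l) +
    (U a * (\sum_l (k == l)%:R * X k l) - \sum_l g a l * Uu k * X k l))).
  apply: eq_bigr => k _; rewrite !mulr_sumr -sumrB -big_split; apply: eq_bigr => l _ /=.
  by rewrite /W; ring.
rewrite big_split /= sum_delta -addrA; congr (_ + _).
rewrite sumrB; congr (_ - _); rewrite -mulr_sumr; congr (_ * _).
by apply: eq_bigr => k _; rewrite sum_delta'.
Qed.

Lemma W_UU a b : \sum_l U l * W l a b = U a * U b *+ 2 - g a b * UU.
Proof.
rewrite -sum_U_Uu mulr_sumr.
transitivity (\sum_l ((l == a)%:R * (U b * U l) + (l == b)%:R * (U a * U l)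
   - g a b * (U l * Uu l))).
  by apply: eq_bigr => l _; rewrite /W; ring.
by rewrite sumrB big_split /= !sum_delta; ring.
Qed.

(** As [gi] is parallel, the index can be raised before differentiating. For u = [U] the left-hand
    side is [divU], the right-hand side what the expansion of the Ricci tensor yields. *)
Lemma divergence_raise (u : 'I_d -> A) :
  \sum_a \sum_b gi a b * (D a (u b) - \sum_k Chr k a b * u k) =
  \sum_k D k (\sum_l gi k l * u l) + \sum_k \sum_l Chr k k l * (\sum_j gi l j * u j).
Proof.
rewrite -big_split; apply: eq_bigr => k _ /=.
under eq_bigr do rewrite mulrBr; rewrite sumrB sum_contract.
rewrite derivation_sum sum_contract; under [X in _ = X + _]eq_bigr do rewrite DM addrC.
rewrite big_split -!addrA /=; congr (_ + _).
under [X in _ = X + _]eq_bigr do rewrite metricity_inv mulNr mulrDl.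
rewrite sumrN big_split opprD addrAC addNr add0r; congr (- _).
by apply: eq_bigr => l _; congr (_ * _); apply: eq_bigr => j _; exact: mulrC.
Qed.

(** The Ricci tensor of [Chr] + [W] is expanded into derivatives of [W], mixed terms and terms
    quadratic in [W]; the mixed terms complete the derivatives of Upsilon to [H] and [divU]. *)
Lemma Ric_conf a b : Ric D gh gih a b = Ric D g gi a b
  - (d%:R - 2) * (H a b - U a * U b + g a b * UU) - g a b * divU.
Proof.
pose G := Chr.
have S1 : \sum_k D k (W k a b) = D a (U b) + D b (U a)
    - \sum_k D k (g a b) * Uu k - g a b * \sum_k D k (Uu k).
  rewrite mulr_sumr -!addrA -opprD -big_split addrA.
  transitivity (\sum_k ((k == a)%:R * D k (U b) + (k == b)%:R * D k (U a)
      - (D k (g a b) * Uu k + g a b * D k (Uu k)))).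
    apply: eq_bigr => k _; rewrite /W !DD derivationN !DM !derivation_nat; ring.
  by rewrite sumrB !big_split /= !sum_delta.
have S2 : \sum_k D a (W k k b) = d%:R * D a (U b).
  by rewrite -derivation_sum W_trace DM derivation_nat mul0r add0r.
have S3 : \sum_k \sum_l G k k l * W l a b =
    U b * (\sum_k G k k a) + U a * (\sum_k G k k b) - g a b * \sum_k \sum_l G k k l * Uu l.
  rewrite !mulr_sumr -big_split -sumrB; apply: eq_bigr => k _ /=.
  transitivity (\sum_l ((l == a)%:R * (U b * G k k l) + (l == b)%:R * (U a * G k k l)
      - g a b * (G k k l * Uu l))).
    by apply: eq_bigr => l _; rewrite /W; ring.
  by rewrite sumrB big_split /= !sum_delta mulr_sumr.
have S4 X : \sum_k \sum_l W k k l * X l = d%:R * \sum_l U l * X l :> A.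
  rewrite exchange_big mulr_sumr /=; apply: eq_bigr => l _.
  by rewrite -mulr_suml W_trace mulrA.
have S6 : \sum_k \sum_l G k a l * W l k b =
    \sum_l U l * G l a b + U b * (\sum_k G k k a) - \sum_k \sum_l g b l * Uu k * G l k a.
  transitivity (\sum_k \sum_l W k b l * G l a k).
    rewrite exchange_big; apply: eq_bigr => k _; apply: eq_bigr => l _ /=.
    by rewrite mulrC W_sym.
  rewrite (W_contract b (fun k l => G l a k)); congr (_ + _ * _ - _).
    by apply: eq_bigr => k _; exact: Chr_sym.
  by apply: eq_bigr => k _; apply: eq_bigr => l _; congr (_ * _); exact: Chr_sym.
have S7 : \sum_k \sum_l W k a l * G l k b =
    \sum_l U l * G l a b + U a * (\sum_k G k k b) - \sum_k \sum_l g a l * Uu k * G l k b.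
  exact: (W_contract a (fun k l => G l k b)).
have S8 : \sum_k \sum_l W k a l * W l k b =
    (d%:R + 2) * U a * U b - g a b * UU *+ 2.
  rewrite (W_contract a (fun k l => W l k b)) W_UU W_trace.
  rewrite (_ : \sum_k \sum_l g a l * Uu k * W l k b = g a b * UU); first by ring.
  transitivity (\sum_k ((g a k * Uu k) * U b + (g a b * (U k * Uu k))
     - (g b k * Uu k) * U a)).
    apply: eq_bigr => k _; rewrite -(raise_lower_g a).
    transitivity (\sum_l ((l == k)%:R * (g a l * Uu k * U b) + (l == b)%:R * (g a l * (U k * Uu k))
       - (g k b * Uu k) * (g a l * Uu l))).
      by apply: eq_bigr => l _; rewrite /W; ring.
    by rewrite sumrB big_split /= !sum_delta -mulr_sumr [g k b]gC.
  rewrite sumrB big_split /= -!mulr_suml -mulr_sumr !raise_lower_g sum_U_Uu; ring.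
(* [S1] leaves a bare derivative of g_ab in the direction of Upsilon; metricity cancels it against
   the last sums of [S6] and [S7]. *)
have Sg : \sum_k D k (g a b) * Uu k =
    \sum_k \sum_l g a l * Uu k * G l k b + \sum_k \sum_l g b l * Uu k * G l k a.
  rewrite -big_split; apply: eq_bigr => k _; rewrite metricity mulrDl !mulr_suml.
  by congr (_ + _); apply: eq_bigr => l _; rewrite mulrAC.
transitivity (Ric D g gi a b + \sum_k D k (W k a b) - \sum_k D a (W k k b)
    + \sum_k \sum_l G k k l * W l a b + \sum_k \sum_l W k k l * G l a b
    + \sum_k \sum_l W k k l * W l a b - \sum_k \sum_l G k a l * W l k b
    - \sum_k \sum_l W k a l * G l k b - \sum_k \sum_l W k a l * W l k b).
  rewrite /Ric -big_split -sumrB -!big_split -!sumrB /=; apply: eq_bigr => k _.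
  rewrite !Chr_conf (DD k (Chr k a b)) (DD a (Chr k k b)).
  under eq_bigr => l _ do rewrite !Chr_conf.
  rewrite (_ : \sum_l _ = \sum_l (G k k l * G l a b - G k a l * G l k b)
     + \sum_l G k k l * W l a b + \sum_l W k k l * G l a b + \sum_l W k k l * W l a b
     - \sum_l G k a l * W l k b - \sum_l W k a l * G l k b - \sum_l W k a l * W l k b); last first.
    by rewrite -!big_split -!sumrB /=; apply: eq_bigr => l _; rewrite -/G; ring.
  by rewrite -/G; ring.
rewrite S1 S2 S3 !S4 S6 S7 S8 Sg W_UU (Uclosed b a).
rewrite /divU divergence_raise -/Uu -/G.
rewrite /H; under [\sum_k Chr k a b * _]eq_bigr do rewrite mulrC.
rewrite -/G; ring.
Qed.

Hypothesis hd : (3 <= d)%N.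

Lemma io_inv r : r != 0 -> io r * io r^-1 = 1.
Proof. by move=> r0; rewrite -rmorphM mulfV ?rmorph1. Qed.

Lemma io_dim : d%:R * io d%:R^-1 = 1.
Proof. by rewrite -(rmorph_nat io d) io_inv // pnatr_eq0 -lt0n (ltn_trans _ hd). Qed.

Lemma io_dim1 : (d%:R - 1) * io (2 * (d%:R - 1))^-1 = io 2^-1.
Proof.
rewrite -(rmorph_nat io d) -(rmorph1 io) -rmorphB -rmorphM invfM mulrCA mulfV ?mulr1//.
by rewrite subr_eq0 (eqr_nat R d 1) gtn_eqF // (ltn_trans _ hd).
Qed.

Lemma io_dim2 : (d%:R - 2) * io (d%:R - 2)^-1 = 1.
Proof.
rewrite -[2 in X in X * _](rmorph_nat io 2) -(rmorph_nat io d) -rmorphB io_inv //.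
by rewrite subr_eq0 (eqr_nat R d 2) gtn_eqF.
Qed.

Lemma Scal_conf : Scal D gh gih =
  Ei * Ei * (Scal D g gi - (d%:R - 2) * (divU - UU + d%:R * UU) - d%:R * divU).
Proof.
have E1 : Scal D g gi - (d%:R - 2) * (divU - UU + d%:R * UU) - d%:R * divU =
   \sum_a \sum_b gi a b * (Ric D g gi a b - (d%:R - 2) * (H a b - U a * U b + g a b * UU)
     - g a b * divU).
  rewrite -!sum_gi_g /divU /UU /Scal -sumrB -big_split mulr_sumr -!sumrB.
  apply: eq_bigr => a _; rewrite -sumrB -big_split mulr_sumr -!sumrB.
  by apply: eq_bigr => b _ /=; ring.
rewrite E1 mulr_sumr; apply: eq_bigr => a _; rewrite mulr_sumr; apply: eq_bigr => b _.
by rewrite Ric_conf /gih; ring.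
Qed.

Lemma Jtr_conf : Jtr D gh gih = Ei * Ei * (Jtr D g gi - divU - (d%:R - 2) * io 2^-1 * UU).
Proof.
rewrite /Jtr Scal_conf; set e := io (2 * (d%:R - 1))^-1.
transitivity (Ei * Ei * (Scal D g gi * e - ((d%:R - 1) * e + (d%:R - 1) * e) * divU
   - (d%:R - 2) * ((d%:R - 1) * e) * UU)); first by ring.
by rewrite io_dim1 half2 mul1r.
Qed.

(** The divergence terms of [Ric_conf] and [Jtr_conf] cancel, and the normalisation by d - 2 leaves
    [H] with coefficient -1. *)
Lemma Sch_conf a b : Sch D gh gih a b =
  Sch D g gi a b - H a b + U a * U b - io 2^-1 * UU * g a b.
Proof.
rewrite /Sch Ric_conf Jtr_conf; set e := io (d%:R - 2)^-1.
transitivity ((Ric D g gi a b - (E * Ei) * (E * Ei) * (Jtr D g gi * g a b)) * e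
  - ((d%:R - 2) * e) * (H a b - U a * U b + g a b * UU - (E * Ei) * (E * Ei) * (io 2^-1 * UU * g a b))
  + ((E * Ei) * (E * Ei) - 1) * e * divU * g a b); first by rewrite /gh; ring.
have hU : g a b * UU = (io 2^-1 + io 2^-1) * (g a b * UU) by rewrite half2 mul1r.
rewrite EEi io_dim2 hU; ring.
Qed.

(** The connection [nb] is the same on both sides: only the metric, with its Christoffel symbols,
    and the factor [Ew] = e^(w om) of the weight contribute. *)
Lemma Lap_conf X (nb : 'I_d -> (X -> A) -> X -> A) w Ew V x : connection D nb ->
  (forall a, D a w = 0) -> (forall a, D a Ew = w * U a * Ew) ->
  Lap D gh gih nb (fun x => Ew * V x) x = Ei * Ei * Ew *
   (Lap D g gi nb V x + (d%:R + 2 * w - 2) * ip gi U (fun a => nb a V x)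
    + w * (divU + (d%:R + w - 2) * UU) * V x).
Proof.
move=> [nbD nbM] Dw DEw.
have N1 a : nb a (fun x => Ew * V x) = fun x => Ew * (nb a V x + w * U a * V x).
  by rewrite nbM; apply/funext => y; rewrite DEw; ring.
have N2 a b : nb a (nb b (fun x => Ew * V x)) x =
    Ew * (nb a (nb b V) x + w * D a (U b) * V x + w * U b * nb a V x
          + w * U a * nb b V x + w * w * U a * U b * V x).
  rewrite N1 nbM nbD nbM DEw DM Dw; ring.
have E1 : \sum_k Uu k * nb k V x = ip gi U (fun a => nb a V x).
  rewrite ipC; apply: eq_bigr => k _; rewrite mulr_suml; apply: eq_bigr => l _; ring.
have E2 a b : \sum_k Chr_ D gh gih k a b * nb k (fun x => Ew * V x) x =
    Ew * (\sum_k Chr k a b * nb k V x + w * V x * (\sum_k Chr k a b * U k)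
     + U b * nb a V x + U a * nb b V x + w * U a * U b * V x *+ 2
     - g a b * (ip gi U (fun a => nb a V x) + w * UU * V x)).
  rewrite -E1 -sum_U_Uu.
  transitivity (\sum_k (Ew * (Chr k a b * nb k V x) + Ew * w * V x * (Chr k a b * U k)
    + (k == a)%:R * (Ew * U b * (nb k V x + w * U k * V x))
    + (k == b)%:R * (Ew * U a * (nb k V x + w * U k * V x))
    - Ew * g a b * (Uu k * nb k V x) - Ew * g a b * w * V x * (U k * Uu k))).
    by apply: eq_bigr => k _; rewrite Chr_conf N1 /W; ring.
  rewrite !sumrB !big_split /= !sum_delta -!mulr_sumr; ring.
transitivity (Ei * Ei * Ew * \sum_a \sum_b (gi a b * (nb a (nb b V) x - \sum_k Chr k a b * nb k V x)
   + w * (gi a b * (U a * nb b V x)) + w * (gi a b * (U b * nb a V x))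
   - gi a b * (U b * nb a V x) - gi a b * (U a * nb b V x)
   + w * V x * (gi a b * H a b) + (w * w - 2 * w) * V x * (gi a b * (U a * U b))
   + gi a b * (g a b * (ip gi U (fun a => nb a V x) + w * UU * V x)))).
  rewrite mulr_sumr; apply: eq_bigr => a _; rewrite mulr_sumr; apply: eq_bigr => b _.
  rewrite N2 E2 /gih /H; ring.
congr (_ * _).
have E3 : \sum_a \sum_b gi a b * (U b * nb a V x) = ip gi U (fun a => nb a V x).
  by rewrite ipC; apply: eq_bigr => a _; apply: eq_bigr => b _; rewrite [U b * _]mulrC.
under eq_bigr => a _ do rewrite !(big_split, sumrB, sumrN) /= -!mulr_sumr.
rewrite !(big_split, sumrB, sumrN) /= -!mulr_sumr ?(big_split, sumrB, sumrN) /=.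
rewrite sum_gi_g E3 -/(ip gi U (fun a => nb a V x)) -/(ip gi U U) -/divU -/UU -/(Lap D g gi nb V x).
ring.
Qed.

(** [Lap_conf] at weight 1, scalars being tensors indexed by [unit]; its divergence term cancels
    against that of [Jtr_conf]. The result is the bottom slot of the tractor transformation law for
    (sigma, nu, rho). *)
Lemma rho_conf s : rho D gh gih (E * s) =
  Ei * (rho D g gi s - ip gi U (D^~ s) - io 2^-1 * s * UU).
Proof.
have c0 : connection D (fun a V (x : unit) => D a (V x)).
  by split=> *; apply/funext => x; [rewrite DD|rewrite DM].
have LC : Lap0 D gh gih (E * s) = Ei * Ei * E *
   (Lap0 D g gi s + (d%:R + 2 * 1 - 2) * ip gi U (D^~ s) + 1 * (divU + (d%:R + 1 - 2) * UU) * s).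
  apply: (@Lap_conf unit _ 1 E (fun=> s) tt c0) => a; first exact: derivation1.
  by rewrite DE mul1r mulrC.
rewrite /rho LC Jtr_conf.
set e := io d%:R^-1; set p := ip _ _ _; set L := Lap0 _ _ _ _; set J := Jtr _ _ _.
transitivity ((E * Ei) * Ei * (- e * (L + J * s) - (d%:R * e) * p
   - e * (d%:R * 1 - 1 - (d%:R - 2) * io 2^-1) * UU * s)); first by ring.
rewrite EEi; congr (_ * _); first by rewrite mul1r.
have -> : d%:R * 1 - 1 - (d%:R - 2) * io 2^-1 = d%:R * io 2^-1.
  transitivity (d%:R * (io 2^-1 + io 2^-1) - (io 2^-1 + io 2^-1) - (d%:R - 2) * io 2^-1).
    by rewrite half2.
  by ring.
transitivity (- e * (L + J * s) - (d%:R * e) * p - (d%:R * e) * io 2^-1 * s * UU); first by ring.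
by rewrite io_dim !mul1r.
Qed.

Lemma ip_conf u v : ip gih u v = Ei * Ei * ip gi u v.
Proof.
rewrite /ip mulr_sumr; apply: eq_bigr => a _; rewrite mulr_sumr; apply: eq_bigr => b _.
by rewrite /gih -!mulrA.
Qed.

Lemma D_Es s a : D a (E * s) = E * (D a s + s * U a).
Proof. by rewrite DM DE; ring. Qed.

Lemma Iq_conf s : Iq D gh gih (E * s) = Iq D g gi s.
Proof.
rewrite /Iq rho_conf ip_conf (@eq_ip _ _ _ _ (D_Es s) (D_Es s)) ipZl ipZr !(ipDl, ipDr) !(ipZl, ipZr).
rewrite -/UU (ipC (D^~ s) U).
transitivity ((E * Ei) * (E * Ei) * (ip gi (D^~ s) (D^~ s) + s * ip gi U (D^~ s) *+ 2 + s * s * UU)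
  + (E * Ei) * (s * rho D g gi s *+ 2 - s * ip gi U (D^~ s) *+ 2 - s * s * (io 2^-1 + io 2^-1) * UU));
  first by ring.
rewrite EEi half2; ring.
Qed.

(** The coefficient d + 2w - 2 is the one that appears in [Lap_conf] before the pairing of Upsilon
    with [nb V]; the new term s Upsilon in the derivative of [E * s] cancels it. The divergence
    cancels between the Laplacian and J, the pairing of Upsilon with [D s] between nu and rho, and
    the terms in [UU] add up to a multiple of 1 - (1/2 + 1/2). *)
Lemma IdD_conf X (nb : 'I_d -> (X -> A) -> X -> A) s w Ew V x : connection D nb ->
  (forall a, D a w = 0) -> (forall a, D a Ew = w * U a * Ew) ->
  IdD D gh gih nb (E * s) w (fun x => Ew * V x) x = Ei * Ew * IdD D g gi nb s w V x.
Proof.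
move=> hnb Dw DEw; rewrite /IdD (@Lap_conf _ _ w)// Jtr_conf rho_conf ip_conf.
rewrite (@eq_ip _ _ (fun a => E * (D a s + s * U a)) (fun a => Ew * (nb a V x + w * V x * U a))).
- rewrite !(ipZl, ipZr, ipDl, ipDr) -/UU (ipC (D^~ s) U).
  set c := d%:R + 2 * w - 2; set p := ip gi U (fun a => nb a V x).
  set q := ip gi (D^~ s) (fun a => nb a V x); set r := ip gi U (D^~ s).
  set L := Lap _ _ _ _ _ _; set J := Jtr _ _ _; set h := io 2^-1.
  transitivity ((E * Ei) * (Ei * Ew * (c * (q + w * V x * r + s * p + s * w * V x * UU))
    + Ei * Ew * (- s * (L + c * p + w * V x * (divU + (d%:R + w - 2) * UU)
      + (J - divU - (d%:R - 2) * h * UU) * w * V x)))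
    + Ei * Ew * c * w * (rho D g gi s - r - h * s * UU) * V x); first by rewrite /c; ring.
  rewrite EEi mul1r.
  transitivity (Ei * Ew * (c * (q + w * rho D g gi s * V x) - s * (L + J * w * V x))
    + Ei * Ew * (s * w * w * V x * UU * (1 - (h + h)))); first by rewrite /c; ring.
  by rewrite half2; ring.
- by move=> a; exact: D_Es.
- by move=> a; have [_ nbM] := hnb; rewrite nbM DEw; ring.
Qed.

Definition scale_mat (x y : option (option 'I_d)) : A :=
  match x, y with
  | None, None => E
  | Some (Some a), None => E * U a
  | Some (Some a), Some (Some b) => E * (a == b)%:R
  | Some None, None => - Ei * (io 2^-1 * \sum_a \sum_b gi a b * U a * U b)
  | Some None, Some (Some b) => - Ei * \sum_a gi a b * U a
  | Some None, Some None => Ei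
  | _, _ => 0
  end.

Lemma D_Uu a c : D a (Uu c) = \sum_l H a l * gi l c - \sum_j Chr c a j * Uu j.
Proof.
rewrite derivation_sum; under eq_bigr do rewrite DM metricity_inv mulNr mulrDl addrC opprD addrA.
rewrite !sumrB addrAC; congr (_ - _).
  rewrite /H; under [RHS]eq_bigr do rewrite mulrBl.
  rewrite sumrB; congr (_ - _); first by apply: eq_bigr => l _; rewrite giC mulrC.
  under eq_bigr do rewrite mulr_suml; rewrite exchange_big /=; apply: eq_bigr => j _.
  by rewrite mulr_suml; apply: eq_bigr => l _; rewrite [gi c j]giC; ring.
by rewrite sum_contract.
Qed.

Lemma D_UU a : D a UU = (\sum_l H a l * Uu l) *+ 2.
Proof.
rewrite -sum_U_Uu derivation_sum; under eq_bigr do rewrite DM D_Uu mulrBr addrA.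
rewrite sumrB big_split /= mulr2n addrAC; congr (_ + _).
  rewrite /H; under [RHS]eq_bigr do rewrite mulrBl.
  rewrite sumrB; congr (_ - _); rewrite sum_contract.
  by apply: eq_bigr => l _; congr (_ * _); apply: eq_bigr => k _; exact: mulrC.
under eq_bigr do rewrite mulr_sumr; rewrite exchange_big /=; apply: eq_bigr => l _.
by rewrite /Uu mulr_sumr; apply: eq_bigr => k _; ring.
Qed.

Lemma Sch_conf_raise a c : \sum_b Sch D gh gih a b * gih b c =
  Ei * Ei * (\sum_b Sch D g gi a b * gi b c - \sum_b H a b * gi b c + U a * Uu c
             - io 2^-1 * UU * (a == c)%:R).
Proof.
under eq_bigr do rewrite Sch_conf.
generalize UU => u.
rewrite -ggi /Uu !mulr_sumr -sumrB -big_split -sumrB mulr_sumr; apply: eq_bigr => b _ /=.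
by rewrite /gih [gi c b]giC; ring.
Qed.

(** Conformal invariance of the tractor connection, written without inverting the matrix.
    Differentiating the entries in Upsilon produces [H], which the term - [H] in [Sch_conf]
    compensates; the Christoffel difference [W] handles the algebraic terms of the middle block. *)
Lemma scale_mat_parallel a x y :
  D a (scale_mat x y) + \sum_z tcon D gh gih a x z * scale_mat z y =
  \sum_z scale_mat x z * tcon D g gi a z y.
Proof.
rewrite !big_tix.
have UUe : \sum_a \sum_b gi a b * U a * U b = UU.
  by apply: eq_bigr => k _; apply: eq_bigr => l _; rewrite mulrA.
have Uue b : \sum_a gi a b * U a = Uu b by apply: eq_bigr => k _; rewrite giC.
have EEE z : E * (Ei * Ei * z) = Ei * z.
  by transitivity ((E * Ei) * (Ei * z)); [ring|rewrite EEi mul1r].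
have EE' z : E * E * z * Ei = E * z.
  by transitivity ((E * Ei) * (E * z)); [ring|rewrite EEi mul1r].
have pick_r (F : 'I_d -> A) c : \sum_k F k * (E * (k == c)%:R) = E * F c.
  by rewrite -(sum_delta F) mulr_sumr; apply: eq_bigr => k _; ring.
have pick_l (F : 'I_d -> A) c : \sum_k E * (c == k)%:R * F k = E * F c.
  by rewrite -(sum_delta' F) mulr_sumr; apply: eq_bigr => k _; ring.
case: x => [[b|]|]; case: y => [[c|]|] /=; rewrite ?UUe ?Uue ?derivation0 ?mulr0 ?mul0r ?add0r ?addr0.
- rewrite pick_r pick_l DM DE derivation_nat Chr_conf /W /gh.
  transitivity (E * U a * (b == c)%:R - (E * Ei) * (E * g a b * Uu c) - E * Chr c a b
     - E * (c == a)%:R * U b - E * (c == b)%:R * U a + E * g a b * Uu c); first by ring.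
  by rewrite EEi [c == a]eq_sym [c == b]eq_sym; ring.
- rewrite pick_l big1 ?addr0 => [|k _]; last by rewrite mulr0.
  by rewrite /gh EE'.
- rewrite pick_l Sch_conf DM DE.
  rewrite (_ : \sum_k _ = - E * (\sum_k Chr k a b * U k + U a * U b *+ 2 - g a b * UU)); last first.
    rewrite -addrA -W_UU -big_split mulr_sumr; apply: eq_bigr => k _ /=.
    by rewrite Chr_conf; ring.
  transitivity (E * Sch D g gi a b + E * g a b * UU * (1 - io 2^-1 - (E * Ei) * io 2^-1)).
    by rewrite /H /gh; ring.
  have -> : 1 - io 2^-1 - E * Ei * io 2^-1 = 0 by rewrite EEi mul1r -addrA -opprD half2 subrr.
  by rewrite mulr0 addr0.
- rewrite pick_r /= Sch_conf_raise [E * - _]mulrN EEE DM derivationN derivation_inv D_Uu.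
  under [X in _ = _ + (_ + X)]eq_bigr do rewrite Uue.
  rewrite (_ : \sum_k (- Ei * Uu k * - Chr c a k) = Ei * \sum_j Chr c a j * Uu j); last first.
    by rewrite mulr_sumr; apply: eq_bigr => k _; ring.
  ring.
- rewrite derivation_inv; under [RHS]eq_bigr do rewrite Uue.
  rewrite (_ : \sum_k (- Ei * Uu k * g a k) = - Ei * \sum_k g a k * Uu k); last first.
    by rewrite mulr_sumr; apply: eq_bigr => k _; ring.
  by rewrite raise_lower_g big1 ?addr0 // => k _; rewrite mulr0.
- under [RHS]eq_bigr do rewrite Uue.
  have E1 (X : 'I_d -> A) : \sum_k (\sum_b X b * gi b k) * U k = \sum_b X b * Uu b.
    by rewrite -sum_contract.
  rewrite (_ : \sum_k _ * (E * U k) = - (Ei * (\sum_b Sch D g gi a b * Uu b - \sum_b H a b * Uu b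
      + U a * UU - io 2^-1 * UU * U a))); last first.
    transitivity (- \sum_k Ei * ((\sum_b Sch D g gi a b * gi b k) * U k - (\sum_b H a b * gi b k) * U k
        + U a * (U k * Uu k) - io 2^-1 * UU * ((a == k)%:R * U k))).
      rewrite -sumrN; apply: eq_bigr => k _; rewrite Sch_conf_raise.
      transitivity (- ((E * Ei) * (Ei * ((\sum_b Sch D g gi a b * gi b k) * U k
          - (\sum_b H a b * gi b k) * U k
          + U a * (U k * Uu k) - io 2^-1 * UU * ((a == k)%:R * U k))))); first by ring.
      by rewrite EEi mul1r.
    by rewrite -mulr_sumr sumrB big_split sumrB /= !E1 -!mulr_sumr sum_U_Uu sum_delta'.
  rewrite DM derivationN derivation_inv DM Dio mul0r add0r D_UU.
  rewrite (_ : \sum_k _ * Sch D g gi a k = - Ei * \sum_b Sch D g gi a b * Uu b); last first.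
    by rewrite mulr_sumr; apply: eq_bigr => k _; ring.
  set S := \sum_b Sch D g gi a b * Uu b; set K := \sum_b H a b * Uu b.
  transitivity (- Ei * S + Ei * (U a * UU * (io 2^-1 + io 2^-1 - 1) + K * (1 - (io 2^-1 + io 2^-1)))).
    by ring.
  by rewrite half2; ring.
- under eq_bigr do rewrite mulNr; rewrite sumrN (pick_r (fun k => (a == k)%:R)) big1 ?addr0 ?mulrN//.
  by move=> k _; rewrite mul0r.
- by rewrite !big1 // => k _; [rewrite mul0r|rewrite mulr0].
- under eq_bigr do rewrite mulNr; rewrite sumrN sum_delta' DE subrr big1 // => k _.
  by rewrite mul0r.
Qed.

End Conformal.
End LeviCivita.

(** * Change of coordinates *)

Section ChangeOfCoordinates.
Variables (D D' : 'I_d -> A -> A) (g gi g' gi' : 'I_d -> 'I_d -> A).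
Variables J K : 'I_d -> 'I_d -> A.
Hypotheses (hD : derivations D) (hg : metric_pair g gi).
Hypotheses (hD' : derivations D') (hg' : metric_pair g' gi').
Hypothesis DJ : forall a u, D a u = \sum_b J a b * D' b u.
Hypothesis JK : forall a c, \sum_b J a b * K b c = (a == c)%:R.
Hypothesis KJ : forall a c, \sum_b K a b * J b c = (a == c)%:R.
Hypothesis Jsym : forall a b c, D a (J b c) = D b (J a c).
Hypothesis Dcomm : forall a b u, D a (D b u) = D b (D a u).
Hypothesis gJ : forall a b, g a b = \sum_k \sum_l J a k * J b l * g' k l.

Let DM a u v : D a (u * v) = D a u * v + u * D a v.
Proof. by case: hD. Qed.
Let DD a u v : D a (u + v) = D a u + D a v.
Proof. by case: hD. Qed.

Lemma JK_sum (F : 'I_d -> A) k : \sum_a K k a * (\sum_q J a q * F q) = F k.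
Proof. by rewrite sum_contract; under eq_bigr do rewrite KJ; exact: sum_delta'. Qed.

(** The inverse of g = J g' J^T, one Jacobian being kept on the left; after multiplication by [g]
    only K J = 1 and the inverse of g' remain. *)
Lemma gi_J a l : \sum_b gi a b * J b l = \sum_k K k a * gi' k l.
Proof.
have [_ _ ggi'] := hg'.
have E p : \sum_m (\sum_q J m q * g' p q) * (\sum_k K k m * gi' k l) = (p == l)%:R.
  rewrite -ggi' (sum_contract (fun m k => K k m)); apply: eq_bigr => k _; congr (_ * _).
  by under eq_bigr do rewrite mulrC; exact: JK_sum.
rewrite -[RHS](raiseK hg (fun a => \sum_k K k a * gi' k l)); apply: eq_bigr => m _.
congr (_ * _).
transitivity (\sum_n (\sum_p J m p * (\sum_q J n q * g' p q)) * (\sum_k K k n * gi' k l)); last first.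
  apply: eq_bigr => n _; rewrite gJ; congr (_ * _); apply: eq_bigr => p _.
  by rewrite mulr_sumr; apply: eq_bigr => q _; rewrite mulrA.
rewrite -(sum_contract (fun p n => \sum_q J n q * g' p q)).
by under eq_bigr do rewrite E mulrC; rewrite sum_delta.
Qed.

(** Full contractions with the inverse metric do not see the coordinates; inner products, scalar
    curvature and Laplacians are treated as instances. *)
Lemma contract_J (T : 'I_d -> 'I_d -> A) :
  \sum_a \sum_b gi a b * (\sum_k \sum_l J a k * J b l * T k l) = \sum_k \sum_l gi' k l * T k l.
Proof.
have E k l : \sum_a \sum_b gi a b * (J a k * J b l) = gi' k l.
  under eq_bigr do under eq_bigr do rewrite mulrCA; under eq_bigr do rewrite -mulr_sumr gi_J.
  rewrite (sum_contract (fun a m => K m a)); rewrite -[RHS](sum_delta (fun m => gi' m l)).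
  apply: eq_bigr => m _; rewrite -KJ; congr (_ * _); apply: eq_bigr => a _; exact: mulrC.
under [RHS]eq_bigr do under eq_bigr do rewrite -E mulr_suml.
under [RHS]eq_bigr do rewrite exchange_big /=.
rewrite [RHS]exchange_big; apply: eq_bigr => a _ /=.
under [RHS]eq_bigr do under eq_bigr do rewrite mulr_suml.
under [RHS]eq_bigr do rewrite exchange_big /=.
rewrite [RHS]exchange_big; apply: eq_bigr => b _ /=.
rewrite mulr_sumr; apply: eq_bigr => k _; rewrite mulr_sumr; apply: eq_bigr => l _.
by rewrite !mulrA.
Qed.

Lemma ip_J u v u' v' : (forall a, u a = \sum_k J a k * u' k) -> (forall a, v a = \sum_k J a k * v' k) ->
  ip gi u v = ip gi' u' v'.
Proof.
move=> uu vv; rewrite /ip -contract_J; apply: eq_bigr => a _; apply: eq_bigr => b _.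
congr (_ * _); rewrite uu vv mulr_suml; apply: eq_bigr => k _; rewrite mulr_sumr.
by apply: eq_bigr => l _; ring.
Qed.

(** The inhomogeneous term is a second derivative of the new coordinates. A Koszul expression
    contains six derivatives of [J]; by [Jsym] four of them cancel and the other two are equal,
    which the factor 1/2 turns into one. *)
Lemma Chr_J a b c : \sum_k Chr D g gi k a b * J k c =
  D a (J b c) + \sum_p \sum_q J a p * J b q * Chr D' g' gi' c p q.
Proof.
have [g'C gi'C ggi'] := hg'; have [gC giC _] := hg.
(* [h] is the metric with one index in each coordinate system; [Y] is the Koszul expression whose
   free index is already in the new coordinates. *)
pose h b p := \sum_q J b q * g' p q.
pose Y p := D a (h b p) + D b (h a p) - \sum_q \sum_r J a q * J b r * D' p (g' q r).
have gh l m : g l m = \sum_p J l p * h m p.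
  by rewrite gJ; apply: eq_bigr => p _; rewrite mulr_sumr; apply: eq_bigr => q _; rewrite mulrA.
have hg2 m p : \sum_q J m q * g' q p = h m p by apply: eq_bigr => q _; rewrite g'C.
have Dg l : D l (g a b) = \sum_p (D l (J a p) * h b p + D l (J b p) * h a p)
    + \sum_p J l p * \sum_q \sum_r J a q * J b r * D' p (g' q r).
  rewrite gJ (derivation_sum hD); under eq_bigr do rewrite (derivation_sum hD).
  under eq_bigr do under eq_bigr do rewrite DM DM (DJ l (g' _ _)).
  transitivity (\sum_q \sum_r (D l (J a q) * (J b r * g' q r) + D l (J b r) * (J a q * g' q r)
     + \sum_p J l p * (J a q * J b r * D' p (g' q r)))).
    apply: eq_bigr => q _; apply: eq_bigr => r _; rewrite mulr_sumr.
    rewrite (_ : \sum_p J l p * (_ * _) = \sum_i J a q * J b r * (J l i * D' i (g' q r))); first by ring.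
    by apply: eq_bigr => p _; ring.
  under eq_bigr do rewrite !big_split /= -mulr_sumr.
  rewrite !big_split /= -!addrA; congr (_ + (_ + _)).
    rewrite exchange_big; apply: eq_bigr => p _ /=.
    by rewrite -mulr_sumr hg2.
  under eq_bigr do rewrite exchange_big /=.
  rewrite exchange_big; apply: eq_bigr => p _ /=; rewrite mulr_sumr; apply: eq_bigr => q _.
  by rewrite mulr_sumr.
have X l : D a (g l b) + D b (g l a) - D l (g a b) = \sum_p J l p * Y p.
  rewrite Dg !gh !(derivation_sum hD) opprD addrA -!big_split -!sumrB /=; apply: eq_bigr => p _.
  by rewrite !DM (Jsym l a p) (Jsym l b p) /Y; ring.
have Y2 p : Y p = (\sum_q D a (J b q) * g' p q) *+ 2 +
    \sum_q \sum_r J a q * J b r * (D' q (g' p r) + D' r (g' p q) - D' p (g' q r)).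
  have Dh u v : D u (h v p) = \sum_q D u (J v q) * g' p q + \sum_q \sum_r J u r * J v q * D' r (g' p q).
    rewrite (derivation_sum hD) -big_split; apply: eq_bigr => q _ /=.
    by rewrite DM (DJ u (g' p q)) mulr_sumr; congr (_ + _); apply: eq_bigr => r _; ring.
  have -> : \sum_q \sum_r J a q * J b r * (D' q (g' p r) + D' r (g' p q) - D' p (g' q r)) =
     \sum_q \sum_r J a r * J b q * D' r (g' p q) + \sum_q \sum_r J b r * J a q * D' r (g' p q)
     - \sum_q \sum_r J a q * J b r * D' p (g' q r).
    rewrite [X in _ = X + _ - _]exchange_big /= -big_split -sumrB; apply: eq_bigr => q _ /=.
    by rewrite -big_split -sumrB; apply: eq_bigr => r _ /=; ring.
  rewrite /Y !Dh; under [\sum_q D b (J a q) * _]eq_bigr do rewrite Jsym.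
  ring.
rewrite /Chr.
transitivity (io 2^-1 * \sum_p gi' c p * Y p).
  under eq_bigr do rewrite -mulrA; rewrite -mulr_sumr; congr (_ * _).
  under eq_bigr do under eq_bigr do rewrite X.
  transitivity (\sum_k J k c * (\sum_l gi k l * (\sum_p J l p * Y p))).
    by apply: eq_bigr => k _; exact: mulrC.
  rewrite (sum_contract gi).
  transitivity (\sum_l (\sum_m gi' c m * K m l) * (\sum_p J l p * Y p)).
    apply: eq_bigr => l _; congr (_ * _); transitivity (\sum_b gi l b * J b c).
      by apply: eq_bigr => b' _; rewrite giC mulrC.
    by rewrite gi_J; apply: eq_bigr => m _; rewrite gi'C mulrC.
  by rewrite -sum_contract; apply: eq_bigr => m _; rewrite JK_sum.
have -> : \sum_p gi' c p * Y p = D a (J b c) *+ 2 + \sum_p \sum_q J a p * J b q *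
    (\sum_l gi' c l * (D' p (g' l q) + D' q (g' l p) - D' l (g' p q))).
  have Y3 p : Y p = (\sum_q g' p q * D a (J b q)) *+ 2 +
      \sum_q \sum_r J a q * J b r * (D' q (g' p r) + D' r (g' p q) - D' p (g' q r)).
    by rewrite Y2; congr (_ *+ 2 + _); apply: eq_bigr => q _; exact: mulrC.
  under eq_bigr do rewrite Y3 mulrDr mulrnAr.
  rewrite big_split sumrMnl (raiseK hg' (fun q => D a (J b q))) /=; congr (_ + _).
  under eq_bigr do rewrite mulr_sumr; rewrite exchange_big; apply: eq_bigr => p _ /=.
  under eq_bigr do rewrite mulr_sumr; rewrite exchange_big; apply: eq_bigr => q _ /=.
  by rewrite mulr_sumr; apply: eq_bigr => l _; ring.
rewrite mulrDr mulr2n mulrDr -mulrDl half2 mul1r; congr (_ + _).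
rewrite mulr_sumr; apply: eq_bigr => p _; rewrite mulr_sumr; apply: eq_bigr => q _.
by rewrite mulrCA.
Qed.

Lemma connection_sum X (nb : 'I_d -> (X -> A) -> X -> A) (I : Type) (r : seq I) (F : I -> X -> A) a x :
  connection D nb -> nb a (fun x => \sum_(i <- r) F i x) x = \sum_(i <- r) nb a (F i) x.
Proof.
move=> [nbD nbM]; elim: r x => [|i r IHr] x.
  have /(congr1 (@^~ x)) /= := nbM a 0 (fun=> 0).
  rewrite (derivation0 hD) !mul0r addr0 big_nil => E; rewrite -[RHS]E.
  by congr (nb a _ x); apply/funext => y; rewrite big_nil.
have /(congr1 (@^~ x)) /= := nbD a (F i) (fun x => \sum_(i <- r) F i x).
rewrite big_cons -IHr => <-.
by congr (nb a _ x); apply/funext => y; rewrite big_cons.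
Qed.

Section Bundle.
Variables (X Y : Type) (nb : 'I_d -> (X -> A) -> X -> A) (nb' : 'I_d -> (Y -> A) -> Y -> A).
Variable S : (Y -> A) -> X -> A.
Hypotheses (hnb : connection D nb) (hS : linear_op S).
Hypothesis nbS : forall a V x, nb a (S V) x = \sum_b J a b * S (nb' b V) x.

Lemma second_J a b V x : nb a (nb b (S V)) x =
  \sum_c D a (J b c) * S (nb' c V) x + \sum_e \sum_c J a e * J b c * S (nb' e (nb' c V)) x.
Proof.
have [_ nbM] := hnb.
rewrite (_ : nb b (S V) = fun x => \sum_c J b c * S (nb' c V) x); last first.
  by apply/funext => y; rewrite nbS.
rewrite connection_sum // [X in _ = _ + X]exchange_big -big_split; apply: eq_bigr => c _ /=.
rewrite nbM nbS mulr_sumr; congr (_ + _); apply: eq_bigr => e _; ring.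
Qed.

(** The first-order term of [second_J], with its derivative of [J], cancels against the
    inhomogeneous term of [Chr_J]. *)
Lemma Lap_J V x : Lap D g gi nb (S V) x = S (Lap D' g' gi' nb' V) x.
Proof.
have [SD SM] := hS.
have SN W : S (fun x => - W x) = fun y => - S W y.
  by under eq_fun do rewrite -mulN1r; rewrite SM; apply/funext => z; rewrite mulN1r.
rewrite /Lap linear_op_sum//; under [RHS]eq_bigr do rewrite linear_op_sum//.
under [RHS]eq_bigr do under eq_bigr do rewrite SM SD SN linear_op_sum//.
under [RHS]eq_bigr do under eq_bigr do under eq_bigr do rewrite SM.
rewrite -contract_J; apply: eq_bigr => a _; apply: eq_bigr => b _; congr (_ * _).
rewrite second_J.
have -> : \sum_k Chr D g gi k a b * nb k (S V) x = \sum_c D a (J b c) * S (nb' c V) x +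
   \sum_c (\sum_p \sum_q J a p * J b q * Chr D' g' gi' c p q) * S (nb' c V) x.
  under eq_bigr do rewrite nbS mulr_sumr.
  rewrite exchange_big -big_split; apply: eq_bigr => c _ /=; rewrite -mulrDl -Chr_J mulr_suml.
  by apply: eq_bigr => k _; rewrite mulrA.
rewrite opprD addrACA subrr add0r.
under [X in _ - X]eq_bigr do rewrite mulr_suml; rewrite [X in _ - X]exchange_big -sumrB /=.
apply: eq_bigr => p _; under [X in _ - X]eq_bigr do rewrite mulr_suml.
rewrite [X in _ - X]exchange_big -sumrB /=; apply: eq_bigr => q _.
rewrite mulrBr; congr (_ - _); rewrite mulr_sumr; apply: eq_bigr => k _; ring.
Qed.

(** Antisymmetrisation removes the derivatives of [J], by [Jsym]; this is why curvature is
    tensorial. *)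
Lemma commutator_J a b V x : nb a (nb b (S V)) x - nb b (nb a (S V)) x =
  \sum_e \sum_c J a e * J b c * S (fun y => nb' e (nb' c V) y - nb' c (nb' e V) y) x.
Proof.
have [SD SM] := hS.
have SB W W' : S (fun y => W y - W' y) = fun y => S W y - S W' y.
  under eq_fun do rewrite -[W' _]mul1r -mulNr; rewrite SD SM.
  by apply/funext => z; rewrite mulN1r.
rewrite !second_J (_ : \sum_c D b (J a c) * _ = \sum_c D a (J b c) * S (nb' c V) x); last first.
  by apply: eq_bigr => c _; rewrite Jsym.
rewrite opprD addrACA subrr add0r [X in _ - X]exchange_big -sumrB; apply: eq_bigr => e _ /=.
by rewrite -sumrB; apply: eq_bigr => c _; rewrite SB; ring.
Qed.

End Bundle.

(* The curvature is read off the commutator of this connection on one-forms, so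
   that its covariance only requires the transformation law of [Chr]. *)
Definition nabT (E : 'I_d -> A -> A) (G : 'I_d -> 'I_d -> 'I_d -> A) (a : 'I_d)
    (V : 'I_d -> A) (c : 'I_d) : A :=
  E a (V c) - \sum_k G k a c * V k.

Definition Riem (E : 'I_d -> A -> A) (G : 'I_d -> 'I_d -> 'I_d -> A) a b l c : A :=
  E a (G l b c) - E b (G l a c) + \sum_k (G k b c * G l a k - G k a c * G l b k).

Lemma nabT_connection E G : derivations E -> connection E (nabT E G).
Proof.
move=> [ED EM Eio]; split=> [a V W|a f V]; apply/funext => c; rewrite /nabT.
  under eq_bigr do rewrite mulrDr.
  by rewrite big_split ED /=; ring.
rewrite EM mulrBr mulr_sumr -addrA; congr (_ + (_ - _)).
by apply: eq_bigr => k _; ring.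
Qed.

Lemma commutator_Riem E G a b V c : derivations E ->
  (forall k, E a (E b (V k)) = E b (E a (V k))) ->
  nabT E G a (nabT E G b V) c - nabT E G b (nabT E G a V) c = - \sum_l Riem E G a b l c * V l.
Proof.
move=> hE EC; have [ED EM Eio] := hE.
rewrite /nabT !ED !(derivationN hE) !(derivation_sum hE) EC.
have T u v : \sum_k G k u c * (E v (V k) - \sum_l G l v k * V l) =
    \sum_k G k u c * E v (V k) - \sum_l (\sum_k G k u c * G l v k) * V l.
  by under eq_bigr do rewrite mulrBr; rewrite sumrB (sum_contract (fun k l => G l v k)).
have Q u v : \sum_k E u (G k v c * V k) = \sum_k E u (G k v c) * V k + \sum_k G k v c * E u (V k).
  by rewrite -big_split; apply: eq_bigr => k _; rewrite EM.
rewrite !T !Q.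
have -> : \sum_l Riem E G a b l c * V l = \sum_l E a (G l b c) * V l - \sum_l E b (G l a c) * V l
   + \sum_l (\sum_k G k b c * G l a k) * V l - \sum_l (\sum_k G k a c * G l b k) * V l.
  rewrite -!sumrB -big_split -sumrB; apply: eq_bigr => l _ /=; rewrite /Riem sumrB; ring.
ring.
Qed.

Lemma Ric_Riem E h hi a b :
  Ric E h hi a b = \sum_k Riem E (Chr E h hi) k a k b.
Proof.
apply: eq_bigr => k _; congr (_ + _); apply: eq_bigr => l _; ring.
Qed.

Lemma Riem_J a b c h :
  \sum_l Riem D (Chr D g gi) a b l c * J l h =
  \sum_e \sum_f J a e * J b f * \sum_m J c m * Riem D' (Chr D' g' gi') e f h m.
Proof.
pose S (V : 'I_d -> A) b := \sum_c J b c * V c.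
have hS : linear_op S.
  split=> [V W|f V]; apply/funext => x; rewrite /S.
    by under eq_bigr do rewrite mulrDr; rewrite big_split.
  by rewrite mulr_sumr; apply: eq_bigr => k _; ring.
have nbS u V x : nabT D (Chr D g gi) u (S V) x =
    \sum_k J u k * S (nabT D' (Chr D' g' gi') k V) x.
  rewrite /nabT /S (derivation_sum hD).
  have -> : \sum_k Chr D g gi k u x * (\sum_l J k l * V l) = \sum_l D u (J x l) * V l +
      \sum_l (\sum_p \sum_q J u p * J x q * Chr D' g' gi' l p q) * V l.
    rewrite sum_contract -big_split; apply: eq_bigr => l _ /=.
    by rewrite Chr_J mulrDl.
  under eq_bigr do rewrite DM; rewrite big_split opprD addrACA subrr add0r /=.
  under [in RHS]eq_bigr do (under eq_bigr do rewrite mulrBr; rewrite sumrB mulrBr).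
  rewrite sumrB; congr (_ - _).
    under eq_bigr do rewrite DJ mulr_sumr; rewrite exchange_big; apply: eq_bigr => k _ /=.
    by rewrite mulr_sumr; apply: eq_bigr => l _; ring.
  under eq_bigr do rewrite mulr_suml; rewrite exchange_big; apply: eq_bigr => p _ /=.
  under eq_bigr do rewrite mulr_suml; rewrite exchange_big mulr_sumr; apply: eq_bigr => q _ /=.
  by rewrite !mulr_sumr; apply: eq_bigr => l _; ring.
(* A constant one-form of the second frame: it selects a column of [J] on the left-hand side and one
   upper index of the curvature on the right-hand side. *)
pose V k : A := (k == h)%:R.
have SV l : S V l = J l h by rewrite /S /V; under eq_bigr do rewrite mulrC; exact: sum_delta.
have E1 := @commutator_Riem D (Chr D g gi) a b (S V) c hD (fun k => Dcomm a b (S V k)).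
apply: (can_inj (@opprK _)).
transitivity (- \sum_l Riem D (Chr D g gi) a b l c * S V l).
  by congr (- _); apply: eq_bigr => l _; rewrite SV.
rewrite -E1 (commutator_J (nabT_connection _ hD) hS nbS).
rewrite -sumrN; apply: eq_bigr => e _; rewrite -sumrN; apply: eq_bigr => f _.
rewrite -mulrN; congr (_ * _); rewrite /S -sumrN; apply: eq_bigr => m _.
(* The components of [V] are constants, so that both second derivatives by [D'] vanish and the
   symmetry asked for holds. *)
rewrite commutator_Riem //; last by move=> k; rewrite !(derivation_nat hD') !(derivation0 hD').
by rewrite -mulrN; congr (_ * - _); under eq_bigr do rewrite mulrC; rewrite sum_delta.
Qed.

(** In [Riem_J] the upper index still carries a [J]; contraction with [K] removes it and takes the
    trace at once. *)
Lemma Ric_J b c : Ric D g gi b c = \sum_k \sum_l J b k * J c l * Ric D' g' gi' k l.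
Proof.
transitivity (\sum_k \sum_h
    (\sum_e \sum_f J k e * J b f * \sum_m J c m * Riem D' (Chr D' g' gi') e f h m) * K h k).
  rewrite Ric_Riem; apply: eq_bigr => k _; under eq_bigr do rewrite -Riem_J.
  rewrite -(sum_contract J) -[LHS](sum_delta (fun l => Riem D (Chr D g gi) k b l c)).
  by apply: eq_bigr => l _; rewrite JK mulrC.
rewrite exchange_big /=.
transitivity (\sum_h \sum_f J b f * \sum_m J c m * Riem D' (Chr D' g' gi') h f h m).
  apply: eq_bigr => h _.
  pose F e := \sum_f J b f * \sum_m J c m * Riem D' (Chr D' g' gi') e f h m.
  rewrite -[RHS](JK_sum F); apply: eq_bigr => k _; rewrite mulrC; congr (_ * _).
  by apply: eq_bigr => e _; rewrite mulr_sumr; apply: eq_bigr => f _; rewrite mulrA.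
rewrite exchange_big; apply: eq_bigr => f _ /=; rewrite -mulr_sumr exchange_big mulr_sumr.
apply: eq_bigr => m _ /=; rewrite -mulr_sumr Ric_Riem; exact: mulrA.
Qed.

Lemma Scal_J : Scal D g gi = Scal D' g' gi'.
Proof.
rewrite /Scal -contract_J; apply: eq_bigr => a _; apply: eq_bigr => b _.
by rewrite Ric_J.
Qed.

Lemma Jtr_J : Jtr D g gi = Jtr D' g' gi'.
Proof. by rewrite /Jtr Scal_J. Qed.

Lemma Sch_J a b : Sch D g gi a b = \sum_k \sum_l J a k * J b l * Sch D' g' gi' k l.
Proof.
rewrite /Sch Ric_J Jtr_J gJ mulr_sumr -sumrB mulr_suml; apply: eq_bigr => k _.
by rewrite mulr_sumr -sumrB mulr_suml; apply: eq_bigr => l _; ring.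
Qed.

Lemma Lap0_J u : Lap0 D g gi u = Lap0 D' g' gi' u.
Proof.
apply: (@Lap_J unit unit (fun a V x => D a (V x)) (fun a V x => D' a (V x)) id _ _ _ (fun=> u) tt).
- by split=> *; apply/funext => x; [rewrite DD|rewrite DM].
- by split.
- by move=> a V x; exact: DJ.
Qed.

Lemma rho_J s : rho D g gi s = rho D' g' gi' s.
Proof. by rewrite /rho Lap0_J Jtr_J. Qed.

Lemma Iq_J s : Iq D g gi s = Iq D' g' gi' s.
Proof. by rewrite /Iq rho_J; congr (_ + _); apply: ip_J => a; exact: DJ. Qed.

Lemma IdD_J X Y (nb : 'I_d -> (X -> A) -> X -> A) (nb' : 'I_d -> (Y -> A) -> Y -> A)
    (S : (Y -> A) -> X -> A) s w V x : connection D nb -> linear_op S ->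
  (forall a V x, nb a (S V) x = \sum_b J a b * S (nb' b V) x) ->
  IdD D g gi nb s w (S V) x = S (IdD D' g' gi' nb' s w V) x.
Proof.
move=> hnb hS nbS; have [SD SM] := hS.
have SN V' : S (fun x => - V' x) = fun y => - S V' y.
  by under eq_fun do rewrite -mulN1r; rewrite SM; apply/funext => z; rewrite mulN1r.
rewrite /IdD (Lap_J hnb hS nbS) rho_J Jtr_J.
rewrite (SD (fun x => (d%:R + 2 * w - 2) *
  (ip gi' (D'^~ s) (fun a => nb' a V x) + w * rho D' g' gi' s * V x))).
rewrite SN !SM !SD !SM; congr (_ * (_ + _) - _).
rewrite (ip_J (fun a => DJ a s) (fun a => nbS a V x)).
rewrite /ip linear_op_sum//; apply: eq_bigr => a _.
rewrite linear_op_sum//; apply: eq_bigr => b _.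
under [in RHS]eq_fun do rewrite mulrA.
by rewrite SM mulrA.
Qed.

Definition chart_mat (x y : option (option 'I_d)) : A :=
  match x, y with
  | None, None => 1
  | Some (Some a), Some (Some b) => J a b
  | Some None, Some None => 1
  | _, _ => 0
  end.

(** The middle block is [Chr_J], its inhomogeneous term being the derivative of the matrix; the
    other entries are the tensor laws of the metric and of the Schouten tensor. *)
Lemma chart_mat_parallel a x y :
  D a (chart_mat x y) + \sum_z tcon D g gi a x z * chart_mat z y =
  \sum_b J a b * \sum_z chart_mat x z * tcon D' g' gi' b z y.
Proof.
have [_ giC _] := hg; have [_ gi'C _] := hg'.
under [RHS]eq_bigr do rewrite big_tix; rewrite !big_tix.
have z1 (F : 'I_d -> A) : \sum_k 0 * F k = 0 by rewrite big1 // => k _; rewrite mul0r.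
have z2 (F : 'I_d -> A) : \sum_k F k * 0 = 0 by rewrite big1 // => k _; rewrite mulr0.
case: x => [[b|]|]; case: y => [[c|]|] /=;
  rewrite ?(derivation0 hD) ?(derivation1 hD) ?z1 ?z2 ?(mul0r, mulr0, add0r, addr0, mulr1);
  under [RHS]eq_bigr do rewrite ?z1 ?z2 ?(mul0r, mulr0, add0r, addr0, mul1r); rewrite ?z2 ?big1_eq //.
- under eq_bigr do rewrite mulNr; rewrite sumrN Chr_J opprD addrA subrr add0r -sumrN.
  apply: eq_bigr => e _; rewrite mulr_sumr -sumrN; apply: eq_bigr => k _; ring.
- by rewrite gJ; apply: eq_bigr => e _; rewrite mulr_sumr; apply: eq_bigr => f _; rewrite mulrA.
- by rewrite Sch_J; apply: eq_bigr => e _; rewrite mulr_sumr; apply: eq_bigr => f _; rewrite mulrA.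
- under eq_bigr do rewrite mulNr; under [RHS]eq_bigr do rewrite mulrN; rewrite !sumrN; congr (- _).
  rewrite -sum_contract; under eq_bigr do rewrite gi_J.
  rewrite (sum_contract (fun b m => K m b)) [RHS]sum_contract; apply: eq_bigr => m _; congr (_ * _).
  rewrite -[RHS](JK_sum (fun m => \sum_e J a e * Sch D' g' gi' e m)).
  apply: eq_bigr => b _; rewrite mulrC Sch_J exchange_big; congr (_ * _).
  apply: eq_bigr => f _; rewrite mulr_sumr; apply: eq_bigr => e _ /=; ring.
- under eq_bigr do rewrite mulNr; under [RHS]eq_bigr do rewrite mulrN; rewrite !sumrN; congr (- _).
  rewrite sum_delta'; under eq_bigr do rewrite mulrC.
  by rewrite sum_delta.
Qed.

End ChangeOfCoordinates.
End Derivations.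

(** * Tractor tensors *)

Section TractorTensors.
Variables (R : realType) (A : comPzRingType) (io : {rmorphism R -> A}) (d n : nat).
Variable D : 'I_d -> A -> A.
Hypothesis hD : derivations io D.
Local Notation X := (tindex d n).
Let DM a u v : D a (u * v) = D a u * v + u * D a v.
Proof. by case: hD. Qed.
Let DD a u v : D a (u + v) = D a u + D a v.
Proof. by case: hD. Qed.

Definition tnab (E : 'I_d -> A -> A) (T : 'I_d -> tix d -> tix d -> A) (a : 'I_d)
    (V : X -> A) (x : X) : A :=
  E a (V x) + \sum_(m < n) \sum_B T a (x m) B * V (upd x m B).

Lemma tnab_connection T : connection D (tnab D T).
Proof.
split=> [a V W|a f V]; apply/funext => x; rewrite /tnab.
  rewrite DD (_ : \sum_m _ = \sum_(m < n) \sum_B T a (x m) B * V (upd x m B)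
    + \sum_(m < n) \sum_B T a (x m) B * W (upd x m B)); first by ring.
  rewrite -big_split; apply: eq_bigr => m _; rewrite -big_split; apply: eq_bigr => B _ /=; ring.
rewrite DM mulrDr addrA; congr (_ + _); rewrite mulr_sumr; apply: eq_bigr => m _.
by rewrite mulr_sumr; apply: eq_bigr => B _; ring.
Qed.

(** The n-th tensor power of the matrix [s]. *)
Definition tpow (s : tix d -> tix d -> A) (V : X -> A) (x : X) : A :=
  \sum_(y : X) (\prod_m s (x m) (y m)) * V y.

Lemma tpow_linear s : linear_op (tpow s).
Proof.
split=> [V W|f V]; apply/funext => x; rewrite /tpow.
  by under eq_bigr do rewrite mulrDr; rewrite big_split.
by rewrite mulr_sumr; apply: eq_bigr => y _; ring.
Qed.

Lemma derivation_prod a (I : finType) (F : I -> A) :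
  D a (\prod_i F i) = \sum_i D a (F i) * \prod_(j | j != i) F j.
Proof.
have := index_enum_uniq I; move: (index_enum I) => r.
elim: r => [|i r IHr] /=; first by rewrite !big_nil (derivation1 hD).
move=> /andP[ir /IHr IH]; rewrite !big_cons eqxx /= DM IH; congr (_ * _ + _).
  rewrite big_seq_cond [RHS]big_seq_cond; apply: eq_bigl => j.
  by rewrite andbT; case: (boolP (j \in r)) => //= jr; apply/esym; apply: contraNneq ir => <-.
rewrite mulr_sumr big_seq [RHS]big_seq; apply: eq_bigr => j jr.
rewrite big_cons ifT; first by rewrite mulrCA.
by apply: contraNneq ir => ->.
Qed.

Lemma upd_same (x : X) m B : upd x m B m = B.
Proof. by rewrite ffunE eqxx. Qed.

Lemma upd_other (x : X) m B k : k != m -> upd x m B k = x k.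
Proof. by rewrite ffunE => /negPf ->. Qed.

Lemma upd_upd (x : X) m B C : upd (upd x m B) m C = upd x m C.
Proof. by apply/ffunP => k; rewrite !ffunE; case: eqP. Qed.

Lemma upd_id (x : X) m : upd x m (x m) = x.
Proof. by apply/ffunP => k; rewrite !ffunE; case: eqP => // ->. Qed.

Lemma upd_comm (x : X) m k B C : m != k -> upd (upd x m B) k C = upd (upd x k C) m B.
Proof.
move=> mk; apply/ffunP => l; rewrite !ffunE.
by case: (eqVneq l k) => [->|//]; rewrite eq_sym (negPf mk).
Qed.

(** By the Leibniz rule the derivative of a product of entries is a sum over the slots, and the
    hypothesis applies in one slot at a time. *)
Lemma tpow_parallel s T T' :
  (forall a x y, D a (s x y) + \sum_z T' a x z * s z y = \sum_z s x z * T a z y) ->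
  forall a V, tnab D T' a (tpow s V) = tpow s (tnab D T a V).
Proof.
move=> sT a V; apply/funext => x; rewrite /tnab /tpow.
pose Q m (y : X) := \prod_(k | k != m) s (x k) (y k).
rewrite (derivation_sum hD).
have E1 m B : \sum_(y : X) (\prod_k s (upd x m B k) (y k)) * V y = \sum_(y : X) s B (y m) * Q m y * V y.
  apply: eq_bigr => y _; congr (_ * _); rewrite (bigD1 m) //= upd_same; congr (_ * _).
  by apply: eq_bigr => k km; rewrite upd_other.
under [X in _ + X]eq_bigr do under eq_bigr do rewrite E1 mulr_sumr.
under [X in _ + X]eq_bigr do rewrite exchange_big /=.
rewrite [X in _ + X]exchange_big /=.
transitivity (\sum_(y : X) (D a ((\prod_m s (x m) (y m)) * V y) +
    \sum_m \sum_B T' a (x m) B * (s B (y m) * Q m y * V y))); first by rewrite big_split.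
transitivity (\sum_(y : X) ((\prod_m s (x m) (y m)) * D a (V y)
    + \sum_m (\sum_z s (x m) z * T a z (y m)) * Q m y * V y)).
  apply: eq_bigr => y _; rewrite DM derivation_prod mulr_suml addrAC addrC.
  congr (_ + _); rewrite -big_split; apply: eq_bigr => m _ /=.
  rewrite -sT !mulrDl !mulr_suml; congr (_ + _).
  by apply: eq_bigr => B _; ring.
under [RHS]eq_bigr do rewrite mulrDr.
rewrite !big_split; congr (_ + _); rewrite exchange_big /=.
under [RHS]eq_bigr do rewrite mulr_sumr.
rewrite [RHS]exchange_big; apply: eq_bigr => m _ /=.
under [RHS]eq_bigr do rewrite mulr_sumr.
under eq_bigr do rewrite !mulr_suml.
rewrite pair_bigA [RHS]pair_bigA /=.
(* Exchanging slot [m] of the multi-index with the extra summation index moves the connection form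
   from the matrix onto the components of [V]. *)
pose phi (p : X * tix d) := (upd p.1 m p.2, p.1 m).
have phiK : involutive phi.
  by case=> y B; rewrite /phi /= upd_upd upd_id upd_same.
rewrite (reindex_inj (inv_inj phiK)) /=; apply: eq_bigr => -[y B] _ /=.
rewrite upd_same (bigD1 m) //= (_ : Q m (upd y m B) = Q m y); first by rewrite /Q; ring.
by apply: eq_bigr => k km; rewrite upd_other.
Qed.

Section Metric.
Variables (g gi : 'I_d -> 'I_d -> A).
Hypothesis hg : metric_pair g gi.

Definition hmet (x y : tix d) : A :=
  match x, y with
  | None, Some None | Some None, None => 1
  | Some (Some a), Some (Some b) => gi a b
  | _, _ => 0
  end.

Definition hmet_inv (x y : tix d) : A :=
  match x, y with
  | None, Some None | Some None, None => 1
  | Some (Some a), Some (Some b) => g a b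
  | _, _ => 0
  end.

Local Notation T := (tcon io D g gi).

Lemma hmet_parallel a x y :
  D a (hmet x y) = \sum_z T a z x * hmet z y + \sum_z T a z y * hmet x z.
Proof.
have z1 (F : 'I_d -> A) : \sum_k 0 * F k = 0 by rewrite big1 // => k _; rewrite mul0r.
have z2 (F : 'I_d -> A) : \sum_k F k * 0 = 0 by rewrite big1 // => k _; rewrite mulr0.
have [gC giC ggi] := hg.
rewrite !big_tix; case: x => [[b|]|]; case: y => [[c|]|] /=;
  rewrite ?(derivation0 hD) ?(derivation1 hD) ?z1 ?z2 ?(mul0r, mulr0, add0r, addr0, mulr1) //.
- rewrite (metricity_inv hD hg) opprD -!sumrN; congr (_ + _); apply: eq_bigr => k _; ring.
- have E : \sum_k g a k * gi b k = (a == b)%:R.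
    by rewrite -ggi; apply: eq_bigr => k _; rewrite giC.
  by rewrite E addNr.
- by rewrite addrC -sumrB big1 // => k _; rewrite giC subrr.
- by rewrite ggi subrr.
- by rewrite subrr.
Qed.

Lemma hmet_inv_parallel a x y :
  D a (hmet_inv x y) = - (\sum_z T a x z * hmet_inv z y + \sum_z T a y z * hmet_inv x z).
Proof.
have z1 (F : 'I_d -> A) : \sum_k 0 * F k = 0 by rewrite big1 // => k _; rewrite mul0r.
have z2 (F : 'I_d -> A) : \sum_k F k * 0 = 0 by rewrite big1 // => k _; rewrite mulr0.
have [gC giC ggi] := hg.
have lowSch b : \sum_k (\sum_c Sch io D g gi a c * gi c k) * g b k = Sch io D g gi a b.
  rewrite -[RHS](lowerK hg); apply: eq_bigr => k _; rewrite mulrC; congr (_ * _).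
  by apply: eq_bigr => c _; rewrite giC mulrC.
rewrite !big_tix; case: x => [[b|]|]; case: y => [[c|]|] /=;
  rewrite ?(derivation0 hD) ?(derivation1 hD) ?z1 ?z2 ?(mul0r, mulr0, add0r, addr0, mulr1, oppr0) //.
- rewrite (metricity io D hg) addrC opprD -!sumrN.
  by congr (_ + _); apply: eq_bigr => k _; rewrite ?(gC _ k); ring.
- by under eq_bigr do rewrite mulNr; rewrite sumrN lowSch subrr oppr0.
- by under eq_bigr do rewrite mulNr; rewrite sumrN sum_delta' gC subrr oppr0.
- under eq_bigr do rewrite mulNr gC; by rewrite sumrN lowSch addNr oppr0.
- by under eq_bigr do rewrite mulNr; rewrite sumrN sum_delta' addNr oppr0.
Qed.

End Metric.
Section Endomorphisms.
Variables (g gi : 'I_d -> 'I_d -> A).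
Hypothesis hg : metric_pair g gi.
Local Notation h := (hmet gi).
Local Notation hi := (hmet_inv g).
Local Notation T := (tcon io D g gi).

Fixpoint endo (e : natural_endo R n) (V : X -> A) : X -> A :=
  match e with
  | Defs.Perm s => fun x => V [ffun k : 'I_n => x (s k)]
  | @Trace _ _ r s _ => fun x => hi (x r) (x s) *
      \sum_B \sum_C h B C * V (upd (upd x r B) s C)
  | Scale a e1 => fun x => io a * endo e1 V x
  | Add e1 e2 => fun x => endo e1 V x + endo e2 V x
  | Comp e1 e2 => endo e1 (endo e2 V)
  end.

Lemma endo_linear e : linear_op (endo e).
Proof.
elim: e => [s|r s rs|a e [eD eM]|e1 [eD1 eM1] e2 [eD2 eM2]|e1 [eD1 eM1] e2 [eD2 eM2]] /=.
- by split.
- split=> [V W|f V]; apply/funext => x.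
    rewrite -mulrDr -big_split; congr (_ * _); apply: eq_bigr => B _.
    by rewrite -big_split; apply: eq_bigr => C _; rewrite mulrDr.
  rewrite mulrCA; congr (_ * _); rewrite mulr_sumr; apply: eq_bigr => B _.
  by rewrite mulr_sumr; apply: eq_bigr => C _; ring.
- by split=> [V W|f V]; apply/funext => x; rewrite ?eD ?eM; ring.
- by split=> [V W|f V]; apply/funext => x; rewrite ?eD1 ?eM1 ?eD2 ?eM2; ring.
- by split=> [V W|f V]; rewrite ?eD2 ?eD1 ?eM2 ?eM1.
Qed.

(** The connection terms in the outer slots [r] and [s] cancel the derivative of the inserted [hi];
    the derivative of [h] supplies those of the contracted slots; the remaining slots are not
    touched by the trace. *)
Lemma trace_parallel (r s : 'I_n) (rs : r != s) a V :
  let P (V : X -> A) (x : X) := hi (x r) (x s) * \sum_B \sum_C h B C * V (upd (upd x r B) s C) in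
  tnab D T a (P V) = P (tnab D T a V).
Proof.
move=> P; apply/funext => x; rewrite /tnab {1}/P.
have sr : s != r by rewrite eq_sym.
pose y B C := upd (upd x r B) s C.
pose c := \sum_B \sum_C h B C * V (y B C).
rewrite -/c DM (bigD1 r) //= (bigD1 s) //= /P.
have Er E : P V (upd x r E) = hi E (x s) * c.
  rewrite /P upd_same upd_other //; congr (_ * _); apply: eq_bigr => B _; apply: eq_bigr => C _.
  by rewrite upd_upd.
have Es E : P V (upd x s E) = hi (x r) E * c.
  rewrite /P upd_same upd_other //; congr (_ * _); apply: eq_bigr => B _; apply: eq_bigr => C _.
  by rewrite (upd_comm x _ _ sr) upd_upd.
have Em m E : (m != r) && (m != s) -> P V (upd x m E) =
    hi (x r) (x s) * \sum_B \sum_C h B C * V (upd (y B C) m E).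
  move=> /andP[mr ms]; rewrite /P !upd_other 1?eq_sym //; congr (_ * _).
  apply: eq_bigr => B _; apply: eq_bigr => C _.
  by rewrite /y (upd_comm x _ _ mr) (upd_comm (upd x r B) _ _ ms).
under eq_bigr do rewrite -/(P V _) Er mulrA.
under [X in _ + (_ + (X + _))]eq_bigr do rewrite -/(P V _) Es mulrA.
rewrite -!mulr_suml (hmet_inv_parallel hg).
have Dc : D a c = \sum_B \sum_C h B C * D a (V (y B C)) +
   \sum_B \sum_C h B C * (\sum_E T a B E * V (y E C)) +
   \sum_B \sum_C h B C * (\sum_E T a C E * V (y B E)).
  rewrite (derivation_sum hD); under eq_bigr do rewrite (derivation_sum hD).
  transitivity (\sum_B \sum_C (h B C * D a (V (y B C)) + (\sum_z T a z B * h z C) * V (y B C)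
      + (\sum_z T a z C * h B z) * V (y B C))).
    apply: eq_bigr => B _; apply: eq_bigr => C _; rewrite DM (hmet_parallel hg); ring.
  under eq_bigr do rewrite !big_split /=; rewrite !big_split /=; congr (_ + _ + _).
    rewrite exchange_big [RHS]exchange_big; apply: eq_bigr => C _ /=.
    under eq_bigr do rewrite mulr_suml; rewrite exchange_big; apply: eq_bigr => B _ /=.
    by rewrite mulr_sumr; apply: eq_bigr => E _; ring.
  apply: eq_bigr => B _; under eq_bigr do rewrite mulr_suml.
  rewrite exchange_big; apply: eq_bigr => C _ /=.
  by rewrite mulr_sumr; apply: eq_bigr => E _; ring.
have yE B C : D a (V (y B C)) + \sum_(m < n) \sum_E T a (y B C m) E * V (upd (y B C) m E) =
   D a (V (y B C)) + (\sum_E T a B E * V (y E C) + (\sum_E T a C E * V (y B E) +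
    \sum_(m < n | (m != r) && (m != s)) \sum_E T a (x m) E * V (upd (y B C) m E))).
  rewrite (bigD1 r) //= (bigD1 s) //=; congr (_ + (_ + (_ + _))).
  - apply: eq_bigr => E _; rewrite /y upd_other // upd_same; congr (_ * V _).
    by rewrite (upd_comm x B C rs) upd_upd (upd_comm x E C rs).
  - by apply: eq_bigr => E _; rewrite /y upd_same upd_upd.
  - by apply: eq_bigr => m /andP[mr ms]; apply: eq_bigr => E _; rewrite /y !upd_other.
under [in RHS]eq_bigr do under eq_bigr do rewrite -/(y _ _) yE !mulrDr.
under [in RHS]eq_bigr do rewrite !big_split.
rewrite !big_split /= Dc.
rewrite (_ : \sum_(m < n | (m != r) && (m != s)) _ = hi (x r) (x s) * \sum_B \sum_C h B C *
    \sum_(m < n | (m != r) && (m != s)) \sum_E T a (x m) E * V (upd (y B C) m E)); first by ring.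
under eq_bigr => m mrs do under eq_bigr => E _ do rewrite -/(P V _) (Em _ _ mrs) mulrCA.
under eq_bigr do rewrite -mulr_sumr; rewrite -mulr_sumr; congr (_ * _).
under eq_bigr do under eq_bigr do rewrite mulr_sumr.
under eq_bigr do rewrite exchange_big /=; rewrite exchange_big; apply: eq_bigr => B _ /=.
under eq_bigr do under eq_bigr do rewrite mulr_sumr.
under eq_bigr do rewrite exchange_big /=; rewrite exchange_big; apply: eq_bigr => C _ /=.
rewrite mulr_sumr; apply: eq_bigr => m _; rewrite mulr_sumr; apply: eq_bigr => E _; ring.
Qed.

Lemma endo_parallel e a V : tnab D T a (endo e V) = endo e (tnab D T a V).
Proof.
elim: e V => [s|r s rs|c e IHe|e1 IH1 e2 IH2|e1 IH1 e2 IH2] V /=.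
- apply/funext => x; rewrite /tnab; congr (_ + _).
  rewrite (reindex_inj (@perm_inj _ s)) /=; apply: eq_bigr => m _; rewrite ffunE.
  apply: eq_bigr => B _; congr (_ * V _); apply/ffunP => k; rewrite !ffunE.
  by rewrite (inj_eq (@perm_inj _ s)).
- exact: trace_parallel.
- have [_ nbM] := tnab_connection T.
  by rewrite nbM IHe; apply/funext => x; case: hD => _ _ ->; rewrite mul0r add0r.
- by have [nbD _] := tnab_connection T; rewrite nbD IH1 IH2.
- by rewrite IH1 IH2.
Qed.
End Endomorphisms.
End TractorTensors.

(** * Commutation of y with the c_j *)

Section Iteration.
Variables (R : numFieldType) (A : comPzRingType) (io : {rmorphism R -> A}) (d : nat).
Variables (D : 'I_d -> A -> A) (g gi : 'I_d -> 'I_d -> A).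
Variables (X : Type) (nb : 'I_d -> (X -> A) -> X -> A) (s iI : A).
Hypotheses (hD : derivations io D) (hg : metric_pair g gi) (hnb : connection D nb).
Hypotheses (d_gt0 : (0 < d)%N) (hI : iI * Iq io D g gi s = 1).

Definition yop (w : R) (V : X -> A) : X -> A := fun x => - iI * IdD io D g gi nb s (io w) V x.

Lemma IdD_add w V W x : IdD io D g gi nb s w (fun x => V x + W x) x =
  IdD io D g gi nb s w V x + IdD io D g gi nb s w W x.
Proof.
have [nbD _] := hnb.
have LD : Lap io D g gi nb (fun x => V x + W x) x = Lap io D g gi nb V x + Lap io D g gi nb W x.
  rewrite -big_split; apply: eq_bigr => a _; rewrite -big_split; apply: eq_bigr => b _ /=.
  rewrite !nbD (_ : \sum_k _ = \sum_k Chr io D g gi k a b * nb k V x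
    + \sum_k Chr io D g gi k a b * nb k W x); first by ring.
  by rewrite -big_split; apply: eq_bigr => k _; rewrite nbD mulrDr.
rewrite /IdD LD (@eq_ip _ _ _ _ _ (D^~ s) (fun a => nb a V x + nb a W x)) //; last first.
  by move=> a; rewrite nbD.
rewrite (ipDr hg); ring.
Qed.

Lemma IdD_const w r V x : IdD io D g gi nb s w (fun x => io r * V x) x =
  io r * IdD io D g gi nb s w V x.
Proof.
have [_ nbM] := hnb.
apply: (@IdD_parallel _ _ io _ D g gi _ _ nb nb (fun V x => io r * V x)).
  by split=> [U W|f U]; apply/funext => y; ring.
by move=> a U; rewrite nbM; apply/funext => y; case: hD => _ _ ->; rewrite mul0r add0r.
Qed.

Lemma yop_add w V W : yop w (fun x => V x + W x) = fun x => yop w V x + yop w W x.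
Proof. by apply/funext => x; rewrite /yop IdD_add mulrDr. Qed.

Lemma yop_const w r V : yop w (fun x => io r * V x) = fun x => io r * yop w V x.
Proof. by apply/funext => x; rewrite /yop IdD_const mulrCA. Qed.

(** [IdD_mul] multiplied by -1/I^2; [V] has weight w - 1, at which h is evaluated. *)
Lemma yop_mul w V : yop w (fun x => s * V x) =
  fun x => s * yop (w - 1) V x - io (d%:R + 2 * (w - 1)) * V x.
Proof.
apply/funext => x; rewrite /yop.
have -> : io w = io (w - 1) + 1 by rewrite rmorphB rmorph1 subrK.
rewrite (IdD_mul io hg s _ V x hnb d_gt0); set I := Iq _ _ _ _ _; set L := IdD _ _ _ _ _ _ _ _ _.
transitivity (s * (- iI * L) - (iI * I) * (d%:R + 2 * io (w - 1)) * V x); first by ring.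
by rewrite hI mul1r rmorphD rmorphM !rmorph_nat.
Qed.

Definition cop (j : nat) (w : R) (V : X -> A) : X -> A := fun x =>
  s * yop w V x + j%:R * (io (d%:R + 2 * w) * V x - j%:R * V x - V x).

Lemma yop_cop j w V : yop w (cop j.+1 w V) = cop j (w - 1) (yop w V).
Proof.
(* On weight [w] the part of c_(j+1) free of y is multiplication by a real number, through which y
   passes unchanged. *)
pose r : R := j.+1%:R * (d%:R + 2 * w - j.+1%:R - 1).
have -> : cop j.+1 w V = fun x => s * yop w V x + io r * V x.
  by apply/funext => x; rewrite /cop /r !(rmorphM, rmorphD, rmorphN, rmorph_nat, rmorph1); ring.
rewrite yop_add yop_const yop_mul; apply/funext => x; rewrite /cop /r -natr1.
rewrite !(rmorphM, rmorphD, rmorphN, rmorph_nat, rmorph1); ring.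
Qed.

Fixpoint ypow (k : nat) (w : R) (V : X -> A) : X -> A :=
  if k is k'.+1 then yop (w - k'%:R) (ypow k' w V) else V.

Lemma ypow_const k w r V : ypow k w (fun x => io r * V x) = fun x => io r * ypow k w V x.
Proof. by elim: k => //= k ->; rewrite yop_const. Qed.

Lemma ypow_cop k j w V : ypow k w (cop (j + k) w V) = cop j (w - k%:R) (ypow k w V).
Proof.
elim: k j => [|k IHk] j /=; first by rewrite addn0 subr0.
by rewrite addnS -addSn IHk yop_cop -natr1 opprD addrA.
Qed.

(** Induction peels off the innermost factor, that of highest index: the powers of y collected so
    far are just enough to lower it to c_0 = xy, hence one more [s] and one more y. *)
Lemma yop_iter w V (q : nat -> R) l :
  yop w (foldr (fun j V x => io (q j) * cop j w V x) V (iota 1 l)) =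
  fun x => io (\prod_(j <- iota 1 l) q j) * (s ^+ l * ypow l.+1 w V x).
Proof.
elim: l V => [|l IHl] V.
  by apply/funext => x; rewrite big_nil /= rmorph1 expr0 !mul1r subr0.
rewrite (_ : iota 1 l.+1 = iota 1 l ++ [:: (1 + l)%N]); last by rewrite -[l.+1]addn1 iotaD.
rewrite foldr_cat.
rewrite [LHS](IHl (fun x => io (q (1 + l)%N) * cop (1 + l) w V x)); apply/funext => x.
have -> : ypow l.+1 w (fun x => io (q (1 + l)%N) * cop (1 + l) w V x) =
    fun x => io (q (1 + l)%N) * (s * ypow l.+2 w V x).
  rewrite ypow_const; apply/funext => y; congr (_ * _).
  by rewrite -[(1 + l)%N]/(0 + l.+1)%N ypow_cop /cop mul0r addr0.
by rewrite big_cat big_seq1 exprSr rmorphM; ring.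
Qed.

End Iteration.

(** * The ring of smooth functions on an open set *)

(* The ring structure needs the domain to be open, hence the proof in the type.
   The value outside the domain is fixed so that functions equal on it are equal. *)
Record smooth_function (R : realType) (d : nat) (U : set 'rV[R]_d) (Uo : open U) :=
  SmoothFunction {
    sval_of :> 'rV[R]_d -> R;
    sval_smooth : smooth_on U sval_of;
    sval_out : forall x, ~ U x -> sval_of x = 0
  }.

Section SmoothFunctions.
Variables (R : realType) (d : nat) (U : set 'rV[R]_d) (Uo : open U).
Local Notation sf := (smooth_function Uo).

Lemma sf_eqP (u v : sf) : (forall x, U x -> u x = v x) -> u = v.
Proof.
case: u v => [u su u0] [v sv v0] /= uv.
have E : u = v.
  by apply/funext => x; have [Ux|nUx] := pselect (U x); [exact: uv|rewrite u0 ?v0].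
by subst v; congr SmoothFunction; exact: Prop_irrelevance.
Qed.

Definition cutoff (f : 'rV[R]_d -> R) (x : 'rV[R]_d) : R := if `[< U x >] then f x else 0.

Lemma cutoffE f x : U x -> cutoff f x = f x.
Proof. by rewrite /cutoff => /asboolP ->. Qed.

Lemma cutoff_smooth f : smooth_on U f -> smooth_on U (cutoff f).
Proof. by apply: smooth_on_congr => // x Ux; rewrite cutoffE. Qed.

Lemma cutoff_out f x : ~ U x -> cutoff f x = 0.
Proof. by move=> nUx; rewrite /cutoff asboolF. Qed.

Definition sf_of f (hf : smooth_on U f) : sf :=
  SmoothFunction Uo (cutoff_smooth hf) (@cutoff_out f).

HB.instance Definition _ := gen_eqMixin sf.
HB.instance Definition _ := gen_choiceMixin sf.

Lemma smooth_onN f : smooth_on U f -> smooth_on U (fun x => - f x).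
Proof.
move=> sf; apply: (@smooth_on_congr _ _ U (cst (-1) * f)) => //.
  by move=> x _; rewrite -[LHS]/(-1 * f x) mulN1r.
by apply: smooth_onM => //; exact: smooth_on_cst.
Qed.

Definition sf_add (u v : sf) : sf := sf_of (smooth_onD Uo (sval_smooth u) (sval_smooth v)).
Definition sf_mul (u v : sf) : sf := sf_of (smooth_onM Uo (sval_smooth u) (sval_smooth v)).
Definition sf_opp (u : sf) : sf := sf_of (smooth_onN (sval_smooth u)).
Definition sf_cst (r : R) : sf := sf_of (smooth_on_cst r Uo).
Definition sf_partial (k : 'I_d) (u : sf) : sf :=
  locked (sf_of (@smooth_on_partial R d U u k (sval_smooth u))).

Lemma sf_addA : associative sf_add.
Proof.
by move=> u v w; apply: sf_eqP => x Ux; rewrite /= !cutoffE // !fctE !cutoffE // addrA.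
Qed.

Lemma sf_addC : commutative sf_add.
Proof. by move=> u v; apply: sf_eqP => x Ux; rewrite /= !cutoffE // addrC. Qed.

Lemma sf_add0 : left_id (sf_cst 0) sf_add.
Proof. by move=> u; apply: sf_eqP => x Ux; rewrite /= !cutoffE // !fctE !cutoffE // add0r. Qed.

Lemma sf_addN : left_inverse (sf_cst 0) sf_opp sf_add.
Proof. by move=> u; apply: sf_eqP => x Ux; rewrite /= !cutoffE // !fctE !cutoffE // addNr. Qed.

HB.instance Definition _ := GRing.isZmodule.Build sf sf_addA sf_addC sf_add0 sf_addN.

Lemma sf_mulA : associative sf_mul.
Proof.
by move=> u v w; apply: sf_eqP => x Ux; rewrite /= !cutoffE // !fctE !cutoffE // mulrA.
Qed.

Lemma sf_mulC : commutative sf_mul.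
Proof. by move=> u v; apply: sf_eqP => x Ux; rewrite /= !cutoffE // mulrC. Qed.

Lemma sf_mul1 : left_id (sf_cst 1) sf_mul.
Proof. by move=> u; apply: sf_eqP => x Ux; rewrite /= !cutoffE // !fctE !cutoffE // mul1r. Qed.

Lemma sf_mulD : left_distributive sf_mul sf_add.
Proof.
move=> u v w; apply: sf_eqP => x Ux; rewrite /= !cutoffE // !fctE !cutoffE //.
by rewrite -[LHS]/((u x + v x) * w x) mulrDl.
Qed.

HB.instance Definition _ := GRing.Zmodule_isComPzRing.Build sf sf_mulA sf_mulC sf_mul1 sf_mulD.

Lemma sfD (u v : sf) x : (u + v) x = u x + v x.
Proof.
have [Ux|nUx] := pselect (U x); first by rewrite -[LHS]/(cutoff _ x) cutoffE.
by rewrite !sval_out // addr0.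
Qed.

Lemma sfM (u v : sf) x : (u * v) x = u x * v x.
Proof.
have [Ux|nUx] := pselect (U x); first by rewrite -[LHS]/(cutoff _ x) cutoffE.
by rewrite !sval_out // mul0r.
Qed.

Lemma sfN (u : sf) x : (- u) x = - u x.
Proof.
have [Ux|nUx] := pselect (U x); first by rewrite -[LHS]/(cutoff _ x) cutoffE.
by rewrite !sval_out // oppr0.
Qed.

Lemma sf0 x : (0 : sf) x = 0.
Proof.
have [Ux|nUx] := pselect (U x); first by rewrite -[LHS]/(cutoff _ x) cutoffE.
by rewrite !sval_out.
Qed.

Lemma sf_sum (I : Type) (r : seq I) (F : I -> sf) x : (\sum_(i <- r) F i) x = \sum_(i <- r) F i x.
Proof. by elim: r => [|i r IHr]; rewrite ?big_nil ?sf0 // !big_cons sfD IHr. Qed.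

Lemma sf1 x : U x -> (1 : sf) x = 1.
Proof. by move=> Ux; rewrite -[LHS]/(cutoff _ x) cutoffE. Qed.

Lemma sf_prod (I : Type) (r : seq I) (F : I -> sf) x : U x ->
  (\prod_(i <- r) F i) x = \prod_(i <- r) F i x.
Proof. by move=> Ux; elim: r => [|i r IHr]; rewrite ?big_nil ?sf1 // !big_cons sfM IHr. Qed.

Lemma sf_cst_additive : zmod_morphism sf_cst.
Proof.
move=> r r'; apply: sf_eqP => x Ux; rewrite sfD sfN.
by rewrite -![(sf_cst _) x]/(cutoff _ x) !cutoffE.
Qed.

Lemma sf_cst_multiplicative : monoid_morphism sf_cst.
Proof.
split=> // r r'; apply: sf_eqP => x Ux; rewrite sfM.
by rewrite -![(sf_cst _) x]/(cutoff _ x) !cutoffE.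
Qed.

HB.instance Definition _ := GRing.isZmodMorphism.Build R sf sf_cst sf_cst_additive.
HB.instance Definition _ := GRing.isMonoidMorphism.Build R sf sf_cst sf_cst_multiplicative.

Lemma sf_ioE (r : R) x : U x -> sf_cst r x = r.
Proof. by move=> Ux; rewrite -[LHS]/(cutoff _ x) cutoffE. Qed.

Lemma sf_natE n x : U x -> (n%:R : sf) x = n%:R.
Proof. by move=> Ux; rewrite -(rmorph_nat sf_cst) sf_ioE. Qed.

Lemma sf_partialE k (u : sf) x : U x -> sf_partial k u x = partial k u x.
Proof. by move=> Ux; rewrite /sf_partial -lock -[LHS]/(cutoff _ x) cutoffE. Qed.

Lemma sf_derivations : derivations (sf_cst : {rmorphism R -> sf}) sf_partial.
Proof.
have dx (u : sf) a x : U x -> derivable u x (delta_mx 0 a).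
  exact: smooth_on_derivable (sval_smooth u).
split=> [a u v|a u v|a r]; apply: sf_eqP => x Ux.
- rewrite sfD !sf_partialE //; transitivity (partial a ((u : _ -> _) + (v : _ -> _)) x).
    by apply: near_partial Ux => // y Uy; rewrite sfD.
  by rewrite /partial deriveD //; exact: dx.
- rewrite sfD !sfM !sf_partialE //; transitivity (partial a ((u : _ -> _) * (v : _ -> _)) x).
    by apply: near_partial Ux => // y Uy; rewrite sfM.
  rewrite /partial deriveM; [|exact: dx|exact: dx].
  by rewrite addrC; congr (_ + _); exact: mulrC.
- rewrite sf_partialE // sf0; transitivity (partial a (cst r) x).
    by apply: near_partial Ux => // y Uy; rewrite sf_ioE.
  by rewrite /partial derive_cst.
Qed.

Lemma sf_partialC a b u : sf_partial a (sf_partial b u) = sf_partial b (sf_partial a u).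
Proof.
apply: sf_eqP => x Ux.
apply: etrans (sf_partialE a (sf_partial b u) Ux) _.
apply: etrans (esym (sf_partialE b (sf_partial a u) Ux)).
have E c e : partial c (sf_partial e u) x = partial c (partial e u) x.
  by apply: (near_partial _ Uo _ Ux) => y Uy; exact: sf_partialE.
rewrite !E; exact: partialC Uo (sval_smooth u) Ux.
Qed.

Lemma smooth_on_sum (I : Type) (r : seq I) (P : pred I) (F : I -> 'rV[R]_d -> R) :
  (forall i, smooth_on U (F i)) -> smooth_on U (fun x => \sum_(i <- r | P i) F i x).
Proof.
move=> sF; elim: r => [|i r IHr].
  by apply: smooth_on_congr (smooth_on_cst 0 Uo) => // x _; rewrite big_nil.
case Pi : (P i); last by apply: smooth_on_congr IHr => // x _; rewrite big_cons Pi.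
by apply: smooth_on_congr (smooth_onD Uo (sF i) IHr) => // x _; rewrite big_cons Pi.
Qed.

Lemma smooth_on_prod (I : Type) (r : seq I) (P : pred I) (F : I -> 'rV[R]_d -> R) :
  (forall i, smooth_on U (F i)) -> smooth_on U (fun x => \prod_(i <- r | P i) F i x).
Proof.
move=> sF; elim: r => [|i r IHr].
  by apply: smooth_on_congr (smooth_on_cst 1 Uo) => // x _; rewrite big_nil.
case Pi : (P i); last by apply: smooth_on_congr IHr => // x _; rewrite big_cons Pi.
by apply: smooth_on_congr (smooth_onM Uo (sF i) IHr) => // x _; rewrite big_cons Pi.
Qed.

Lemma smooth_on_det n (F : 'rV[R]_d -> 'M[R]_n) :
  (forall a b, smooth_on U (fun x => F x a b)) -> smooth_on U (fun x => \det (F x)).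
Proof.
move=> sF; apply: smooth_on_sum => s.
apply: (smooth_onM Uo (f := cst ((-1) ^+ s)) (g := fun x => \prod_i F x i (s i))).
  exact: smooth_on_cst.
by apply: smooth_on_prod => i; exact: sF.
Qed.

(** Cramer's rule: an entry of the inverse is a cofactor over the determinant, and the latter has no
    zeros on [U]. *)
Lemma smooth_on_invmx n (F : 'rV[R]_d -> 'M[R]_n) :
  (forall a b, smooth_on U (fun x => F x a b)) -> (forall x, U x -> F x \in unitmx) ->
  forall a b, smooth_on U (fun x => invmx (F x) a b).
Proof.
move=> sF uF a b.
have s1 : smooth_on U (fun x => (\det (F x))^-1).
  apply: smooth_on_inv => //; first exact: smooth_on_det.
  by move=> x Ux; rewrite -unitfE; have := uF x Ux; rewrite unitmxE.
have s2 : smooth_on U (fun x => (\adj (F x)) a b).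
  have s3 : smooth_on U (fun x => \det (row' b (col' a (F x)))).
    apply: smooth_on_det => k l.
    by apply: smooth_on_congr (sF (lift b k) (lift a l)) => // x _; rewrite !mxE.
  apply: smooth_on_congr (smooth_onM Uo (smooth_on_cst ((-1) ^+ (b + a)) Uo) s3) => // x _.
  by rewrite mxE /cofactor.
apply: smooth_on_congr (smooth_onM Uo s1 s2) => // x Ux.
by rewrite /invmx uF // mxE.
Qed.

End SmoothFunctions.

(** * Functions on a chart as ring elements *)

Lemma tmetric_sum (R : realType) (d : nat) (M : smooth_manifold R d) (g : metric M) j p
    (F : tix d -> tix d -> R) :
  \sum_B \sum_C tmetric g j p B C * F B C =
  F (top d) (bot d) + F (bot d) (top d) + \sum_a \sum_b ginv g j p a b * F (mid a) (mid b).
Proof.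
have z (I : finType) (G : I -> R) : \sum_k 0 * G k = 0 by rewrite big1 // => k _; rewrite mul0r.
rewrite big_tix !big_tix /= !z !mul0r !mul1r !add0r !addr0 addrA; congr (_ + _ + _).
by apply: eq_bigr => a _; rewrite big_tix /= !mul0r !add0r.
Qed.

Section Representation.
Variables (R : realType) (d : nat) (M : smooth_manifold R d) (i : chart M) (W : set M).
Hypothesis hW : W `<=` chart_dom i.
Variable Uo : open (chart_coord i @` W).
Local Notation U := (chart_coord i @` W).
Local Notation sf := (smooth_function Uo).
Local Notation io := (sf_cst Uo : {rmorphism R -> sf}).

(** [W] may be smaller than the domain of the chart, so that the same notion serves on overlaps. *)
Definition rep (f : M -> R) (u : sf) : Prop := forall p, W p -> f p = u (chart_coord i p).

Lemma in_image p : W p -> U (chart_coord i p).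
Proof. by move=> Wp; exists p. Qed.

Lemma smooth_rep f : smooth_on U (f \o chart_param i) -> exists u, rep f u.
Proof.
move=> sf; exists (sf_of Uo sf) => p Wp.
apply: esym; apply: etrans (cutoffE _ (in_image Wp)) _.
by rewrite /= chart_coordK //; exact: hW.
Qed.

Lemma rep_smooth f u : rep f u -> smooth_on U (f \o chart_param i).
Proof.
move=> fu; apply: smooth_on_congr (sval_smooth u) => // _ [p Wp <-] /=.
by rewrite chart_coordK ?fu //; exact: hW.
Qed.

Lemma rep_eq f u v : rep f u -> rep f v -> u = v.
Proof. by move=> fu fv; apply: sf_eqP => _ [p Wp <-]; rewrite -fu -?fv. Qed.

Lemma rep_pd f u k : rep f u -> rep (pd i k f) (sf_partial k u).
Proof.
move=> fu p Wp; apply: etrans (esym (sf_partialE k u (in_image Wp))).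
apply: (near_partial _ Uo _ (in_image Wp)) => _ [q Wq <-] /=.
by rewrite chart_coordK ?fu //; exact: hW.
Qed.

Lemma repD f u h v : rep f u -> rep h v -> rep (fun p => f p + h p) (u + v).
Proof. by move=> fu hv p Wp; rewrite sfD fu ?hv. Qed.

Lemma repM f u h v : rep f u -> rep h v -> rep (fun p => f p * h p) (u * v).
Proof. by move=> fu hv p Wp; rewrite sfM fu ?hv. Qed.

Lemma repN f u : rep f u -> rep (fun p => - f p) (- u).
Proof. by move=> fu p Wp; rewrite sfN fu. Qed.

Lemma rep_cst r : rep (fun=> r) (io r).
Proof. by move=> p Wp; apply: esym; apply: sf_ioE; exact: in_image. Qed.

Lemma rep_sum (I : finType) (F : I -> M -> R) (G : I -> sf) :
  (forall x, rep (F x) (G x)) -> rep (fun p => \sum_x F x p) (\sum_x G x).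
Proof. by move=> FG p Wp; rewrite sf_sum; apply: eq_bigr => x _; exact: FG. Qed.

Section Geometry.
Variables (j : chart M) (E : 'I_d -> sf -> sf).
Hypothesis HE : forall f u a, rep f u -> rep (pd j a f) (E a u).
Variables (g : metric M) (gA giA : 'I_d -> 'I_d -> sf).
Hypothesis Hg : forall a b, rep (fun p => g j p a b) (gA a b).
Hypothesis Hgi : forall a b, rep (fun p => ginv g j p a b) (giA a b).

(** Functions are read in chart [i], whereas the geometry is that of a chart [j] with derivations
    [E]. The lemmas of this section are thus used for [j] = [i] with the partial derivatives, and on
    an overlap with their combinations by the inverse Jacobian. *)
Lemma rep_christoffel k a b :
  rep (fun p => christoffel g j p k a b) (Chr io E gA giA k a b).
Proof.
apply: repM; first exact: rep_cst.
apply: rep_sum => l; apply: repM => //; apply: repD; last by apply: repN; exact: HE.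
by apply: repD; apply: HE.
Qed.

Lemma rep_ricci a b : rep (fun p => ricci g j p a b) (Ric io E gA giA a b).
Proof.
apply: rep_sum => k; apply: repD.
  apply: repD; first by apply: HE; exact: rep_christoffel.
  by apply: repN; apply: HE; exact: rep_christoffel.
apply: rep_sum => l; apply: repD; first by apply: repM; exact: rep_christoffel.
by apply: repN; apply: repM; exact: rep_christoffel.
Qed.

Lemma rep_Jtrace : rep (fun p => Jtrace g j p) (Jtr io E gA giA).
Proof.
apply: repM; last exact: rep_cst.
by apply: rep_sum => a; apply: rep_sum => b; apply: repM => //; exact: rep_ricci.
Qed.

Lemma rep_schouten a b : rep (fun p => schouten g j p a b) (Sch io E gA giA a b).
Proof.
apply: repM; last exact: rep_cst.
apply: repD; first exact: rep_ricci.
by apply: repN; apply: repM => //; exact: rep_Jtrace.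
Qed.

Lemma rep_laplacian f u : rep f u -> rep (laplacian g j f) (Lap0 io E gA giA u).
Proof.
move=> fu; apply: rep_sum => a; apply: rep_sum => b; apply: repM => //.
apply: repD; first by apply: HE; exact: HE.
apply: repN; apply: rep_sum => k; apply: repM; first exact: rep_christoffel.
exact: HE.
Qed.

Lemma rep_tconn a x y : rep (fun p => tconn g j p a x y) (tcon io E gA giA a x y).
Proof.
have r0 : rep (fun=> 0) 0 by move=> p _; rewrite sf0.
case: x => [[b|]|]; case: y => [[c|]|] //=.
- by apply: repN; exact: rep_christoffel.
- exact: rep_schouten.
- apply: repN; apply: rep_sum => b; apply: repM => //; exact: rep_schouten.
- by move=> p Wp; rewrite sfN sf_natE //; exact: in_image.
Qed.

Section Tensors.
Variable n : nat.
Local Notation X := (tindex d n).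
Local Notation nab := (tnab E (tcon io E gA giA)).

Lemma rep_nabla a (V : M -> tensor R d n) (v : X -> sf) x :
  (forall x, rep (fun p => V p x) (v x)) -> rep (fun p => nabla g j a V p x) (nab a v x).
Proof.
move=> Vv; apply: repD; first exact: HE.
by apply: rep_sum => m; apply: rep_sum => B; apply: repM => //; exact: rep_tconn.
Qed.

Lemma rep_tlaplacian (V : M -> tensor R d n) (v : X -> sf) x :
  (forall x, rep (fun p => V p x) (v x)) ->
  rep (fun p => tlaplacian g j V p x) (Lap io E gA giA nab v x).
Proof.
move=> Vv; apply: rep_sum => a; apply: rep_sum => b; apply: repM => //.
apply: repD; first by apply: rep_nabla => y; exact: rep_nabla.
apply: repN; apply: rep_sum => k; apply: repM; first exact: rep_christoffel.
exact: rep_nabla.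
Qed.

Variables (sigma : density M) (s : sf).
Hypothesis Hs : rep (sigma g) s.

Lemma rep_rho : rep (fun p => scale_tractor sigma g j p (bot d)) (rho io E gA giA s).
Proof.
apply: repM; first by apply: repN; exact: rep_cst.
apply: repD; first exact: rep_laplacian.
by apply: repM => //; exact: rep_Jtrace.
Qed.

Lemma rep_Isq : rep (fun p => Isq sigma g j p) (Iq io E gA giA s).
Proof.
move=> p Wp; rewrite /Iq sfD mulr2n sfD sfM -(rep_rho Wp) -(Hs Wp).
have <- : \sum_a \sum_b ginv g j p a b * (pd j a (sigma g) p * pd j b (sigma g) p) =
    ip giA (E^~ s) (E^~ s) (chart_coord i p).
  have : rep (fun p => \sum_a \sum_b ginv g j p a b * (pd j a (sigma g) p * pd j b (sigma g) p))
     (ip giA (E^~ s) (E^~ s)).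
    by apply: rep_sum => a; apply: rep_sum => b; apply: repM => //; apply: repM; exact: HE.
  by move=> /(_ p Wp).
rewrite /Isq; under eq_bigr do under eq_bigr do rewrite -mulrA.
rewrite tmetric_sum /=; ring.
Qed.

Lemma rep_IdotD (w : R) (V : tfield M n) (v : X -> sf) x :
  (forall x, rep (fun p => V g j p x) (v x)) ->
  rep (fun p => IdotD sigma w V g j p x) (IdD io E gA giA nab s (io w) v x).
Proof.
move=> Vv p Wp; have Up := in_image Wp.
have r_ip : rep (fun p => \sum_a \sum_b ginv g j p a b * (pd j a (sigma g) p * nabla g j b (V g j) p x))
     (ip giA (E^~ s) (fun a => nab a v x)).
  apply: rep_sum => a; apply: rep_sum => b; apply: repM => //; apply: repM; first exact: HE.
  exact: rep_nabla.
have r_w : rep (fun=> d%:R + 2 * w - 2) (d%:R + 2 * io w - 2).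
  move=> q Wq; rewrite !(sfD, sfN, sfM) (sf_natE Uo d) ?(sf_natE Uo 2) ?(sf_ioE Uo) //; exact: in_image.
have r_all := repD (repM r_w (repD r_ip (repM (repM (rep_cst w) rep_rho) (Vv x))))
  (repN (repM Hs (repD (rep_tlaplacian x Vv) (repM (repM rep_Jtrace (rep_cst w)) (Vv x))))).
rewrite /IdD -(r_all p Wp) /IdotD.
under eq_bigr do under eq_bigr do rewrite -mulrA.
rewrite tmetric_sum /=.
have -> : \sum_a \sum_b ginv g j p a b * (pd j a (sigma g) p *
      ((d%:R + 2 * w - 2) * nabla g j b (V g j) p x)) = (d%:R + 2 * w - 2) *
    \sum_a \sum_b ginv g j p a b * (pd j a (sigma g) p * nabla g j b (V g j) p x).
  by rewrite mulr_sumr; apply: eq_bigr => a _; rewrite mulr_sumr; apply: eq_bigr => b _; ring.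
rewrite /=; ring.
Qed.

End Tensors.
End Geometry.
End Representation.

(** * Overlaps of charts *)

Section Charts.
Variables (R : realType) (d : nat) (M : smooth_manifold R d).
Implicit Types (i j : chart M) (p : M).

Lemma overlap_open i j : open (chart_coord i @` (chart_dom i `&` chart_dom j)).
Proof.
rewrite openE => _ [p [ip jp] <-].
have n1 : \forall x \near chart_coord i p, (chart_coord i @` chart_dom i) x.
  by apply: open_nbhs_nbhs; split; [exact: image_open|exists p].
have n2 : \forall x \near chart_coord i p, chart_dom j (chart_param i x).
  apply: param_continuous; first by exists p.
  by rewrite chart_coordK //; apply: open_nbhs_nbhs; split => //; exact: dom_open.
apply: (@filterS2 _ _ (nbhs_filter _) _ _ _ _ n1 n2) => _ [q iq <-].
by rewrite chart_coordK // => jq; exists q.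
Qed.

Lemma derive_coord (b c : 'I_d) (x : 'rV[R]_d) :
  'D_(delta_mx 0 b) (fun y : 'rV[R]_d => y 0 c) x = (b == c)%:R.
Proof.
have did : derivable (id : 'rV[R]_d -> 'rV[R]_d) x (delta_mx 0 b) by exact: derivable_id.
have := derive_mx did.
rewrite derive_id => /matrixP /(_ 0 c); rewrite !mxE eqxx /= => <-.
by rewrite eq_sym.
Qed.

Lemma pd_coord j (b c : 'I_d) p : chart_dom j p ->
  pd j b (fun q => chart_coord j q 0 c) p = (b == c)%:R.
Proof.
move=> jp; transitivity (partial b (fun y : 'rV[R]_d => y 0 c) (chart_coord j p)).
  2: exact: derive_coord.
apply: (near_partial _ (@image_open _ _ _ j)) => [_ [q jq <-] /=|]; last by exists p.
by rewrite chart_coordK.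
Qed.

Section Overlap.
Variables i j : chart M.
Local Notation W := (chart_dom i `&` chart_dom j).
Let hW : W `<=` chart_dom i. Proof. by move=> p []. Qed.
Let Uo : open (chart_coord i @` W) := @overlap_open i j.
Local Notation sf := (smooth_function Uo).
Local Notation rep := (@rep R d M i W Uo).

(** In the coordinates of [j], [f] is its representative in chart [i] composed with the transition
    map. *)
Lemma pd_chain f (u : sf) b p : rep f u -> W p ->
  pd j b f p = \sum_a jac j i p b a * pd i a f p.
Proof.
move=> fu Wp; have [ip jp] := Wp.
have jU : (chart_coord j @` (chart_dom j `&` chart_dom i)) (chart_coord j p) by exists p.
pose phi := chart_coord i \o chart_param j.
have px : phi (chart_coord j p) = chart_coord i p by rewrite /phi /= chart_coordK.
have := @chain_rule R d _ u phi (chart_coord j p) (delta_mx 0 b) Uo (sval_smooth u).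
rewrite px => /(_ (in_image i Wp)) CR.
transitivity (partial b (u \o phi) (chart_coord j p)).
  apply: (near_partial _ (@overlap_open j i) _ jU) => _ [q [jq iq] <-] /=.
  by rewrite /phi /= chart_coordK // fu.
rewrite [LHS]CR; last first.
  move=> a; have := @smooth_on_derivable R d _ _ b _ (@transition_smooth _ _ _ j i a) jU.
  by [].
apply: eq_bigr => a _; congr (_ * _).
by rewrite (rep_pd hW a fu Wp); apply: esym; apply: sf_partialE; exact: in_image.
Qed.

(** K J = 1 is the chain rule for the coordinates of [j] themselves. The entries of [K] are
    derivatives taken in chart [j]; their smoothness in the coordinates of [i] follows from K being
    the inverse matrix of J. *)
Lemma overlap_jacobian : exists J K : 'I_d -> 'I_d -> sf,
  [/\ forall a b, rep (fun p => jac i j p a b) (J a b),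
      forall a b, rep (fun p => jac j i p a b) (K a b),
      forall a c, \sum_b J a b * K b c = (a == c)%:R,
      forall a c, \sum_b K a b * J b c = (a == c)%:R &
      forall a b c, sf_partial a (J b c) = sf_partial b (J a c)].
Proof.
have /choice[y hy] : forall c, exists u : sf, rep (fun q => chart_coord j q 0 c) u.
  by move=> c; apply: smooth_rep => //; exact: (@transition_smooth _ _ _ i j c).
pose J a b := sf_partial a (y b).
have hJ a b : rep (fun p => jac i j p a b) (J a b) by exact: rep_pd (hy b).
pose Jm p := \matrix_(a, b) jac i j p a b.
pose Km p := \matrix_(a, b) jac j i p a b.
have KJm p : W p -> Km p *m Jm p = 1%:M.
  move=> Wp; apply/matrixP => b c; rewrite !mxE -(pd_coord b c (proj2 Wp)).
  rewrite (pd_chain b (hy c) Wp); apply: eq_bigr => a _.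
  by rewrite !mxE.
have JKm p : W p -> Jm p *m Km p = 1%:M by move=> /KJm /mulmx1C.
have Ki p : W p -> Km p = invmx (Jm p).
  move=> Wp; have [uJ _] := mulmx1_unit (JKm p Wp).
  by rewrite -[Km p](mulKmx uJ) JKm // mulmx1.
have /choice[K hK] : forall ab : 'I_d * 'I_d, exists u : sf, rep (fun p => jac j i p ab.1 ab.2) u.
  move=> -[a b] /=.
  apply: smooth_rep => //.
  have : smooth_on (chart_coord i @` W) (fun x => invmx (Jm (chart_param i x)) a b).
    apply: smooth_on_invmx => // [a' b'|_ [p Wp <-]].
      apply: smooth_on_congr (rep_smooth hW (hJ a' b')) => // x _ /=.
      by rewrite mxE.
    rewrite chart_coordK //; last exact: hW.
    by have [uJ _] := mulmx1_unit (JKm p Wp).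
  apply: smooth_on_congr => // _ [p Wp <-] /=.
  by rewrite chart_coordK //; [rewrite -Ki // mxE|exact: hW].
exists J, (fun a b => K (a, b)); split.
- exact: hJ.
- by move=> a b; exact: (hK (a, b)).
- move=> a c; apply: sf_eqP => _ [p Wp <-].
  rewrite sf_sum (sf_natE _ _ (in_image i Wp)).
  transitivity ((Jm p *m Km p) a c); last by rewrite JKm // mxE.
  rewrite mxE; apply: eq_bigr => b _; rewrite sfM !mxE -(hJ a b) //.
  by rewrite -(hK (b, c)).
- move=> a c; apply: sf_eqP => _ [p Wp <-].
  rewrite sf_sum (sf_natE _ _ (in_image i Wp)).
  transitivity ((Km p *m Jm p) a c); last by rewrite KJm // mxE.
  rewrite mxE; apply: eq_bigr => b _; rewrite sfM !mxE -(hJ b c) //.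
  by rewrite -(hK (a, b)).
- by move=> a b c; exact: sf_partialC.
Qed.

End Overlap.

Lemma metric_rep i j W (Uo : open (chart_coord i @` W)) (g : metric M) :
  W `<=` chart_dom i -> W `<=` chart_dom j -> is_metric g ->
  (forall a b, exists u, @rep _ _ _ i W Uo (fun p => g j p a b) u) ->
  exists gA giA, [/\ forall a b, @rep _ _ _ i W Uo (fun p => g j p a b) (gA a b),
    forall a b, @rep _ _ _ i W Uo (fun p => ginv g j p a b) (giA a b) & metric_pair gA giA].
Proof.
move=> Wi Wj [gu gT _ _] gs.
have /choice[gA hgA] : forall ab : 'I_d * 'I_d, exists u, @rep _ _ _ i W Uo (fun p => g j p ab.1 ab.2) u.
  by move=> ab; exact: gs.
have /choice[giA hgiA] : forall ab : 'I_d * 'I_d,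
    exists u, @rep _ _ _ i W Uo (fun p => ginv g j p ab.1 ab.2) u.
  move=> -[a b] /=.
  apply: smooth_rep => //.
  apply: (@smooth_on_invmx R d _ Uo d (fun x => g j (chart_param i x))) => [a' b'|_ [p Wp <-]].
    exact: (rep_smooth Wi (hgA (a', b'))).
  by rewrite chart_coordK; [apply: gu; exact: Wj|exact: Wi].
exists (fun a b => gA (a, b)), (fun a b => giA (a, b)); split.
- by move=> a b; exact: (hgA (a, b)).
- by move=> a b; exact: (hgiA (a, b)).
split=> [a b|a b|a c].
- apply: (@rep_eq _ _ _ i W Uo (fun p => g j p a b)); first exact: (hgA (a, b)).
  by move=> p Wp; rewrite -(hgA (b, a)) //= -[in LHS]gT ?mxE //; exact: Wj.
- apply: (@rep_eq _ _ _ i W Uo (fun p => ginv g j p a b)); first exact: (hgiA (a, b)).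
  move=> p Wp; rewrite -(hgiA (b, a)) //= /ginv.
  by rewrite -[in LHS]gT -?trmx_inv ?mxE //; exact: Wj.
- apply: sf_eqP => _ [p Wp <-].
  rewrite sf_sum (sf_natE _ _ (in_image i Wp)).
  transitivity ((g j p *m invmx (g j p)) a c).
    by rewrite mxE; apply: eq_bigr => b _; rewrite sfM -(hgA (a, b)) // -(hgiA (b, c)).
  by rewrite mulmxV ?mxE //; apply: gu; exact: Wj.
Qed.

End Charts.

(** * Invariance of the operator y *)

(** [tpow_parallel] applies to the connection form contracted with [J]; since D = J D', the factor
    [J] then splits off the whole covariant derivative. *)
Lemma tpow_coordinates (R : realType) (A : comPzRingType) (io : {rmorphism R -> A}) (d n : nat)
    (D D' : 'I_d -> A -> A) (J : 'I_d -> 'I_d -> A) (T T' : 'I_d -> tix d -> tix d -> A)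
    (s : tix d -> tix d -> A) : derivations io D ->
  (forall a u, D a u = \sum_b J a b * D' b u) ->
  (forall a x y, D a (s x y) + \sum_z T a x z * s z y = \sum_b J a b * \sum_z s x z * T' b z y) ->
  forall a (V : tindex d n -> A) x,
    tnab D T a (tpow s V) x = \sum_b J a b * tpow s (tnab D' T' b V) x.
Proof.
move=> hD DJ sT a V x.
rewrite (@tpow_parallel _ _ _ _ _ _ hD s (fun a x y => \sum_b J a b * T' b x y)); last first.
  move=> k y z; rewrite sT; under eq_bigr do rewrite mulr_sumr.
  rewrite exchange_big; apply: eq_bigr => u _ /=; rewrite mulr_sumr.
  by apply: eq_bigr => b _; rewrite mulrCA.
have -> : tnab D (fun a x y => \sum_b J a b * T' b x y) a V =
    fun y => \sum_b J a b * tnab D' T' b V y.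
  apply/funext => y; rewrite /tnab DJ; under [RHS]eq_bigr do rewrite mulrDr.
  rewrite big_split; congr (_ + _) => /=; under [RHS]eq_bigr do rewrite mulr_sumr.
  rewrite [RHS]exchange_big; apply: eq_bigr => m _ /=; under [RHS]eq_bigr do rewrite mulr_sumr.
  rewrite [RHS]exchange_big; apply: eq_bigr => B _ /=; rewrite mulr_suml.
  by apply: eq_bigr => b _; rewrite mulrA.
have hS : linear_op (@tpow A d n s) by exact: tpow_linear.
have [_ SM] := hS.
by rewrite linear_op_sum //; apply: eq_bigr => b _; rewrite SM.
Qed.

Section Sections.
Variables (R : realType) (d : nat) (hd : (3 <= d)%N) (M : smooth_manifold R d).
Variables (c : set (metric M)) (sigma : density M).
Hypothesis hAR : almost_riemannian c sigma.
Hypothesis hI : forall (g : metric M) (i : chart M) (p : M),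
  c g -> chart_dom i p -> Isq sigma g i p != 0.
Variables (n : nat) (Phi : set (natural_endo R n)).
Local Notation X := (tindex d n).

Let cM g : c g -> is_metric g.
Proof. by case: hAR => -[_ cM _] _ _; exact: cM. Qed.

Lemma image_sub (i : chart M) (W : set M) : W `<=` chart_dom i ->
  chart_coord i @` W `<=` chart_coord i @` chart_dom i.
Proof. by move=> Wi _ [p Wp <-]; exists p => //; exact: Wi. Qed.

Lemma smooth_in_rep (i : chart M) (W : set M) (Uo : open (chart_coord i @` W)) f :
  W `<=` chart_dom i -> smooth_in i f -> exists u, @rep _ _ _ i W Uo f u.
Proof.
move=> Wi sf; apply: smooth_rep => //; apply: smooth_on_sub sf; exact: image_sub.
Qed.

Lemma own_metric_rep (i : chart M) (W : set M) (Uo : open (chart_coord i @` W)) g :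
  W `<=` chart_dom i -> c g -> exists gA giA,
  [/\ forall a b, @rep _ _ _ i W Uo (fun p => g i p a b) (gA a b),
      forall a b, rep (fun p => ginv g i p a b) (giA a b) & metric_pair gA giA].
Proof.
move=> Wi cg; have gm := cM cg; have [_ _ gs _] := gm.
by apply: metric_rep => // a b; apply: smooth_in_rep => //; exact: gs.
Qed.

Lemma section_rep (i : chart M) (W : set M) (Uo : open (chart_coord i @` W)) w V g :
  W `<=` chart_dom i -> is_section c Phi w V -> c g ->
  exists v : X -> smooth_function Uo, forall x, rep (fun p => V g i p x) (v x).
Proof.
move=> Wi [Vs _ _ _] cg.
have /choice[v hv] : forall x, exists u : smooth_function Uo, rep (fun p => V g i p x) u.
  by move=> x; apply: smooth_in_rep => //; exact: Vs.
by exists v.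
Qed.

Lemma sigma_rep (i : chart M) (W : set M) (Uo : open (chart_coord i @` W)) g :
  W `<=` chart_dom i -> c g -> exists u, @rep _ _ _ i W Uo (sigma g) u.
Proof. by move=> Wi cg; apply: smooth_in_rep => //; case: hAR => _ [sc _] _; exact: sc. Qed.

Lemma repX (i : chart M) (W : set M) (Uo : open (chart_coord i @` W)) (I : finType)
    (F : I -> M -> R) (G : I -> smooth_function Uo) :
  (forall x, rep (F x) (G x)) -> rep (fun p => \prod_x F x p) (\prod_x G x).
Proof.
move=> FG p Wp; rewrite sf_prod; last exact: in_image.
by apply: eq_bigr => x _; exact: FG.
Qed.

Lemma rep_tpow (i : chart M) (W : set M) (Uo : open (chart_coord i @` W))
    (F : M -> tix d -> tix d -> R) (G : tix d -> tix d -> smooth_function Uo)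
    (V : M -> tensor R d n) (v : X -> smooth_function Uo) (x : X) :
  (forall x y, rep (fun p => F p x y) (G x y)) -> (forall x, rep (fun p => V p x) (v x)) ->
  rep (fun p => \sum_(y : X) (\prod_m F p (x m) (y m)) * V p y) (tpow G v x).
Proof. by move=> FG Vv; apply: rep_sum => y; apply: repM => //; apply: repX => m; exact: FG. Qed.

Lemma y_op_chart w (V : tfield M n) g i j p (x : X) : is_section c Phi w V -> c g ->
  chart_dom i p -> chart_dom j p ->
  y_op sigma w V g i p x =
  \sum_(y : X) (\prod_m chart_mx i j p (x m) (y m)) * y_op sigma w V g j p y.
Proof.
move=> sV cg ip jp.
pose W := chart_dom i `&` chart_dom j.
have Wi : W `<=` chart_dom i by move=> q [].
have Wj : W `<=` chart_dom j by move=> q [].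
have Wp : W p by [].
pose Uo : open (chart_coord i @` W) := @overlap_open _ _ _ i j.
have [J [K [hJ hK JK KJ Jsym]]] := overlap_jacobian i j.
pose D := @sf_partial _ _ _ Uo.
pose D' (b : 'I_d) (u : smooth_function Uo) := \sum_a K b a * D a u.
pose io := sf_cst Uo : {rmorphism R -> smooth_function Uo}.
have hD : derivations io D := sf_derivations Uo.
have hD' : derivations io D'.
  have [DD DM Dio] := hD; split=> [a u v|a u v|a r]; rewrite /D'.
  - by under eq_bigr do rewrite DD mulrDr; rewrite big_split.
  - under eq_bigr do rewrite DM mulrDr; rewrite big_split mulr_suml mulr_sumr /=.
    by congr (_ + _); apply: eq_bigr => b _; ring.
  - by rewrite big1 // => b _; rewrite Dio mulr0.
have DJ a u : D a u = \sum_b J a b * D' b u.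
  rewrite /D' sum_contract; under eq_bigr do rewrite JK.
  by rewrite sum_delta'.
have HE f u b : rep f u -> rep (pd j b f) (D' b u).
  move=> fu q Wq; rewrite (pd_chain b fu Wq) /D'.
  have : rep (fun q => \sum_a jac j i q b a * pd i a f q) (\sum_a K b a * D a u).
    by apply: rep_sum => a; apply: repM; [exact: hK|exact: rep_pd].
  by move=> /(_ q Wq).
have gm := cM cg; have [_ _ _ gc] := gm.
have [gA [giA [hgA hgiA mp]]] := own_metric_rep Uo Wi cg.
have [gB [giB [hgB hgiB mp']]] : exists gB giB,
    [/\ forall a b, @rep _ _ _ i W Uo (fun p => g j p a b) (gB a b),
    forall a b, rep (fun p => ginv g j p a b) (giB a b) & metric_pair gB giB].
  apply: metric_rep => // a b.
  (* The Gram matrix of chart [j] is smooth in the coordinates of [i] because the transformation law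
     expresses it through [K] and [gA]. *)
  exists (\sum_k \sum_l K a k * K b l * gA k l) => q Wq; have [iq jq] := Wq.
  rewrite (gc j i q a b jq iq).
  have : rep (fun q => \sum_k \sum_l jac j i q a k * jac j i q b l * g i q k l)
    (\sum_k \sum_l K a k * K b l * gA k l).
    by apply: rep_sum => k; apply: rep_sum => l; apply: repM => //; apply: repM.
  by move=> /(_ q Wq).
have gJ a b : gA a b = \sum_k \sum_l J a k * J b l * gB k l.
  apply: (rep_eq (hgA a b)) => q Wq; have [iq jq] := Wq.
  rewrite (gc i j q a b iq jq).
  have : rep (fun q => \sum_k \sum_l jac i j q a k * jac i j q b l * g j q k l)
    (\sum_k \sum_l J a k * J b l * gB k l).
    by apply: rep_sum => k; apply: rep_sum => l; apply: repM => //; apply: repM.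
  by move=> /(_ q Wq).
have chartJ i' j' L : (forall a b, @rep _ _ _ i W Uo (fun p => jac i' j' p a b) (L a b)) ->
    forall x y, rep (fun p => chart_mx i' j' p x y) (chart_mat L x y).
  move=> hL; case=> [[a|]|] [[b|]|] //=; try (by move=> q Wq; rewrite sf0);
    by move=> q Wq; rewrite sf1 //; exact: in_image.
have [s hs] := sigma_rep Uo Wi cg.
have [v hv] := section_rep Uo Wi sV cg.
have [_ Vc _ _] := sV.
(* The components in chart [j] come from those in chart [i] through [K]; the reverse law then writes
   [v] as a tensor power applied to [v'], the form that [IdD_J] requires. *)
pose v' := tpow (chart_mat K) v.
have hv' y : rep (fun p => V g j p y) (v' y).
  move=> q Wq; have [iq jq] := Wq; rewrite (Vc g j i q y cg jq iq).
  exact: (rep_tpow y (chartJ j i K hK) hv).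
have vE : v = tpow (chart_mat J) v'.
  apply/funext => y; apply: (rep_eq (hv y)) => q Wq; have [iq jq] := Wq.
  rewrite (Vc g i j q y cg iq jq).
  exact: (rep_tpow y (chartJ i j J hJ) hv').
have HEi f u b : rep f u -> rep (pd i b f) (D b u) by exact: rep_pd.
have Dcomm a b u : D a (D b u) = D b (D a u) by exact: sf_partialC.
have nabJ := tpow_coordinates hD DJ
  (chart_mat_parallel hD mp hD' mp' DJ JK KJ Jsym Dcomm gJ).
have Iij : Isq sigma g i p = Isq sigma g j p.
  rewrite (rep_Isq HEi hgA hgiA hs Wp) (rep_Isq HE hgB hgiB hs Wp).
  by rewrite (Iq_J hD mp hD' mp' DJ JK KJ Jsym Dcomm gJ).
rewrite /y_op Iij; under eq_bigr do rewrite mulrCA; rewrite -mulr_sumr; congr (_ * _).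
rewrite (rep_IdotD HEi hgA hgiA hs w x hv Wp) vE.
have hc := tnab_connection n hD (tcon io D gA giA).
have hl := @tpow_linear _ d n (chart_mat J).
rewrite (IdD_J hD mp hD' mp' DJ JK KJ Jsym Dcomm gJ _ _ _ _ hc hl (nabJ n)).
have Rj y := rep_IdotD HE hgB hgiB hs w y hv'.
by rewrite -(rep_tpow x (chartJ i j J hJ) Rj).
Qed.

Lemma rep_expR (i : chart M) (W : set M) (Uo : open (chart_coord i @` W)) f
    (u : smooth_function Uo) : W `<=` chart_dom i -> rep f u ->
  exists2 e : smooth_function Uo, rep (fun p => expR (f p)) e &
    forall a, sf_partial a e = e * sf_partial a u.
Proof.
move=> Wi fu.
have [e he] : exists e : smooth_function Uo, rep (fun p => expR (f p)) e.
  by apply: smooth_rep => //; exact: smooth_on_exp Uo (rep_smooth Wi fu).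
exists e => // a; apply: (rep_eq (rep_pd Wi a he)) => p Wp.
have Up := in_image i Wp.
have df : derivable (f \o chart_param i) (chart_coord i p) (delta_mx 0 a).
  exact: (smooth_on_derivable (rep_smooth Wi fu) Up).
have [_ De] := is_derive_expR_comp df.
rewrite sfM -(he p Wp) -(rep_pd Wi a fu Wp); apply: etrans De _.
by rewrite /= chart_coordK //; exact: Wi.
Qed.

Lemma y_op_scale w (V : tfield M n) g g' om i p (x : X) : is_section c Phi w V ->
  c g -> c g' -> smooth_fun om -> rescales om g g' -> chart_dom i p ->
  y_op sigma w V g' i p x = expR ((w - 1) * om p) *
  \sum_(y : X) (\prod_m scale_mx g om i p (x m) (y m)) * y_op sigma w V g i p y.
Proof.
move=> sV cg cg' som resc ip.
pose W := chart_dom i.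
have Wi : W `<=` chart_dom i by [].
pose Uo : open (chart_coord i @` W) := @image_open _ _ _ i.
pose D := @sf_partial _ _ _ Uo.
pose io := sf_cst Uo : {rmorphism R -> smooth_function Uo}.
have hD : derivations io D := sf_derivations Uo.
have [_ DM Dio] := hD.
have [gA [giA [hgA hgiA mp]]] := own_metric_rep Uo Wi cg.
have [z hz] : exists z, @rep _ _ _ i W Uo om z by apply: smooth_in_rep => //; exact: som.
have [E hE DE] := rep_expR Wi hz.
have [Ei hEi _] := rep_expR Wi (repN hz).
have [Ew hEw DEw] := rep_expR Wi (repM (rep_cst Uo w) hz).
pose U a := D a z.
have EEi : E * Ei = 1.
  apply: (rep_eq (repM hE hEi)) => q Wq.
  by rewrite expRN divff ?gt_eqF ?expR_gt0 // sf1 //; exact: in_image.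
have Uclosed a b : D a (U b) = D b (U a) by exact: sf_partialC.
have DEw' a : D a Ew = io w * U a * Ew.
  have -> : D a Ew = Ew * D a (io w * z) := DEw a.
  by rewrite DM Dio mul0r add0r mulrC.
pose gh a b := E * E * gA a b; pose gih a b := Ei * Ei * giA a b.
have hgh a b : rep (fun p => g' i p a b) (gh a b).
  move=> q Wq; rewrite (resc i q Wq) mxE mulr_natl mulr2n expRD.
  exact: (repM (repM hE hE) (hgA a b)).
have hgih a b : rep (fun p => ginv g' i p a b) (gih a b).
  move=> q Wq; rewrite /ginv (resc i q Wq) invmxZ; last first.
    by rewrite -resc //; have [gu' _ _ _] := cM cg'; exact: gu'.
  rewrite mxE mulr_natl mulr2n expRD invfM -!expRN.
  exact: (repM (repM hEi hEi) (hgiA a b)).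
have [s hs] := sigma_rep Uo Wi cg.
have hs' : rep (sigma g') (E * s).
  move=> q Wq; have [_ [_ sc] _] := hAR.
  by rewrite (sc g g' om cg cg' som resc) mul1r; exact: (repM hE hs).
have [v hv] := section_rep Uo Wi sV cg.
have HE f u b : rep f u -> rep (pd i b f) (D b u) by exact: rep_pd.
have hS x' y : rep (fun p => scale_mx g om i p x' y) (scale_mat io giA E Ei U x' y).
  have hU a : rep (fun p => pd i a om p) (U a) by exact: HE.
  have r0 : @rep _ _ _ i W Uo (fun=> 0) 0 by move=> q Wq; rewrite sf0.
  case: x' => [[a|]|]; case: y => [[b|]|] //=.
  - by apply: repM => // q Wq; rewrite sf_natE //; exact: in_image.
  - exact: repM.
  - apply: repM; first exact: repN.
    by apply: rep_sum => a; apply: repM.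
  - apply: repM; first exact: repN.
    apply: repM; first exact: rep_cst.
    by apply: rep_sum => a; apply: rep_sum => k; apply: repM => //; apply: repM.
pose S := @tpow _ d n (scale_mat io giA E Ei U).
have [_ _ Vs _] := sV.
have hv' y : rep (fun p => V g' i p y) (Ew * S v y).
  move=> q Wq; rewrite (Vs g g' om cg cg' som resc i q y Wq).
  exact: (repM hEw (rep_tpow y hS hv)).
have hSl : linear_op S by exact: tpow_linear.
have hSp a V' : tnab D (tcon io D gh gih) a (S V') = S (tnab D (tcon io D gA giA) a V').
  apply: (tpow_parallel hD) => a' x' y'.
  exact: (scale_mat_parallel hD mp EEi DE Uclosed hd).
have hc := tnab_connection n hD (tcon io D gh gih).
have Dw a : D a (io w) = 0 by exact: Dio.
have Iij : Isq sigma g' i p = Isq sigma g i p.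
  rewrite (rep_Isq HE hgh hgih hs' ip) (rep_Isq HE hgA hgiA hs ip).
  by rewrite (Iq_conf hD mp EEi DE Uclosed hd).
rewrite /y_op Iij.
under [in RHS]eq_bigr do rewrite mulrCA; rewrite -mulr_sumr [RHS]mulrCA; congr (_ * _).
rewrite (rep_IdotD HE hgh hgih hs' w x hv' ip).
(* The metric changes while the tractor connection remains that of [g']; [S], which intertwines the
   two connections, then passes to that of [g]. *)
rewrite (IdD_conf hD mp EEi DE Uclosed hd s (S v) x hc Dw DEw').
rewrite (IdD_parallel io D gA giA s (io w) v x hSl hSp) !sfM -(hEi p ip) -(hEw p ip).
rewrite -expRD (_ : - om p + w * om p = (w - 1) * om p); last by ring.
congr (_ * _).
have Rj y := rep_IdotD HE hgA hgiA hs w y hv.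
by rewrite -(rep_tpow x hS Rj).
Qed.

Lemma rep_endo (i : chart M) (W : set M) (Uo : open (chart_coord i @` W)) (g : metric M)
    (gA giA : 'I_d -> 'I_d -> smooth_function Uo) (V : M -> tensor R d n)
    (v : X -> smooth_function Uo) (e : natural_endo R n) (x : X) :
  (forall a b, rep (fun p => g i p a b) (gA a b)) ->
  (forall a b, rep (fun p => ginv g i p a b) (giA a b)) ->
  (forall x, rep (fun p => V p x) (v x)) ->
  rep (fun p => endo_act g i p e (V p) x)
    (endo (sf_cst Uo : {rmorphism R -> smooth_function Uo}) gA giA e v x).
Proof.
move=> hgA hgiA; elim: e V v x => [t|r t rt|a e IHe|e1 IH1 e2 IH2|e1 IH1 e2 IH2] V v x hv /=.
- exact: hv.
- have h1 y z : rep (fun p => tmetric g i p y z) (hmet giA y z).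
    by case: y => [[a|]|]; case: z => [[b|]|] //= q Wq; rewrite ?sf0 ?sf1 //; exact: in_image.
  have h2 y z : rep (fun p => tmetric_inv g i p y z) (hmet_inv gA y z).
    by case: y => [[a|]|]; case: z => [[b|]|] //= q Wq; rewrite ?sf0 ?sf1 //; exact: in_image.
  apply: repM => //; apply: rep_sum => B; apply: rep_sum => C; exact: repM.
- by apply: repM; [exact: rep_cst|exact: IHe].
- by apply: repD; [exact: IH1|exact: IH2].
- by apply: (IH1 (fun p => endo_act g i p e2 (V p))) => y; exact: IH2.
Qed.

Lemma y_op_section w (V : tfield M n) : is_section c Phi w V ->
  is_section c Phi (w - 1) (y_op sigma w V).
Proof.
move=> sV; have [_ _ _ Ve] := sV.
(* A local representative of y V, available because I^2 has no zeros, provides both the smoothness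
   and the symmetry type. *)
have H g i : c g -> let W := chart_dom i in let Uo : open (chart_coord i @` W) := @image_open _ _ _ i in
   exists gA giA (u : X -> smooth_function Uo),
     [/\ forall a b, rep (fun p => g i p a b) (gA a b),
         forall a b, rep (fun p => ginv g i p a b) (giA a b),
         forall x, rep (fun p => y_op sigma w V g i p x) (u x) &
         forall e, Phi e -> endo (sf_cst Uo : {rmorphism R -> smooth_function Uo}) gA giA e u = fun=> 0].
  move=> cg W Uo.
  have Wi : W `<=` chart_dom i by [].
  pose D := @sf_partial _ _ _ Uo.
  pose io := sf_cst Uo : {rmorphism R -> smooth_function Uo}.
  have hD : derivations io D := sf_derivations Uo.
    have [gA [giA [hgA hgiA mp]]] := own_metric_rep Uo Wi cg.
  have [s hs] := sigma_rep Uo Wi cg.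
  have [v hv] := section_rep Uo Wi sV cg.
  have HE f u b : rep f u -> rep (pd i b f) (D b u) by exact: rep_pd.
  have hIq := rep_Isq HE hgA hgiA hs.
  have [iI hiI] : exists iI : smooth_function Uo, rep (fun p => (Isq sigma g i p)^-1) iI.
    apply: smooth_rep => //; apply: (@smooth_on_inv _ _ _ (Isq sigma g i \o chart_param i)) => //.
      exact: rep_smooth hIq.
    by move=> _ [p ip <-] /=; rewrite chart_coordK //; exact: hI.
  have hy x : rep (fun p => y_op sigma w V g i p x)
      (- iI * IdD io D gA giA (tnab D (tcon io D gA giA)) s (io w) v x).
    by apply: repM; [exact: repN|exact: rep_IdotD].
  exists gA, giA, (fun x => - iI * IdD io D gA giA (tnab D (tcon io D gA giA)) s (io w) v x).
  split=> // e Phie.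
  have [_ eM] := endo_linear io gA giA e.
  have ev : endo io gA giA e v = fun=> 0.
    apply/funext => x; apply: (rep_eq (rep_endo e x hgA hgiA hv)) => p ip.
    by rewrite sf0; exact: Ve.
  (* Natural endomorphisms being parallel, they can be moved inside I.D, where they annihilate [v];
     that I.D maps 0 to 0 is homogeneity for the constant 0. *)
  have eP a V' : tnab D (tcon io D gA giA) a (endo io gA giA e V') =
      endo io gA giA e (tnab D (tcon io D gA giA) a V') by exact: (endo_parallel hD mp).
  apply/funext => x; rewrite (eM (- iI)).
  rewrite -(IdD_parallel io D gA giA s (io w) v x (endo_linear io gA giA e) eP) ev.
  have := IdD_const gA giA s hD (tnab_connection n hD (tcon io D gA giA)) (io w) 0 (fun=> 0) x.
  move=> E; apply: etrans (mulr0 (- iI)); congr (_ * _); apply: etrans (etrans E _).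
    by congr (IdD _ _ _ _ _ _ _ _ x); apply/funext => y; rewrite mulr0.
  by rewrite rmorph0 mul0r.
split.
- move=> g i x cg; have [gA [giA [u [_ _ hu _]]]] := H g i cg.
  exact: rep_smooth (hu x).
- move=> g i j p x cg ip jp; exact: y_op_chart.
- move=> g g' om cg cg' som resc i p x ip; exact: y_op_scale.
- move=> g i p e x cg ip Phie; have [gA [giA [u [hgA hgiA hu he]]]] := H g i cg.
  by rewrite (rep_endo e x hgA hgiA hu ip) he // sf0.
Qed.

End Sections.

(** * Iteration *)

Section Iterates.
Variables (R : realType) (d : nat) (hd : (3 <= d)%N) (M : smooth_manifold R d).
Variables (c : set (metric M)) (sigma : density M).
Hypothesis hAR : almost_riemannian c sigma.
Hypothesis hI : forall (g : metric M) (i : chart M) (p : M),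
  c g -> chart_dom i p -> Isq sigma g i p != 0.
Variables (n : nat) (Phi : set (natural_endo R n)).
Local Notation X := (tindex d n).

Lemma endo_act_linear (g : metric M) (i : chart M) p (e : natural_endo R n) r (V W : tensor R d n) :
  endo_act g i p e (fun x => r * V x + W x) =
  fun x => r * endo_act g i p e V x + endo_act g i p e W x.
Proof.
elim: e V W => [t|k t kt|a e IHe|e1 IH1 e2 IH2|e1 IH1 e2 IH2] V W //=; apply/funext => x.
- have -> : \sum_B \sum_C tmetric g i p B C * (r * V (upd (upd x k B) t C) + W (upd (upd x k B) t C)) =
      r * (\sum_B \sum_C tmetric g i p B C * V (upd (upd x k B) t C)) +
      \sum_B \sum_C tmetric g i p B C * W (upd (upd x k B) t C).
    rewrite mulr_sumr -big_split; apply: eq_bigr => B _ /=.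
    by rewrite mulr_sumr -big_split; apply: eq_bigr => C _ /=; ring.
  by ring.
- by rewrite IHe; ring.
- by rewrite IH1 IH2; ring.
- by rewrite IH2 IH1.
Qed.

Lemma section_linear w r (V W : tfield M n) : is_section c Phi w V -> is_section c Phi w W ->
  is_section c Phi w (fun g i p x => r * V g i p x + W g i p x).
Proof.
have sum_lin (F : X -> R) (f h : X -> R) :
    \sum_y F y * (r * f y + h y) = r * \sum_y F y * f y + \sum_y F y * h y.
  by rewrite mulr_sumr -big_split; apply: eq_bigr => y _ /=; ring.
move=> [Vs Vc Vr Ve] [Ws Wc Wr We]; split.
- move=> g i x cg; have Uo := @image_open _ _ M i.
  exact: (smooth_onD Uo (smooth_onM Uo (smooth_on_cst r Uo) (Vs g i x cg)) (Ws g i x cg)).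
- move=> g i j p x cg ip jp; rewrite (Vc g i j p x cg ip jp) (Wc g i j p x cg ip jp).
  by rewrite sum_lin.
- move=> g g' om cg cg' som resc i p x ip.
  rewrite (Vr g g' om cg cg' som resc i p x ip) (Wr g g' om cg cg' som resc i p x ip).
  by rewrite sum_lin; ring.
- move=> g i p e x cg ip Phie; rewrite endo_act_linear.
  by rewrite (Ve g i p e x cg ip Phie) (We g i p e x cg ip Phie) mulr0 addr0.
Qed.

Lemma section_x w (V : tfield M n) : is_section c Phi w V ->
  is_section c Phi (w + 1) (x_op sigma V).
Proof.
move=> [Vs Vc Vr Ve]; have [_ [ss sr] _] := hAR; split.
- move=> g i x cg; exact: (smooth_onM (@image_open _ _ M i) (ss g cg i) (Vs g i x cg)).
- move=> g i j p x cg ip jp; rewrite /x_op (Vc g i j p x cg ip jp) mulr_sumr.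
  by apply: eq_bigr => y _; rewrite mulrCA.
- move=> g g' om cg cg' som resc i p x ip.
  rewrite /x_op (Vr g g' om cg cg' som resc i p x ip) (sr g g' om cg cg' som resc) mulrDl expRD.
  under [in RHS]eq_bigr do rewrite mulrCA.
  by rewrite -mulr_sumr; ring.
- move=> g i p e x cg ip Phie.
  have E : x_op sigma V g i p = fun y => sigma g p * V g i p y + (fun=> 0) y.
    by apply/funext => y; rewrite addr0.
  have E0 : endo_act g i p e (fun=> 0) x = 0 :> R.
    have Z0 : (fun=> 0) = (fun=> -1 * 0 + 0) :> tensor R d n by apply/funext => y; rewrite mulr0 addr0.
    by rewrite Z0 (endo_act_linear g i p e (-1) (fun=> 0) (fun=> 0)) mulN1r addNr.
  by rewrite E endo_act_linear (Ve g i p e x cg ip Phie) mulr0 add0r.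
Qed.

Lemma section_zero w (V : tfield M n) : is_section c Phi w V ->
  is_section c Phi w (fun _ _ _ _ => 0).
Proof.
move=> sV; have := section_linear (-1) sV sV.
congr (is_section _ _ _ _); apply/funext => g; apply/funext => i; apply/funext => p.
by apply/funext => x; rewrite mulN1r addNr.
Qed.

(** [f_iter] for an arbitrary list of indices, which makes induction over the factors possible. *)
Definition c_iter (w0 : R) (f0 : tfield M n) (s : seq nat) : tfield M n :=
  foldr (fun (j : nat) V => fun g i p x =>
    (j%:R * (d%:R + 2 * w0 - j%:R - 1))^-1 * c_op sigma j%:Z w0 V g i p x) f0 s.

(** The divisor is the scalar part of c_j at weight w0, so each normalised factor is 1 + q x y.
    Every partial product therefore differs from [f0] by sigma times a section, and the two claims
    go through the induction together. *)
Lemma c_iter_section w0 (f0 : tfield M n) s : is_section c Phi w0 f0 ->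
  (forall j, j \in s -> j%:R * (d%:R + 2 * w0 - j%:R - 1) != 0 :> R) ->
  is_section c Phi w0 (c_iter w0 f0 s) /\
  exists2 G, is_section c Phi (w0 - 1) G &
    forall g i p x, c_iter w0 f0 s g i p x = f0 g i p x + sigma g p * G g i p x.
Proof.
move=> sf; have yf V w : is_section c Phi w V -> is_section c Phi (w - 1) (y_op sigma w V).
  exact: y_op_section.
elim: s => [|j s IHs] qs.
  split=> //; exists (fun _ _ _ _ => 0); first exact: section_zero (yf _ _ sf).
  by move=> g i p x; rewrite mulr0 addr0.
have [|sV [G sG hG]] := IHs.
  by move=> k ks; apply: qs; rewrite inE ks orbT.
have qj := qs j (mem_head j s).
pose q : R := (j%:R * (d%:R + 2 * w0 - j%:R - 1))^-1.
have E : c_iter w0 f0 (j :: s) = fun g i p x =>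
    q * x_op sigma (y_op sigma w0 (c_iter w0 f0 s)) g i p x + c_iter w0 f0 s g i p x.
  apply/funext => g; apply/funext => i; apply/funext => p; apply/funext => x /=.
  transitivity (q * x_op sigma (y_op sigma w0 (c_iter w0 f0 s)) g i p x +
      (q * (j%:R * (d%:R + 2 * w0 - j%:R - 1))) * c_iter w0 f0 s g i p x).
    by rewrite /c_op /h_op -/(c_iter w0 f0 s) (_ : (j%:Z)%:~R = j%:R :> R) // -/q; ring.
  by rewrite mulVf // mul1r.
split.
  rewrite E; apply: section_linear => //.
  by rewrite -[w0](subrK 1); apply: section_x; rewrite subrK; exact: yf.
exists (fun g i p x => q * y_op sigma w0 (c_iter w0 f0 s) g i p x + G g i p x).
  by apply: section_linear => //; exact: yf.
by move=> g i p x; rewrite E hG /x_op; ring.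
Qed.

Fixpoint y_pow (k : nat) (w0 : R) (f0 : tfield M n) : tfield M n :=
  if k is k'.+1 then y_op sigma (w0 - k'%:R) (y_pow k' w0 f0) else f0.

Lemma y_pow_section k w0 (f0 : tfield M n) : is_section c Phi w0 f0 ->
  is_section c Phi (w0 - k%:R) (y_pow k w0 f0).
Proof.
move=> sf; elim: k => [|k IHk]; first by rewrite subr0.
by rewrite -natr1 opprD addrA; exact: y_op_section.
Qed.

(** Within one chart y and c_j are represented by [yop] and [cop], and the identity is [yop_iter]
    read through [rep]. *)
Lemma y_op_c_iter w0 (f0 : tfield M n) l g i p x : is_section c Phi w0 f0 -> c g -> chart_dom i p ->
  y_op sigma w0 (c_iter w0 f0 (iota 1 l)) g i p x =
  sigma g p ^+ l * ((\prod_(j <- iota 1 l) (j%:R * (d%:R + 2 * w0 - j%:R - 1))^-1) *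
    y_pow l.+1 w0 f0 g i p x).
Proof.
move=> sf cg ip.
pose W := chart_dom i.
have Wi : W `<=` chart_dom i by [].
pose Uo : open (chart_coord i @` W) := @image_open _ _ _ i.
pose D := @sf_partial _ _ _ Uo.
pose io := sf_cst Uo : {rmorphism R -> smooth_function Uo}.
have hD : derivations io D := sf_derivations Uo.
have [gA [giA [hgA hgiA mp]]] := own_metric_rep hAR Uo Wi cg.
have [s hs] := sigma_rep hAR Uo Wi cg.
have [v hv] := section_rep Uo Wi sf cg.
have HE f u b : rep f u -> rep (pd i b f) (D b u) by exact: rep_pd.
have hIq := rep_Isq HE hgA hgiA hs.
have [iI hiI] : exists iI : smooth_function Uo, rep (fun p => (Isq sigma g i p)^-1) iI.
  apply: smooth_rep => //; apply: (@smooth_on_inv _ _ _ (Isq sigma g i \o chart_param i)) => //.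
    exact: rep_smooth hIq.
  by move=> _ [q iq <-] /=; rewrite chart_coordK //; exact: hI.
have hI1 : iI * Iq io D gA giA s = 1.
  apply: (rep_eq (repM hiI hIq)) => q Wq.
  by rewrite mulVf ?hI // sf1 //; exact: in_image.
pose nb := @tnab _ d n D (tcon io D gA giA).
have hc : connection D nb := tnab_connection n hD (tcon io D gA giA).
have d0 : (0 < d)%N by apply: leq_trans hd.
have hy w (V : tfield M n) (u : X -> smooth_function Uo) y :
    (forall y, rep (fun p => V g i p y) (u y)) ->
    rep (fun p => y_op sigma w V g i p y) (yop io D gA giA nb s iI w u y).
  by move=> Vu; apply: repM; [exact: repN|exact: rep_IdotD].
have hcop (j : nat) (V : tfield M n) (u : X -> smooth_function Uo) y :
    (forall y, rep (fun p => V g i p y) (u y)) ->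
    rep (fun p => c_op sigma j%:Z w0 V g i p y) (cop io D gA giA nb s iI j w0 u y).
  move=> Vu; have hj : rep (fun=> j%:R) (j%:R : smooth_function Uo).
    by move=> q Wq; rewrite sf_natE //; exact: in_image.
  apply: repD; first by apply: repM => //; exact: hy.
  apply: repM => //; apply: repD; last exact: repN.
  apply: repD; first by apply: repM => //; exact: rep_cst.
  by apply: repN; exact: repM.
pose q (j : nat) : R := (j%:R * (d%:R + 2 * w0 - j%:R - 1))^-1.
have hiter t y : rep (fun p => c_iter w0 f0 t g i p y)
    (foldr (fun j V x => io (q j) * cop io D gA giA nb s iI j w0 V x) v t y).
  elim: t y => [|j t IHt] y; first exact: hv.
  by apply: repM; [exact: rep_cst|exact: hcop].
have hpow k y : rep (fun p => y_pow k w0 f0 g i p y) (ypow io D gA giA nb s iI k w0 v y).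
  by elim: k y => [|k IHk] y; [exact: hv|exact: hy].
rewrite (hy w0 _ _ x (hiter (iota 1 l)) p ip).
rewrite (yop_iter hD mp hc d0 hI1 w0 v q l) [RHS]mulrCA.
have hsl k : rep (fun p => sigma g p ^+ k) (s ^+ k).
  by elim: k => [|k IHk] q' Wq'; rewrite ?sf1 ?exprS ?sfM -?IHk -?hs //; exact: in_image.
have R1 := repM (rep_cst Uo (\prod_(j <- iota 1 l) q j)) (repM (hsl l) (hpow l.+1 x)).
exact: (esym (R1 p ip)).
Qed.

End Iterates.

Theorem proposition2p21 (R : realType) (d : nat) (hd : (3 <= d)%N)
    (M : smooth_manifold R d) (c : set (metric M)) (sigma : density M)
    (hAR : almost_riemannian c sigma)
    (hI : forall (g : metric M) (i : chart M) (p : M),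
      c g -> chart_dom i p -> Isq sigma g i p != 0)
    (n : nat) (Phi : set (natural_endo R n)) (w0 : R)
    (f f0 : tfield M n) (hf0 : is_section c Phi w0 f0)
    (hext : forall (g : metric M) (i : chart M) (p : M) A,
      c g -> chart_dom i p -> zero_locus c sigma p ->
      f0 g i p A = f g i p A)
    (hh0 : forall m : nat, (2 <= m)%N -> d%:R + 2 * w0 != m%:R)
    (l : nat) (hl : (1 <= l)%N) :
  (exists2 fs : nat -> tfield M n,
     agree c (fs 0%N) f0 /\
     (forall k : nat, (k <= l)%N -> is_section c Phi (w0 - k%:R) (fs k)) &
     O_sigma c sigma Phi w0 l.+1
       (fun g i p A => f_iter sigma w0 f0 l g i p A
          - \sum_(k < l.+1) sigma g p ^+ k * fs k g i p A)) /\
  O_sigma c sigma Phi (w0 - 1) l (y_op sigma w0 (f_iter sigma w0 f0 l)).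
Proof.
have zero k : is_section c Phi (w0 - k%:R) (fun _ _ _ _ => 0).
  exact: section_zero (y_pow_section hd hAR hI k hf0).
split.
  have [|_ [G sG hG]] := @c_iter_section _ _ hd _ _ _ hAR hI n Phi w0 f0 (iota 1 l) hf0.
    move=> j; rewrite mem_iota => /andP[j1 _].
    (* For j >= 1 the divisor could vanish only if h0 = j + 1, an integer >= 2. *)
    rewrite mulf_neq0 ?pnatr_eq0 -?lt0n // -addrA -opprD natr1 subr_eq0.
    exact: hh0.
  (* Since f^(l) = f0 + sigma [G] exactly, [G] serves as f_1, and the later coefficients as well as
     the remainder are zero. *)
  exists (fun k => if k is k'.+1 then if k' is _.+1 then fun _ _ _ _ => 0 else G else f0).
    split=> // -[|[|k]] _; [by rewrite subr0|exact: sG|exact: zero].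
  exists (fun _ _ _ _ => 0); first exact: zero.
  move=> g i p x cg ip; rewrite mulr0 [f_iter _ _ _ _ _ _ _ _]hG.
  (* As l >= 1, the terms of index 0 and 1 both occur in the sum. *)
  case: l hl {hG} => [//|l _]; rewrite !big_ord_recl /= big1 => [|k _]; last by rewrite mulr0.
  by rewrite expr0 expr1 mul1r addr0 subrr.
pose r : R := \prod_(j <- iota 1 l) (j%:R * (d%:R + 2 * w0 - j%:R - 1))^-1.
(* The cofactor of sigma^l is a constant times y^(l+1) f0, of weight w0 - (l + 1) = (w0 - 1) - l. *)
exists (fun g i p x => r * y_pow sigma l.+1 w0 f0 g i p x + 0).
  have -> : w0 - 1 - l%:R = w0 - l.+1%:R by rewrite -natr1; ring.
  exact: section_linear (y_pow_section hd hAR hI l.+1 hf0) (zero _).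
move=> g i p x cg ip; rewrite addr0; exact: (y_op_c_iter hd hAR hI l x hf0 cg ip).
Qed.
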